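(* In the setting described in the context (in particular under the Regularity Assumption (A.1)-(A.3) and the Approximation Assumption), let $(\tilde{\mathbf{y}},\tilde{\mathbf{p}},\tilde\theta)\in W_T^{2N}\times\mathcal{R}_\varepsilon$ be an admissible point of $(\mathcal{P}^N_\varepsilon)$, let $\mathcal{J}_N:\mathcal{N}(\tilde\theta)\to[0,\infty)$ be the associated reduced objective functional, and let $\theta\in\mathcal{N}(\tilde\theta)$. With $y_i=Y_i(\theta)$, $p_i=P_i(\theta)$, $\widehat\theta_i$ and the costates $\zeta_i,\kappa_i\in W_T$ as defined in the context, the gradient of $\mathcal{J}_N$ at $\theta$ (the Riesz representative of $\mathcal{J}_N'(\theta)$ in $\mathcal{R}_\varepsilon$) is given by $$\nabla\mathcal{J}_N(\theta)=\sum_{i=1}^N\omega_i\Big(D_\theta\mathcal{F}^\varepsilon_\theta(y_i)^\top\big(\mathbf{g}(y_i)^\top\zeta_i+[D\mathbf{g}(y_i)\kappa_i]^\top p_i\big)+\widehat\theta_i\Big)+\gamma_\varepsilon\theta .$$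
   Context: Setting. Let $n,m\in\mathbb{N}$, $T>0$, $I=(0,T)$, $\bar I=[0,T]$; $W_T=\{y\in L^2(I;\mathbb{R}^n):\dot y\in L^2(I;\mathbb{R}^n)\}$ with $\|y\|_{W_T}^2=\|\dot y\|_{L^2}^2+\|y\|_{L^2}^2$, and $\imath:W_T\to\mathcal{C}(\bar I;\mathbb{R}^n)$ is the continuous embedding. Let $f:\bar I\times\mathbb{R}^n\to\mathbb{R}^n$, $g:\bar I\times\mathbb{R}^n\to\mathbb{R}^{n\times m}$, with Nemytskii operators $\mathbf{f}(y)(t)=f(t,y(t))$, $(\mathbf{g}(y)u)(t)=g(t,y(t))u(t)$. Let $Q_1,Q_2\in\mathbb{R}^{n\times n}$ be symmetric positive semi-definite, $\beta>0$, $y_d\in L^2(I;\mathbb{R}^n)$, and $y_d^T\in\mathbb{R}^n$ a desired terminal state; $\mathbf{Q}_1$ denotes pointwise multiplication by $Q_1$. For $t\in\bar I$ put $$J_t(y,u)=\tfrac12\int_t^T\big(|Q_1(y(s)-y_d(s))|^2+\beta|u(s)|^2\big)\,ds+\tfrac12|Q_2(y(T)-y_d^T)|^2,\qquad J=J_0.$$ For $y_0\in\mathbb{R}^n$, problem $(P_{y_0})$ is: minimize $J(y,u)$ over $(y,u)\in W_T\times L^2(I;\mathbb{R}^m)$ subject to $\dot y=\mathbf{f}(y)+\mathbf{g}(y)u$, $y(0)=y_0$. The value function is $V^*(t_0,y_0)=\inf J_{t_0}(y,u)$ over $y\in H^1(t_0,T;\mathbb{R}^n)$, $u\in L^2(t_0,T;\mathbb{R}^m)$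 with $\dot y=f(\cdot,y)+g(\cdot,y)u$, $y(t_0)=y_0$. $\partial_y,\partial_{yy}=D_{yy}$ denote gradient and Hessian in $y$. $Y_0\subset\mathbb{R}^n$ is compact. Regularity Assumption. (A.1) $f,g$ are twice continuously differentiable, and their Jacobians and Hessians with respect to $y$ are Lipschitz continuous on compact sets, uniformly in $t$. (A.2) There is $M_{Y_0}>0$ such that, with $\widehat M=M_{Y_0}\|\imath\|$, $V^*$ is twice continuously differentiable on $\bar I\times\bar B_{2\widehat M}(0)$ with gradient and Hessian Lipschitz continuous (w.r.t. $y$, uniformly in $t$). Let $\mathcal{F}^*(y)(t)=-\frac1\beta g(t,y(t))^\top\partial_yV^*(t,y(t))$ for $y\in W_T$ with $\|y\|_{W_T}\le2M_{Y_0}$. (A.3) For every $y_0\in Y_0$ there is a unique $y=\mathbf{y}^*(y_0)\in W_T$ with $\dot y=\mathbf{f}(y)+\mathbf{g}(y)\mathcal{F}^*(y)$, $y(0)=y_0$, $\|y\|_{W_T}\le M_{Y_0}$, and $(\mathbf{y}^*(y_0),\mathcal{F}^*(\mathbf{y}^*(y_0)))$ is a minimizer of $(P_{y_0})$. Approximation Assumption. Let $\varepsilon_0>0$. For each $0<\varepsilon\le\varepsilon_0$, $\mathcal{R}_\varepsilon\simeq\mathbb{R}^{N_\varepsilon}$ is a finite-dimensional parameter space with Hilbert norm $\|\cdot\|_{\mathcal{R}_\varepsilon}$, and $(\theta,t,y)\mapsto V^\varepsilon_\theta(t,y)$ belongs to $\mathcal{C}^4(\mathcal{R}_\varepsilon\times\mathbb{R}\times\mathbb{R}^n)$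 with $V^\varepsilon_\theta(T,y)=\frac12|Q_2(y-y_d^T)|^2$ for all $y,\theta$. There are $\theta_\varepsilon\in\mathcal{R}_\varepsilon$ and $c>0$ independent of $\varepsilon$ such that $|V^\varepsilon_{\theta_\varepsilon}-V^*|+|\partial_y(V^\varepsilon_{\theta_\varepsilon}-V^* )|+\|\partial_{yy}(V^\varepsilon_{\theta_\varepsilon}-V^* )\|\le c\varepsilon$ on $\bar I\times\bar B_{2\widehat M}(0)$. Put $F^\varepsilon_\theta(t,y)=-\frac1\beta g(t,y)^\top\partial_yV^\varepsilon_\theta(t,y)$, $\mathcal{F}^\varepsilon_\theta(y)(t)=F^\varepsilon_\theta(t,y(t))$, $\mathcal{V}^\varepsilon_\theta(y)(t)=V^\varepsilon_\theta(t,y(t))$. Finite learning problem. Fix $y_0^1,\dots,y_0^N\in Y_0$, weights $\omega_i>0$, $\gamma_1,\gamma_2\ge0$, $\gamma_\varepsilon>0$, and $\varepsilon>0$ sufficiently small that the problem below has admissible points. Put $$J_\varepsilon(y,p,\theta)=J(y,\mathcal{F}^\varepsilon_\theta(y))+\int_0^T\tfrac{\gamma_1}2|V^\varepsilon_\theta(t,y(t))-J_t(y,\mathcal{F}^\varepsilon_\theta(y))|^2+\tfrac{\gamma_2}2|\partial_yV^\varepsilon_\theta(t,y(t))-p(t)|^2\,dt,$$ $$\mathbf{A}(y,\theta)=D\mathbf{f}(y)^\top+[D\mathbf{g}(y)^\top\mathcal{F}^\varepsilon_\theta(y)],$$ where $D\mathbf{f}(y)^\top$ is pointwise multiplication by $D_yf(t,y(t))^\top$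 and $([D\mathbf{g}(y)^\top u]p)_k=\sum_{i,j}\partial_{y_k}g_{ij}(t,y(t))u_j(t)p_i(t)$. $(\mathcal{P}^N_\varepsilon)$: minimize $\sum_i\omega_iJ_\varepsilon(y_i,p_i,\theta)+\frac{\gamma_\varepsilon}2\|\theta\|^2_{\mathcal{R}_\varepsilon}$ over $y_i,p_i\in W_T$, $\theta\in\mathcal{R}_\varepsilon$ subject to, for $i=1,\dots,N$, $\dot y_i=\mathbf{f}(y_i)+\mathbf{g}(y_i)\mathcal{F}^\varepsilon_\theta(y_i)$, $y_i(0)=y_0^i$, $-\dot p_i=\mathbf{A}(y_i,\theta)p_i+\mathbf{Q}_1^\top\mathbf{Q}_1(y_i-y_d)$, $p_i(T)=Q_2^\top Q_2(y_i(T)-y_d^T)$. Reduced functional. Near an admissible point $(\tilde{\mathbf{y}},\tilde{\mathbf{p}},\tilde\theta)$ there are a neighbourhood $\mathcal{N}(\tilde\theta)$ of $\tilde\theta$ and $\mathcal{C}^1$-mappings $Y_i,P_i:\mathcal{N}(\tilde\theta)\to W_T$, with values in neighbourhoods of $\tilde y_i,\tilde p_i$, obtained from the implicit function theorem, such that for every $\theta\in\mathcal{N}(\tilde\theta)$ and $i=1,\dots,N$ the functions $y_i=Y_i(\theta)$, $p_i=P_i(\theta)$ satisfy the state equation $\dot y_i=\mathbf{f}(y_i)+\mathbf{g}(y_i)\mathcal{F}^\varepsilon_\theta(y_i)$, $y_i(0)=y_0^i$, and the adjoint equation $-\dot p_i=\mathbf{A}(y_i,\theta)p_i+\mathbf{Q}_1^\top\mathbf{Q}_1(y_i-y_d)$,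 $p_i(T)=Q_2^\top Q_2(y_i(T)-y_d^T)$. Put $\mathcal{J}_N(\theta)=\sum_{i=1}^N\omega_iJ_\varepsilon(Y_i(\theta),P_i(\theta),\theta)+\frac{\gamma_\varepsilon}2\|\theta\|^2_{\mathcal{R}_\varepsilon}$. Auxiliary quantities. With $y_i=Y_i(\theta)$, $p_i=P_i(\theta)$, let $J_\bullet(y,u)$ be $t\mapsto J_t(y,u)$, $\Phi_i(t)=\int_0^t(V^\varepsilon_\theta(s,y_i(s))-J_s(y_i,\mathcal{F}^\varepsilon_\theta(y_i)))\,ds$, and $$\widehat y_i=(1-\gamma_1\Phi_i)\mathbf{Q}_1^\top\mathbf{Q}_1(y_i-y_d)+\beta(1-\gamma_1\Phi_i)D_y\mathcal{F}^\varepsilon_\theta(y_i)^\top\mathcal{F}^\varepsilon_\theta(y_i)+\gamma_1(\mathcal{V}^\varepsilon_\theta(y_i)-J_\bullet(y_i,\mathcal{F}^\varepsilon_\theta(y_i)))\partial_y\mathcal{V}^\varepsilon_\theta(y_i)+\gamma_2D_{yy}\mathcal{V}^\varepsilon_\theta(y_i)(\partial_y\mathcal{V}^\varepsilon_\theta(y_i)-p_i),$$ $$\widehat y_i^T=(1-\gamma_1\Phi_i(T))Q_2^\top Q_2(y_i(T)-y_d^T),\qquad \widehat p_i=\gamma_2(p_i-\partial_y\mathcal{V}^\varepsilon_\theta(y_i)),$$ $$\widehat\theta_i=\int_0^T\Big[\gamma_1D_\theta V^\varepsilon_\theta(t,y_i)^\top(V^\varepsilon_\theta(t,y_i)-J_t(y_i,\mathcal{F}^\varepsilon_\theta(y_i)))+\beta(1-\gamma_1\Phi_i(t))D_\theta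 F^\varepsilon_\theta(t,y_i)^\top F^\varepsilon_\theta(t,y_i)+\gamma_2D_{y\theta}V^\varepsilon_\theta(t,y_i)^\top(\partial_yV^\varepsilon_\theta(t,y_i)-p_i)\Big]dt,$$ with $y_i=y_i(t)$, $p_i=p_i(t)$ in the integrand. The costates $\zeta_i,\kappa_i\in W_T$ solve $$-\dot\zeta_i=\mathbf{A}(y_i,\theta)\zeta_i+D_y\mathcal{F}^\varepsilon_\theta(y_i)^\top\mathbf{g}(y_i)^\top\zeta_i+[D_y\mathbf{A}(y_i,\theta)^\top p_i]\kappa_i+\mathbf{Q}_1^\top\mathbf{Q}_1\kappa_i+\widehat y_i,\quad \dot\kappa_i=\mathbf{A}(y_i,\theta)^\top\kappa_i+\widehat p_i,$$ $\zeta_i(T)=Q_2^\top Q_2\kappa_i(T)+\widehat y_i^T$, $\kappa_i(0)=0$. Notation. Derivatives of Nemytskii operators act pointwise; $D_y\mathcal{F}^\varepsilon_\theta(y)$ is multiplication by $D_yF^\varepsilon_\theta(t,y(t))\in\mathbb{R}^{m\times n}$; $D_\theta$ is the derivative in $\theta$ and $D_{y\theta}V^\varepsilon_\theta$ the $\theta$-derivative of $\partial_yV^\varepsilon_\theta$; $\top$ denotes adjoints with respect to the inner products of $\mathcal{R}_\varepsilon$, $\mathbb{R}^k$ and $L^2$. $[D\mathbf{g}(y)\kappa]$ is the matrix function with entries $\sum_k\partial_{y_k}g_{ij}(t,y(t))\kappa_k(t)$. $[D_y\mathbf{A}(y,\theta)\delta y]p$ is the derivative of $y\mapsto\mathbf{A}(y,\theta)p$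 in direction $\delta y$, and $[D_y\mathbf{A}(y,\theta)^\top p]$ is the adjoint of $\delta y\mapsto[D_y\mathbf{A}(y,\theta)\delta y]p$. *)

(* Defs.v *)
From HB Require Import structures.
From mathcomp Require Import all_boot all_order all_algebra.
From mathcomp Require Import all_classical all_reals all_analysis.
Set Implicit Arguments.
Unset Strict Implicit.
Unset Printing Implicit Defensive.
Import Order.TTheory GRing.Theory Num.Theory.
Import numFieldNormedType.Exports.
Local Open Scope classical_set_scope.
Local Open Scope ring_scope.

(* Vectors are columns.  The library norm `| _ | on matrices is the sup norm;
   it is only used where equivalent norms are interchangeable. *)
Definition dotv (R : realType) k (x y : 'cV[R]_k) : R :=
  \sum_(i < k) x i 0 * y i 0.

(* Euclidean norm of a vector, Frobenius norm of a matrix. *)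
Definition enorm (R : realType) k l (A : 'M[R]_(k, l)) : R :=
  Num.sqrt (\sum_(i < k) \sum_(j < l) A i j ^+ 2).

Definition psd (R : realType) n (Q : 'M[R]_n) : Prop :=
  Q^T = Q /\ forall x : 'cV[R]_n, 0 <= dotv x (Q *m x).

Definition pd (R : realType) k (W : normedModType R) (i : 'I_k)
    (h : 'cV[R]_k -> W) (x : 'cV[R]_k) : W :=
  'D_(delta_mx i 0) h x.

Definition grad (R : realType) k (h : 'cV[R]_k -> R) (x : 'cV[R]_k) : 'cV[R]_k :=
  \col_i pd i h x.

(* The library's [jacobian] is for row vectors acting on the right. *)
Definition Jac (R : realType) k l (h : 'cV[R]_k -> 'cV[R]_l) (x : 'cV[R]_k)
    : 'M[R]_(l, k) :=
  \matrix_(i, j) pd j (fun z => h z i 0) x.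

Definition is_fderiv_on (R : realType) (U W : normedModType R) (K : set U)
    (F : U -> W) (x : U) (L : U -> W) : Prop :=
  [/\ linear L, continuous L &
      forall e : R, 0 < e ->
        \forall z \near within K (nbhs x),
          `|F z - F x - L (z - x)| <= e * `|z - x|].

(* C^k regularity up to the boundary, meant for finite-dimensional U and convex
   K with nonempty interior (so that the derivative relative to K is unique):
   the derivative relative to K, evaluated in any fixed direction, is again
   C^(k-1) on K. *)
Fixpoint Ck_on (R : realType) (U W : normedModType R) (k : nat) (K : set U)
    (F : U -> W) : Prop :=
  {within K, continuous F} /\
  if k is k'.+1 then
    exists DF : U -> U -> W,
      (forall x, K x -> is_fderiv_on K F x (DF x)) /\
      (forall v, Ck_on k' K (fun x => DF x v))
  else True.

Definition grad_on (R : realType) k (K : set 'cV[R]_k) (h : 'cV[R]_k -> R)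
    (x : 'cV[R]_k) : 'cV[R]_k :=
  xget 0 [set v | is_fderiv_on K h x (dotv v)].

Definition hess_on (R : realType) k (K : set 'cV[R]_k) (h : 'cV[R]_k -> R)
    (x : 'cV[R]_k) : 'M[R]_k :=
  xget 0 [set H | is_fderiv_on K (grad_on K h) x (mulmx H)].

Definition inner_product (R : realType) d (ip : 'cV[R]_d -> 'cV[R]_d -> R) : Prop :=
  [/\ forall x y, ip x y = ip y x,
      forall (a : R) x y z, ip (a *: x + y) z = a * ip x z + ip y z &
      forall x, x != 0 -> 0 < ip x x].

Definition gram (R : realType) d (ip : 'cV[R]_d -> 'cV[R]_d -> R) : 'M[R]_d :=
  \matrix_(i, j) ip (delta_mx i 0) (delta_mx j 0).

(* Adjoint of h |-> M *m h from ('cV_d, ip) to R^k with the Euclidean inner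
   product; see [adjP]. *)
Definition adj (R : realType) d k (ip : 'cV[R]_d -> 'cV[R]_d -> R)
    (M : 'M[R]_(k, d)) : 'M[R]_(d, k) :=
  invmx (gram ip) *m M^T.

Lemma inner_productE (R : realType) d (ip : 'cV[R]_d -> 'cV[R]_d -> R)
    (hip : inner_product ip) (x y : 'cV[R]_d) :
  ip x y = dotv x (gram ip *m y).
Proof.
case: hip => ipC ipl _.
have ip0 z : ip 0 z = 0.
  have := ipl 1 0 0 z; rewrite scale1r mul1r addr0 => h.
  by apply: (addrI (ip 0 z)); rewrite addr0 -h.
have ips (v : 'I_d -> 'cV[R]_d) (c : 'I_d -> R) z :
    ip (\sum_i c i *: v i) z = \sum_i c i * ip (v i) z.
  apply: (big_ind2 (fun a b => ip a z = b)) => [|a b u w <- <-|i _].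
  - exact: ip0.
  - by have := ipl 1 a u z; rewrite scale1r mul1r.
  - by rewrite -[_ *: _]addr0 ipl ip0 addr0.
have cE (z : 'cV[R]_d) : z = \sum_i z i 0 *: delta_mx i 0.
  by rewrite {1}[z]matrix_sum_delta; apply: eq_bigr => i _; rewrite big_ord1.
rewrite {1}[x]cE ips /dotv; apply: eq_bigr => i _; congr (_ * _).
rewrite ipC {1}[y]cE ips !mxE; apply: eq_bigr => j _.
by rewrite !mxE mulrC ipC.
Qed.

Lemma gram_unit (R : realType) d (ip : 'cV[R]_d -> 'cV[R]_d -> R) :
  inner_product ip -> gram ip \in unitmx.
Proof.
move=> hip; have [_ _ ip_gt0] := hip.
rewrite -unitmx_tr -row_free_unit -kermx_eq0; apply/eqP/row_matrixP => i.
rewrite row0; set v := row i _.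
have : v *m (gram ip)^T = 0 by rewrite -row_mul mulmx_ker row0.
move=> /(congr1 trmx); rewrite trmx_mul trmxK trmx0 => Gv.
have [v0|/ip_gt0] := eqVneq v^T 0; first by rewrite -[v]trmxK v0 trmx0.
rewrite inner_productE // Gv /dotv big1 ?ltxx // => j _.
by rewrite [X in _ * X]mxE mulr0.
Qed.

Lemma adjP (R : realType) d k (ip : 'cV[R]_d -> 'cV[R]_d -> R)
    (M : 'M[R]_(k, d)) (w : 'cV[R]_k) (h : 'cV[R]_d) : inner_product ip ->
  ip (adj ip M *m w) h = dotv w (M *m h).
Proof.
have dotE l (a b : 'cV[R]_l) : dotv a b = (a^T *m b) 0 0.
  by rewrite /dotv !mxE; apply: eq_bigr => i _; rewrite mxE.
move=> hip; have [ipC _ _] := hip.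
rewrite ipC inner_productE // /adj -mulmxA mulKVmx ?gram_unit //.
rewrite !dotE; have -> : w^T *m (M *m h) = (h^T *m (M^T *m w))^T.
  by rewrite !trmx_mul !trmxK mulmxA.
by rewrite [RHS]mxE.
Qed.

Definition is_gradient (R : realType) d (ip : 'cV[R]_d -> 'cV[R]_d -> R)
    (J : 'cV[R]_d -> R) (x v : 'cV[R]_d) : Prop :=
  differentiable J x /\ forall h, 'd J x h = ip v h.

Definition vint (R : realType) k (a b : R) (v : R -> 'cV[R]_k) : 'cV[R]_k :=
  \col_i (\int[lebesgue_measure]_(t in `[a, b]) v t i 0)%R.

Definition sint (R : realType) (a b : R) (v : R -> R) : R :=
  (\int[lebesgue_measure]_(t in `[a, b]) v t)%R.

(* Functions are total on R; only their values on [a, b] matter. *)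
Definition L2 (R : realType) k (a b : R) (v : R -> 'cV[R]_k) : Prop :=
  (forall i, measurable_fun `[a, b] (fun t => v t i 0)) /\
  (\int[lebesgue_measure]_(t in `[a, b]) ((enorm (v t) ^+ 2)%:E) < +oo)%E.

Definition L2norm (R : realType) k (a b : R) (v : R -> 'cV[R]_k) : R :=
  Num.sqrt (sint a b (fun t => enorm (v t) ^+ 2)).

(* C^1_c(a, b); testing against these or against C^oo_c(a, b) is equivalent for
   locally integrable functions. *)
Definition test_function (R : realType) (a b : R) (phi : R -> R) : Prop :=
  [/\ forall t, derivable phi t 1, continuous (derive1 phi) &
      exists c d : R, [/\ a < c, d < b & forall t, t \notin `[c, d] -> phi t = 0]].

Definition is_wderiv (R : realType) k (a b : R) (y v : R -> 'cV[R]_k) : Prop :=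
  L2 a b v /\
  forall phi, test_function a b phi ->
    forall i, sint a b (fun t => y t i 0 * derive1 phi t)
              = - sint a b (fun t => v t i 0 * phi t).

(* H^1(a, b), each class being represented by its continuous representative,
   so that point values y(a), y(b) make sense; W_T is [H1 0 T]. *)
Definition H1 (R : realType) k (a b : R) (y : R -> 'cV[R]_k) : Prop :=
  {within `[a, b], continuous y} /\ exists v, is_wderiv a b y v.

Definition wderiv (R : realType) k (a b : R) (y : R -> 'cV[R]_k) : R -> 'cV[R]_k :=
  xget (fun=> 0) [set v | is_wderiv a b y v].

Definition H1norm (R : realType) k (a b : R) (y : R -> 'cV[R]_k) : R :=
  Num.sqrt (L2norm a b (wderiv a b y) ^+ 2 + L2norm a b y ^+ 2).

(* Operator norm of the embedding of W_T into C([0, T]; R^n). *)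
Definition embedding_norm (R : realType) (n : nat) (T : R) : R :=
  sup [set r | exists (y : R -> 'cV[R]_n) (t : R),
         [/\ H1 0 T y, H1norm 0 T y <= 1, t \in `[0, T] & r = enorm (y t)]].

(* Y is C^1 (in the Frechet sense) from the open set U into W_T, with
   derivative D. *)
Definition C1_into_WT (R : realType) d k (T : R) (U : set 'cV[R]_d)
    (Y : 'cV[R]_d -> R -> 'cV[R]_k) : Prop :=
  (forall th, U th -> H1 0 T (Y th)) /\
  exists D : 'cV[R]_d -> 'cV[R]_d -> R -> 'cV[R]_k,
    forall th, U th ->
      [/\ forall h, H1 0 T (D th h),
          forall (a : R) h1 h2, {in `[0, T], forall t,
            D th (a *: h1 + h2) t = a *: D th h1 t + D th h2 t},
          forall e : R, 0 < e -> \forall h \near (0 : 'cV[R]_d),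
            H1norm 0 T (fun t => Y (th + h) t - Y th t - D th h t) <= e * `|h| &
          forall e : R, 0 < e -> \forall th' \near th, forall h,
            H1norm 0 T (fun t => D th' h t - D th h t) <= e * `|h|].

Record control_data (R : realType) (n m : nat) := ControlData {
  horizon : R;
  drift : R -> 'cV[R]_n -> 'cV[R]_n;            (* f *)
  control_map : R -> 'cV[R]_n -> 'M[R]_(n, m);  (* g *)
  Q1 : 'M[R]_n;
  Q2 : 'M[R]_n;
  beta : R;
  y_d : R -> 'cV[R]_n;
  y_dT : 'cV[R]_n }.

Definition control_data_ok (R : realType) n m (P : control_data R n m) : Prop :=
  [/\ 0 < horizon P, psd (Q1 P), psd (Q2 P), 0 < beta P & L2 0 (horizon P) (y_d P)].

(* J_t(y, u) *)
Definition cost_from (R : realType) n m (P : control_data R n m) (t : R)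
    (y : R -> 'cV[R]_n) (u : R -> 'cV[R]_m) : R :=
  2^-1 * sint t (horizon P)
    (fun s => enorm (Q1 P *m (y s - y_d P s)) ^+ 2 + beta P * enorm (u s) ^+ 2)
  + 2^-1 * enorm (Q2 P *m (y (horizon P) - y_dT P)) ^+ 2.

Definition feasible (R : realType) n m (P : control_data R n m) (t0 : R)
    (y0 : 'cV[R]_n) (y : R -> 'cV[R]_n) (u : R -> 'cV[R]_m) : Prop :=
  [/\ H1 t0 (horizon P) y, L2 t0 (horizon P) u,
      is_wderiv t0 (horizon P) y
        (fun t => drift P t (y t) + control_map P t (y t) *m u t) &
      y t0 = y0].

Definition is_minimizer (R : realType) n m (P : control_data R n m)
    (y0 : 'cV[R]_n) (y : R -> 'cV[R]_n) (u : R -> 'cV[R]_m) : Prop :=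
  feasible P 0 y0 y u /\
  forall z w, feasible P 0 y0 z w -> cost_from P 0 y u <= cost_from P 0 z w.

Definition value_fun (R : realType) n m (P : control_data R n m) (t0 : R)
    (y0 : 'cV[R]_n) : \bar R :=
  ereal_inf [set (cost_from P t0 yu.1 yu.2)%:E |
              yu in [set yu | feasible P t0 y0 yu.1 yu.2]].

(* Only meaningful where the value function is finite. *)
Definition Vstar (R : realType) n m (P : control_data R n m) (t : R)
    (y : 'cV[R]_n) : R := fine (value_fun P t y).

Definition closed_loop (R : realType) n m (P : control_data R n m)
    (F : R -> 'cV[R]_n -> 'cV[R]_m) (y0 : 'cV[R]_n) (y : R -> 'cV[R]_n) : Prop :=
  [/\ H1 0 (horizon P) y,
      is_wderiv 0 (horizon P) y
        (fun t => drift P t (y t) + control_map P t (y t) *m F t (y t)) &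
      y 0 = y0].

Definition eball (R : realType) n (r : R) : set 'cV[R]_n := [set y | enorm y <= r].

(* The ball of radius 2 * Mhat, where Mhat = M_{Y_0} * (norm of the embedding). *)
Definition tube (R : realType) n m (P : control_data R n m) (M : R) : set 'cV[R]_n :=
  eball (2 * (M * embedding_norm n (horizon P))).

Definition unif_lipschitz (R : realType) n k l (T : R) (K : set 'cV[R]_n)
    (h : R -> 'cV[R]_n -> 'M[R]_(k, l)) : Prop :=
  exists L : R, forall t y z, t \in `[0, T] -> K y -> K z ->
    enorm (h t y - h t z) <= L * enorm (y - z).

Definition regular_coefficient (R : realType) n k l (T : R)
    (h : R -> 'cV[R]_n -> 'M[R]_(k, l)) : Prop :=
  [/\ Ck_on 2 [set z : R * 'cV[R]_n | z.1 \in `[0, T]] (fun z => h z.1 z.2),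
      forall (K : set 'cV[R]_n) (i : 'I_n), compact K ->
        unif_lipschitz T K (fun t => pd i (h t)) &
      forall (K : set 'cV[R]_n) (i j : 'I_n), compact K ->
        unif_lipschitz T K (fun t => pd j (pd i (h t)))].

Definition Fstar (R : realType) n m (P : control_data R n m) (M : R) (t : R)
    (y : 'cV[R]_n) : 'cV[R]_m :=
  - (beta P)^-1 *: ((control_map P t y)^T *m grad_on (tube P M) (Vstar P t) y).

Definition regularity_assumption (R : realType) n m (P : control_data R n m)
    (Y0 : set 'cV[R]_n) (M : R) : Prop :=
  let T := horizon P in
  let B := tube P M in
  [/\ regular_coefficient T (drift P) /\ regular_coefficient T (control_map P),
      [/\ 0 < M,
          forall t y, t \in `[0, T] -> B y -> value_fun P t y \is a fin_num,
          Ck_on 2 [set z : R * 'cV[R]_n | z.1 \in `[0, T] /\ B z.2]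
                (fun z => Vstar P z.1 z.2),
          unif_lipschitz T B (fun t => grad_on B (Vstar P t)) &
          unif_lipschitz T B (fun t => hess_on B (Vstar P t))] &
      forall y0, Y0 y0 -> exists y,
        [/\ closed_loop P (Fstar P M) y0 y /\ H1norm 0 T y <= M,
            forall z, closed_loop P (Fstar P M) y0 z -> H1norm 0 T z <= M ->
              {in `[0, T], z =1 y} &
            is_minimizer P y0 y (fun t => Fstar P M t (y t))]].

Record value_family (R : realType) (n : nat) := ValueFamily {
  param_dim : R -> nat;
  param_ip : forall eps : R, 'cV[R]_(param_dim eps) -> 'cV[R]_(param_dim eps) -> R;
  V_approx : forall eps : R, 'cV[R]_(param_dim eps) -> R -> 'cV[R]_n -> R }.
Arguments param_ip {R n} v eps _ _.
Arguments V_approx {R n} v eps _ _ _.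

Definition approximation_assumption (R : realType) n m (P : control_data R n m)
    (M eps0 : R) (A : value_family R n) : Prop :=
  let T := horizon P in
  let B := tube P M in
  [/\ 0 < eps0,
      forall eps, 0 < eps <= eps0 ->
        [/\ inner_product (param_ip A eps),
            Ck_on 4 [set: 'cV[R]_(param_dim A eps) * R * 'cV[R]_n]
              (fun z => V_approx A eps z.1.1 z.1.2 z.2) &
            forall th y, V_approx A eps th T y
                         = 2^-1 * enorm (Q2 P *m (y - y_dT P)) ^+ 2] &
      exists2 c : R, 0 < c & forall eps, 0 < eps <= eps0 ->
        exists th : 'cV[R]_(param_dim A eps),
          forall t y, t \in `[0, T] -> B y ->
            let V := V_approx A eps th t in
            `|V y - Vstar P t y|
            + enorm (grad V y - grad_on B (Vstar P t) y)
            + enorm (Jac (grad V) y - hess_on B (Vstar P t) y) <= c * eps].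

Section Learning.
(* V is the family V^eps_theta for a fixed eps, ipd the inner product of the
   parameter space. *)
Context (R : realType) (n m d : nat) (P : control_data R n m).
Context (ipd : 'cV[R]_d -> 'cV[R]_d -> R) (V : 'cV[R]_d -> R -> 'cV[R]_n -> R).

Local Notation T := (horizon P).
Local Notation f := (drift P).
Local Notation g := (control_map P).
Local Notation Q1Q1 := ((Q1 P)^T *m Q1 P).
Local Notation Q2Q2 := ((Q2 P)^T *m Q2 P).

Definition feedback (th : 'cV[R]_d) (t : R) (y : 'cV[R]_n) : 'cV[R]_m :=
  - (beta P)^-1 *: ((g t y)^T *m grad (V th t) y).

(* The matrix of p |-> [Dg(y)^T u] p. *)
Definition DgT (t : R) (y : 'cV[R]_n) (u : 'cV[R]_m) : 'M[R]_n :=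
  \matrix_(k, i) \sum_(j < m) pd k (fun z => g t z i j) y * u j 0.

(* [Dg(y) kappa] *)
Definition Dgdir (t : R) (y kappa : 'cV[R]_n) : 'M[R]_(n, m) :=
  \matrix_(i, j) \sum_(k < n) pd k (fun z => g t z i j) y * kappa k 0.

(* A(y, theta) at time t, as a function of the point y in R^n. *)
Definition Amx (th : 'cV[R]_d) (t : R) (y : 'cV[R]_n) : 'M[R]_n :=
  (Jac (f t) y)^T + DgT t y (feedback th t y).

(* [D_y A(y, theta)^T p]; the dependence of A on y through the feedback is
   differentiated as well. *)
Definition DyAT (th : 'cV[R]_d) (t : R) (y p : 'cV[R]_n) : 'M[R]_n :=
  (Jac (fun z => Amx th t z *m p) y)^T.

Definition state_eq (th : 'cV[R]_d) (y0 : 'cV[R]_n) (y : R -> 'cV[R]_n) : Prop :=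
  closed_loop P (feedback th) y0 y.

Definition adjoint_eq (th : 'cV[R]_d) (y p : R -> 'cV[R]_n) : Prop :=
  [/\ H1 0 T p,
      is_wderiv 0 T p
        (fun t => - (Amx th t (y t) *m p t + Q1Q1 *m (y t - y_d P t))) &
      p T = Q2Q2 *m (y T - y_dT P)].

Definition admissible N (y0s : 'I_N -> 'cV[R]_n) (ys ps : 'I_N -> R -> 'cV[R]_n)
    (th : 'cV[R]_d) : Prop :=
  forall i, state_eq th (y0s i) (ys i) /\ adjoint_eq th (ys i) (ps i).

(* J_t(y, F_theta(y)) *)
Definition cl_cost (th : 'cV[R]_d) (y : R -> 'cV[R]_n) (t : R) : R :=
  cost_from P t y (fun s => feedback th s (y s)).

Definition Jeps (gam1 gam2 : R) (y p : R -> 'cV[R]_n) (th : 'cV[R]_d) : R :=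
  cl_cost th y 0
  + sint 0 T (fun t =>
      gam1 / 2 * `|V th t (y t) - cl_cost th y t| ^+ 2
      + gam2 / 2 * enorm (grad (V th t) (y t) - p t) ^+ 2).

(* Y, P : N(th0) -> (W_T)^N are the C^1 maps parametrizing the solutions of the
   state and adjoint equations near the point (ys, ps, th0). *)
Definition solution_maps N (y0s : 'I_N -> 'cV[R]_n) (ys ps : 'I_N -> R -> 'cV[R]_n)
    (th0 : 'cV[R]_d) (U : set 'cV[R]_d)
    (Ym Pm : 'I_N -> 'cV[R]_d -> R -> 'cV[R]_n) : Prop :=
  [/\ open_nbhs th0 U,
      forall i, C1_into_WT T U (Ym i) /\ C1_into_WT T U (Pm i),
      forall i, {in `[0, T], Ym i th0 =1 ys i} /\ {in `[0, T], Pm i th0 =1 ps i} &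
      forall th, U th -> admissible y0s (Ym^~ th) (Pm^~ th) th].

Definition JN N (om : 'I_N -> R) (gam1 gam2 game : R)
    (Ym Pm : 'I_N -> 'cV[R]_d -> R -> 'cV[R]_n) (th : 'cV[R]_d) : R :=
  \sum_(i < N) om i * Jeps gam1 gam2 (Ym i th) (Pm i th) th
  + game / 2 * ipd th th.

Section Costates.
Context (gam1 gam2 : R) (th : 'cV[R]_d) (y p : R -> 'cV[R]_n).

Local Notation F := (feedback th).
Local Notation DyF t := (Jac (F t) (y t)).
Local Notation DthF t := (Jac (fun th' => feedback th' t (y t)) th).
Local Notation dyV t := (grad (V th t) (y t)).
Local Notation DyyV t := (Jac (grad (V th t)) (y t)).
Local Notation DthV t := ((grad (fun th' => V th' t (y t)) th)^T).
Local Notation DythV t := (Jac (fun th' => grad (V th' t) (y t)) th).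
Local Notation Vgap t := (V th t (y t) - cl_cost th y t).

Definition Phi (t : R) : R := sint 0 t (fun s => Vgap s).

Definition yhat (t : R) : 'cV[R]_n :=
  (1 - gam1 * Phi t) *: (Q1Q1 *m (y t - y_d P t))
  + (beta P * (1 - gam1 * Phi t)) *: ((DyF t)^T *m F t (y t))
  + (gam1 * Vgap t) *: dyV t
  + gam2 *: (DyyV t *m (dyV t - p t)).

Definition yhatT : 'cV[R]_n :=
  (1 - gam1 * Phi T) *: (Q2Q2 *m (y T - y_dT P)).

Definition phat (t : R) : 'cV[R]_n := gam2 *: (p t - dyV t).

Definition thetahat : 'cV[R]_d :=
  vint 0 T (fun t =>
    (gam1 * Vgap t) *: adj ipd (DthV t)
    + (beta P * (1 - gam1 * Phi t)) *: (adj ipd (DthF t) *m F t (y t))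
    + gam2 *: (adj ipd (DythV t) *m (dyV t - p t))).

Definition costate_eqs (zeta kappa : R -> 'cV[R]_n) : Prop :=
  [/\ H1 0 T zeta /\ H1 0 T kappa,
      is_wderiv 0 T zeta (fun t =>
        - (Amx th t (y t) *m zeta t
           + (DyF t)^T *m ((g t (y t))^T *m zeta t)
           + DyAT th t (y t) (p t) *m kappa t
           + Q1Q1 *m kappa t
           + yhat t)),
      is_wderiv 0 T kappa (fun t => (Amx th t (y t))^T *m kappa t + phat t),
      zeta T = Q2Q2 *m kappa T + yhatT &
      kappa 0 = 0].

(* Value at w of the adjoint of the operator dtheta |-> D_theta F_theta(y) dtheta
   from the parameter space to L^2(0, T; R^m). *)
Definition DthetaF_adj (w : R -> 'cV[R]_m) : 'cV[R]_d :=
  vint 0 T (fun t => adj ipd (DthF t) *m w t).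

End Costates.
End Learning.

(* Main.v *)
Require Import Defs.
From HB Require Import structures.
From mathcomp Require Import all_boot all_order all_algebra.
From mathcomp Require Import all_classical all_reals all_analysis.
From mathcomp Require Import measurable_realfun.
From mathcomp Require Import ring lra.
Import Order.TTheory GRing.Theory Num.Theory.
Import numFieldNormedType.Exports.
Set Implicit Arguments.
Unset Strict Implicit.
Unset Printing Implicit Defensive.
Local Open Scope classical_set_scope.
Local Open Scope ring_scope.

(** The gradient is computed with the Lagrangian of the learning problem.

    Fix one trajectory and write y, p for the state and adjoint at the parameter
    th' near th.  Three scalar functions of th' are differentiated at th: the cost
    J_eps; the state equation tested with zeta; the adjoint equation tested with
    kappa.  In the last two, one integration by parts moves the time derivative
    from y, p onto the costates, which leaves point values of y, p and integrals, against
    fixed weights, of y, p and the right-hand sides.  They are constant in th' because y and p solve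
    their equations, hence their formal derivatives are o(h).  Subtracting the first
    one from the formal derivative of J_eps and adding the second one
    (duality_identity) makes all terms in the derivatives dy, dp of the solution maps
    cancel: this is what the costate equations and their boundary conditions are made
    for.  What remains is an integral that is linear in h, and it is the inner product
    of h with the vector of the theorem.  No linearized state or adjoint equation has
    to be derived or solved.

    Differentiability is organized around curve_diff: a family th' |-> phi th' of
    continuous functions on [0, T] that is Frechet differentiable at th for the sup
    norm.  The solution maps have this property because W_T embeds into C([0, T])
    (H1norm_sup, C1_into_WT_curve); it is stable under sums, products, composition
    with functions of (t, th', y) that are C^1 on the strip t in [0, T]
    (curve_diff_comp), and integration against integrable weights
    (curve_diff_tail_int).  The last point is what allows y_d, and the weak derivatives
    of the costates, to be merely square integrable.

    Weak derivatives enter only through weak_primitive: a continuous function is the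
    integral of its weak derivative.  This gives the embedding and the integration by
    parts for pairs of absolutely continuous functions (primitive_mul).  The latter
    also replaces Fubini in the term of J_eps that contains the cost-to-go
    (tail_fubini), which is how the weight 1 - gam1 * Phi arises.

    The Hessian of the approximate value function appears transposed when dy is
    isolated, so its symmetry is needed (schwarz, hessian_sym). *)

(** * Integrals over compact intervals *)

Lemma within_continuousP (R : realType) (U : topologicalType) (W : normedModType R)
    (K : set U) (F : U -> W) :
  {within K, continuous F} <->
  forall x, K x -> forall e, 0 < e ->
    \forall y \near x, K y -> `|F x - F y| <= e.
Proof.
split=> [/subspace_continuousP h x Kx e e0|h].
  by have /cvgrPdist_le /(_ e e0) := h x Kx.
by apply/subspace_continuousP => x Kx; apply/cvgrPdist_le => e e0; exact: h.
Qed.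

Section Integral.
Context {R : realType}.
Implicit Types (f g v w z : R -> R) (a b c s t T : R).
Local Notation mu := (@lebesgue_measure R).

Definition intg a b f := mu.-integrable `[a, b] (EFin \o f).

Definition cont_on a b f := {within `[a, b], continuous f}.

Lemma intg_eq a b f g : (forall t, t \in `[a, b] -> f t = g t) ->
  intg a b f -> intg a b g.
Proof.
move=> fg; apply: eq_integrable => //= t; rewrite inE => tab.
by rewrite /= fg.
Qed.

Lemma intgD a b f g : intg a b f -> intg a b g -> intg a b (fun t => f t + g t).
Proof. move=> fi gi; have := integrableD _ fi gi; exact. Qed.

Lemma intgZ a b (k : R) f : intg a b f -> intg a b (fun t => k * f t).
Proof. by move=> fi; have := integrableZl _ k fi; exact. Qed.

Lemma intgN a b f : intg a b f -> intg a b (fun t => - f t).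
Proof. by move=> fi; have := integrableN fi; exact. Qed.

Lemma intgB a b f g : intg a b f -> intg a b g -> intg a b (fun t => f t - g t).
Proof. by move=> fi gi; apply: intgD => //; exact: intgN. Qed.

Lemma intg_norm a b f : intg a b f -> intg a b (fun t => `|f t|).
Proof. by move=> fi; exact: integrable_norm. Qed.

Lemma intg_sub a b c d f : a <= c -> d <= b -> intg a b f -> intg c d f.
Proof.
move=> ac db; apply: integrableS => //=.
by apply: subset_itv; rewrite bnd_simp.
Qed.

Lemma cont_intg a b f : cont_on a b f -> intg a b f.
Proof.
by move=> fc; apply: continuous_compact_integrable => //; exact: segment_compact.
Qed.

Lemma intg0 a b : intg a b (fun=> 0).
Proof. exact: integrable0. Qed.

Lemma intg_sum (I : Type) (r : seq I) a b (F : I -> R -> R) :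
  (forall i, intg a b (F i)) -> intg a b (fun t => \sum_(i <- r) F i t).
Proof.
move=> Fi; elim: r => [|i r IH].
  by apply: intg_eq (intg0 a b) => t _; rewrite big_nil.
by apply: intg_eq (intgD (Fi i) IH) => t _; rewrite big_cons.
Qed.

Lemma cont_bounded a b f : cont_on a b f ->
  exists2 C, 0 < C & forall t, t \in `[a, b] -> `|f t| <= C.
Proof.
move=> fc; have := continuous_compact fc (segment_compact (a:=a) (b:=b)).
move=> /compact_bounded[M [_ hM]]; exists (`|M| + 1).
  by rewrite ltr_wpDl.
move=> t tab; apply: (hM (`|M| + 1)); last by exists t.
by rewrite (le_lt_trans (ler_norm _))// ltrDl.
Qed.

Lemma cont_meas a b f : cont_on a b f -> measurable_fun `[a, b] f.
Proof. by move=> fc; apply: subspace_continuous_measurable_fun. Qed.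

Lemma intgM a b w f : intg a b w -> cont_on a b f ->
  intg a b (fun t => w t * f t).
Proof.
move=> wi fc.
have bf : [bounded f x | x in `[a, b]].
  have [C _ hC] := cont_bounded fc.
  exists C; split; rewrite ?num_real// => x Cx t /= tab.
  by rewrite (le_trans (hC t tab))// ltW.
by have := integrableMl _ wi (cont_meas fc) bf; exact.
Qed.

Lemma eq_sint a b f g : (forall t, t \in `[a, b] -> f t = g t) ->
  sint a b f = sint a b g.
Proof. by move=> fg; apply: eq_Rintegral => t; rewrite inE => /fg. Qed.

Lemma sintD a b f g : intg a b f -> intg a b g ->
  sint a b (fun t => f t + g t) = sint a b f + sint a b g.
Proof. exact: RintegralD. Qed.

Lemma sintZ a b k f : intg a b f -> sint a b (fun t => k * f t) = k * sint a b f.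
Proof. exact: RintegralZl. Qed.

Lemma sintN a b f : intg a b f -> sint a b (fun t => - f t) = - sint a b f.
Proof.
move=> fi; rewrite -mulN1r -sintZ//.
by apply: eq_sint => t _; rewrite mulN1r.
Qed.

Lemma sintB a b f g : intg a b f -> intg a b g ->
  sint a b (fun t => f t - g t) = sint a b f - sint a b g.
Proof. exact: RintegralB. Qed.

Lemma sint0 a b : sint a b (fun=> 0) = 0.
Proof.
rewrite -[RHS](mul0r (sint a b (fun=> 0))) -sintZ; last exact: intg0.
by apply: eq_sint => t _; rewrite mul0r.
Qed.

Lemma sint_sum (I : Type) (r : seq I) a b (F : I -> R -> R) :
  (forall i, intg a b (F i)) ->
  sint a b (fun t => \sum_(i <- r) F i t) = \sum_(i <- r) sint a b (F i).
Proof.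
move=> Fi; elim: r => [|i r IH].
  by rewrite big_nil -[RHS](sint0 a b); apply: eq_sint => t _; rewrite big_nil.
rewrite big_cons -IH -sintD//; last exact: intg_sum.
by apply: eq_sint => t _; rewrite big_cons.
Qed.

Lemma sint_cst a b k : a <= b -> sint a b (fun=> k) = k * (b - a).
Proof.
move=> ab; rewrite /sint Rintegral_cst//= lebesgue_measure_itv/= lte_fin.
move: ab; rewrite le_eqVlt => /predU1P[->|->]; last by [].
by rewrite ltxx subrr mulr0.
Qed.

Lemma sintxx a f : sint a a f = 0.
Proof. by rewrite /sint set_itv1 Rintegral_set1. Qed.

Lemma sint_le a b f g : intg a b f -> intg a b g ->
  (forall t, t \in `[a, b] -> f t <= g t) -> sint a b f <= sint a b g.
Proof. by move=> fi gi fg; exact: le_Rintegral. Qed.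

Lemma sint_ge0 a b f : (forall t, t \in `[a, b] -> 0 <= f t) -> 0 <= sint a b f.
Proof. by move=> f0; exact: Rintegral_ge0. Qed.

Lemma sint_norm a b f : intg a b f -> `|sint a b f| <= sint a b (fun t => `|f t|).
Proof. by move=> fi; exact: le_normr_Rintegral. Qed.

Lemma sint_cat a c b f : a <= c <= b -> intg a b f ->
  sint a b f = sint a c f + sint c b f.
Proof.
move=> /andP[ac cb] fi; apply/eqP; rewrite addrC -subr_eq; apply/eqP.
rewrite /sint Rintegral_itvB ?bnd_simp// Rintegral_itv_obnd_cbnd//.
apply: integrableS fi => //=; apply: subset_itvr.
by rewrite bnd_simp.
Qed.

Lemma sint_sub a b c d f : a <= c -> d <= b -> intg a b f ->
  (forall t, t \in `[a, b] -> 0 <= f t) -> c <= d -> sint c d f <= sint a b f.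
Proof.
move=> ac db fi f0 cd.
rewrite (@sint_cat a c b)// ?ac ?(le_trans cd)//.
rewrite (@sint_cat c d b) ?cd//; last exact: intg_sub fi.
rewrite addrCA lerDl addr_ge0// sint_ge0// => t; rewrite in_itv/= => /andP[h1 h2];
  apply: f0; rewrite in_itv/=.
  by rewrite h1 (le_trans h2)// (le_trans cd).
by rewrite h2 (le_trans _ h1)// (le_trans ac).
Qed.

Lemma sint_mul_le a b w f C : intg a b w -> intg a b (fun t => w t * f t) ->
  (forall t, t \in `[a, b] -> `|f t| <= C) ->
  `|sint a b (fun t => w t * f t)| <= C * sint a b (fun t => `|w t|).
Proof.
move=> wi wfi fC; apply: (le_trans (sint_norm wfi)).
rewrite -sintZ; last exact: intg_norm.
apply: sint_le => [||t tab]; [exact: intg_norm|exact/intgZ/intg_norm|].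
by rewrite normrM mulrC ler_wpM2r// fC.
Qed.

Lemma cont_on_eq a b f g : (forall t, t \in `[a, b] -> f t = g t) ->
  cont_on a b f -> cont_on a b g.
Proof.
move=> fg /within_continuousP fc; apply/within_continuousP => x xab e e0.
have := fc x xab e e0; apply: filterS => t h tab.
by rewrite -!fg//; exact: h.
Qed.

Lemma cont_on_cst a b k : cont_on a b (fun=> k).
Proof. by move=> x; exact: cvg_cst. Qed.

Lemma cont_onD a b f g : cont_on a b f -> cont_on a b g ->
  cont_on a b (fun t => f t + g t).
Proof. by move=> fc gc x; apply: cvgD; [exact: fc|exact: gc]. Qed.

Lemma cont_onB a b f g : cont_on a b f -> cont_on a b g ->
  cont_on a b (fun t => f t - g t).
Proof. by move=> fc gc x; apply: cvgB; [exact: fc|exact: gc]. Qed.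

Lemma cont_onM a b f g : cont_on a b f -> cont_on a b g ->
  cont_on a b (fun t => f t * g t).
Proof. by move=> fc gc x; apply: cvgM; [exact: fc|exact: gc]. Qed.

Lemma cont_on_sum (I : Type) (r : seq I) a b (F : I -> R -> R) :
  (forall i, cont_on a b (F i)) -> cont_on a b (fun t => \sum_(i <- r) F i t).
Proof.
move=> Fi; elim: r => [|i r IH].
  apply: (@cont_on_eq a b (fun=> 0)); last exact: cont_on_cst.
  by move=> t _; rewrite big_nil.
apply: (@cont_on_eq a b (fun t => F i t + \sum_(j <- r) F j t)).
  by move=> t _; rewrite big_cons.
exact: cont_onD.
Qed.

End Integral.

Section Primitive.
Context {R : realType} (T : R).
Implicit Types (v w z u : R -> R) (s t : R).
Local Notation mu := (@lebesgue_measure R).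

(** Absolute continuity of z on [0, T] with density v, which is what being in W_T
   amounts to for one component. *)
Definition primitive z v := intg 0 T v /\
  forall s t, 0 <= s -> s <= t -> t <= T -> z t - z s = sint s t v.

Lemma primitive_unif z v : 0 <= T -> primitive z v -> forall e, 0 < e ->
  exists2 dl, 0 < dl & forall s t, 0 <= s -> s <= t -> t <= T -> t - s < dl ->
    `|z t - z s| <= e.
Proof.
move=> T0 [vi zv] e e0.
pose f := v \_ `[0, T].
have fi : mu.-integrable setT (EFin \o f).
  by rewrite /f -restrict_EFin; apply/integrable_restrict => //=; rewrite setTI.
have [dl [dl0 h]] := integral_normr_continuous fi e0.
exists dl => // s t s0 st tT tsdl; rewrite zv//.
have vi' : intg s t v by apply: intg_sub vi.
apply: (le_trans (sint_norm vi')).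
have -> : sint s t (fun x => `|v x|) = \int[mu]_(x in `[s, t]) `|f x|.
  apply: eq_Rintegral => x; rewrite inE/= in_itv/= => /andP[sx xt].
  by rewrite /f patchE ifT// inE/= in_itv/= (le_trans s0)//= (le_trans xt).
apply/ltW/h => //=; rewrite lebesgue_measure_itv/= lte_fin.
by case: ifP => // _; rewrite -EFinD lte_fin.
Qed.

Lemma primitive_cont z v : 0 <= T -> primitive z v -> cont_on 0 T z.
Proof.
move=> T0 zv.
apply/within_continuousP => x /=; rewrite in_itv/= => /andP[x0 xT] e e0.
have [dl dl0 h] := primitive_unif T0 zv e0.
near=> y; rewrite in_itv/= => /andP[y0 yT].
have xy : `|x - y| < dl by near: y; exact: (@cvgr_dist_lt _ R R^o).
have [le_xy|/ltW le_yx] := leP x y.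
  by rewrite distrC; apply: h => //; rewrite -(ger0_norm (_ : 0 <= y - x)) ?subr_ge0// distrC.
by apply: h => //; rewrite -(ger0_norm (_ : 0 <= x - y)) ?subr_ge0.
Unshelve. all: by end_near. Qed.

Lemma primitive_sint v : intg 0 T v -> primitive (fun t => sint 0 t v) v.
Proof.
move=> vi; split=> // s t s0 st tT.
rewrite (@sint_cat _ 0 s t) ?s0 ?st//; last exact: intg_sub vi.
by rewrite addrAC subrr add0r.
Qed.

Hypothesis T0 : 0 < T.

Lemma cont_tail v : intg 0 T v -> cont_on 0 T (fun t => sint t T v).
Proof.
move=> vi; apply: (@cont_on_eq _ 0 T (fun t => sint 0 T v - sint 0 t v)).
  by move=> t; rewrite in_itv/= => tT; rewrite (sint_cat tT vi) addrAC subrr add0r.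
apply: cont_onB; first exact: cont_on_cst.
by apply: primitive_cont (primitive_sint vi); exact: ltW.
Qed.

(** Integration by parts for absolutely continuous functions.  The defect
   D s t := z t * w t - z s * w s - (integral of the product rule over [s, t]) is
   additive over adjacent intervals and, written as an integral of v * (w t - w) and
   u * (z s - z), is at most e times the integral of |v| + |u| on short intervals.
   Summing over a fine mesh gives D 0 T = 0. *)
Lemma primitive_mul z v w u : primitive z v -> primitive w u ->
  z T * w T - z 0 * w 0 = sint 0 T (fun t => v t * w t + u t * z t).
Proof.
move=> zv wu; have [vi zE] := zv; have [ui wE] := wu.
have zc := primitive_cont (ltW T0) zv; have wc := primitive_cont (ltW T0) wu.
have gi : intg 0 T (fun t => v t * w t + u t * z t).
  by apply: intgD; exact: intgM.
have ni : intg 0 T (fun t => `|v t| + `|u t|) by apply: intgD; exact: intg_norm.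
set g := fun t => v t * w t + u t * z t in gi *.
pose C := sint 0 T (fun t => `|v t| + `|u t|).
pose D s t := z t * w t - z s * w s - sint s t g.
suff D0 : D 0 T = 0 by apply/eqP; rewrite -subr_eq0; apply/eqP.
have C0 : 0 <= C by apply: sint_ge0 => t _; rewrite addr_ge0.
suff key e : 0 < e -> `|D 0 T| <= e * C.
  apply/eqP; rewrite -normr_le0; apply/ler_addgt0Pr => e e0; rewrite add0r.
  have C1 : 0 < C + 1 by rewrite ltr_wpDl.
  apply: (le_trans (key (e / (C + 1)) _)); first exact: divr_gt0.
  by rewrite -mulrA ler_piMr ?(ltW e0)// mulrC ler_pdivrMr// mul1r lerDl.
move=> e0.
have [d1 d10 h1] := primitive_unif (ltW T0) zv e0.
have [d2 d20 h2] := primitive_unif (ltW T0) wu e0.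
have loc s t : 0 <= s -> s <= t -> t <= T -> t - s < Num.min d1 d2 ->
    `|D s t| <= e * sint s t (fun x => `|v x| + `|u x|).
  move=> s0 st tT; rewrite lt_min => /andP[td1 td2].
  have sub f : intg 0 T f -> intg s t f by exact: intg_sub.
  have subc f : cont_on 0 T f -> cont_on s t f.
    apply: continuous_subspaceW; apply: subset_itv; rewrite bnd_simp//.
  have pt x : x \in `[s, t] -> [/\ 0 <= x, x <= T, s <= x & x <= t].
    rewrite in_itv/= => /andP[sx xt].
    by rewrite sx xt (le_trans s0 sx) (le_trans xt tT).
  have DE : D s t = sint s t (fun x => v x * (w t - w x))
                    + sint s t (fun x => u x * (z s - z x)).
    rewrite /D.
    have -> : sint s t g = sint s t (fun x => v x * w x) + sint s t (fun x => u x * z x).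
      by rewrite sintD//; apply: intgM; [exact: sub|exact: subc|exact: sub|exact: subc].
    have -> : sint s t (fun x => v x * (w t - w x)) =
        w t * sint s t v - sint s t (fun x => v x * w x).
      rewrite -sintZ ?sub// -sintB; [|exact/intgZ/sub|by apply: intgM; [exact: sub|exact: subc]].
      by apply: eq_sint => x _; rewrite mulrBr mulrC.
    have -> : sint s t (fun x => u x * (z s - z x)) =
        z s * sint s t u - sint s t (fun x => u x * z x).
      rewrite -sintZ ?sub// -sintB; [|exact/intgZ/sub|by apply: intgM; [exact: sub|exact: subc]].
      by apply: eq_sint => x _; rewrite mulrBr mulrC.
    by rewrite -zE// -wE//; ring.
  have cstc (c : R) f : cont_on 0 T f -> cont_on s t (fun x => c - f x).
    move=> /subc fc x; apply: cvgB; [exact: cvg_cst|exact: fc].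
  rewrite DE sintD; [|exact/intg_norm/sub|exact/intg_norm/sub].
  rewrite mulrDr (le_trans (ler_normD _ _))// lerD//; apply: sint_mul_le.
  - exact: sub.
  - by apply: intgM; [exact: sub|exact: cstc].
  - move=> x /pt[x0 xT sx xt]; apply: h2 => //.
    by apply: le_lt_trans td2; rewrite lerD2l lerN2.
  - exact: sub.
  - by apply: intgM; [exact: sub|exact: cstc].
  - move=> x /pt[x0 xT sx xt]; rewrite distrC; apply: h1 => //.
    by apply: le_lt_trans td1; rewrite lerD2r.
pose dl := Num.min d1 d2; have dl0 : 0 < dl by rewrite lt_min d10.
have [N hN] : exists N : nat, T / N.+1%:R < dl.
  exists (Num.truncn (T / dl)); rewrite ltr_pdivrMr ?ltr0n// mulrC.
  rewrite -ltr_pdivrMr//.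
  by have /andP[_] := truncn_itv (ltW (divr_gt0 T0 dl0)).
(* the mesh points *)
pose x k : R := T / N.+1%:R * k%:R.
have x0 k : 0 <= x k by rewrite mulr_ge0// divr_ge0// ltW.
have xT k : (k <= N.+1)%N -> x k <= T.
  move=> kN; rewrite /x mulrAC ler_pdivrMr ?ltr0n// ler_wpM2l ?(ltW T0)//.
  by rewrite ler_nat.
have x_le k : x k <= x k.+1.
  by rewrite /x ler_wpM2l ?ler_nat// divr_ge0// ltW.
suff H k : (k <= N.+1)%N -> `|D 0 (x k)| <= e * sint 0 (x k) (fun x => `|v x| + `|u x|).
  have := H N.+1 (leqnn _).
  by rewrite /x mulfVK ?pnatr_eq0.
elim: k => [_|k IH kN].
  by rewrite /x mulr0 /D sintxx subrr subr0 normr0 sintxx mulr0.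
have cat f : intg 0 T f -> sint 0 (x k.+1) f = sint 0 (x k) f + sint (x k) (x k.+1) f.
  by move=> fi; apply: sint_cat; [rewrite x0 x_le|apply: intg_sub fi => //; exact: xT].
have -> : D 0 (x k.+1) = D 0 (x k) + D (x k) (x k.+1).
  by rewrite /D cat//; ring.
rewrite cat// mulrDr (le_trans (ler_normD _ _))// lerD//.
  exact/IH/ltnW.
apply: loc => //; first exact: xT.
by rewrite /x -mulrBr -natrB// subSnn mulr1.
Qed.

End Primitive.

(** * Weak derivatives *)

(** The o(h) form of the derivative, which avoids handling difference quotients. *)
Lemma is_derive_epsP (R : realType) (V W : normedModType R) (F : V -> W) x v l :
  (forall e : R, 0 < e ->
     \forall h \near (0 : R), `|F (x + h *: v) - F x - h *: l| <= e * `|h|) ->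
  is_derive x v F l.
Proof.
move=> H.
have cv : h^-1 *: ((F \o shift x) (h *: v) - F x) @[h --> 0^'] --> l.
  apply/cvgrPdist_le => e e0.
  rewrite near_withinE; near=> h => h0.
  have hF : `|F (x + h *: v) - F x - h *: l| <= e * `|h| by near: h; exact: H.
  have nh : 0 < `|h| by rewrite normr_gt0.
  rewrite -(ler_pM2r nh) (le_trans _ hF)// mulrC -normrZ distrC /=.
  by rewrite scalerBr scalerA divff// scale1r [h *: v + x]addrC.
apply: DeriveDef; first by apply/cvg_ex; exists l.
by rewrite /derive; exact: cvg_lim cv.
Unshelve. all: by end_near. Qed.

Section SmoothStep.
Context {R : realType}.
Implicit Types (x s e : R).

(* The square of the positive part is C^1; a second difference of it is a C^1 step
   whose derivative is a tent function, in closed form. *)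
Let pos x := Num.max 0 x.

Let pos2_taylor (x h : R) :
  `|pos (x + h) ^+ 2 - pos x ^+ 2 - 2 * pos x * h| <= h ^+ 2.
Proof.
rewrite ler_norml /pos.
by case: (leP 0 x) => ?; case: (leP 0 (x + h)) => ?; apply/andP; split; nra.
Qed.

Let pos_lip (x y : R) : `|pos x - pos y| <= `|x - y|.
Proof.
rewrite ler_norml /pos; case: (ler0P (x - y)) => ?;
case: (leP 0 x) => ?; case: (leP 0 y) => ?; apply/andP; split; lra.
Qed.

(** C^1 transition from 0 to 1 on [s, s + 2 e]. *)
Definition smooth_step e s x : R :=
  (2 * e ^+ 2)^-1 * (pos (x - s) ^+ 2 - 2 * pos (x - s - e) ^+ 2
                     + pos (x - s - 2 * e) ^+ 2).

(** The derivative of smooth_step: an approximate Dirac mass at s, as e tends to 0. *)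
Definition tent e s x : R :=
  (e ^+ 2)^-1 * (pos (x - s) - 2 * pos (x - s - e) + pos (x - s - 2 * e)).

Lemma is_derive_step e s x : 0 < e -> is_derive x 1 (smooth_step e s) (tent e s x).
Proof.
move=> e0; apply: is_derive_epsP => eta eta0.
set C := (2 * e ^+ 2)^-1 * 4.
have C0 : 0 < C by rewrite mulr_gt0// invr_gt0 mulr_gt0// exprn_gt0.
near=> h.
have he : `|h| <= eta / C.
  rewrite -[h]subr0 distrC; near: h.
  by apply: (@cvgr_dist_le _ R R^o) => //; exact: divr_gt0.
rewrite /GRing.scale/= mulr1.
apply: (@le_trans _ _ (C * h ^+ 2)); last first.
  by rewrite -(real_normK (num_real h)) expr2 mulrA ler_wpM2r// mulrC -ler_pdivlMr.
have h1 := pos2_taylor (x - s) h.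
have h2 := pos2_taylor (x - s - e) h.
have h3 := pos2_taylor (x - s - 2 * e) h.
have -> : smooth_step e s (x + h) - smooth_step e s x - h * tent e s x =
  (2 * e ^+ 2)^-1 *
   ((pos (x - s + h) ^+ 2 - pos (x - s) ^+ 2 - 2 * pos (x - s) * h)
    - 2 * (pos (x - s - e + h) ^+ 2 - pos (x - s - e) ^+ 2 - 2 * pos (x - s - e) * h)
    + (pos (x - s - 2 * e + h) ^+ 2 - pos (x - s - 2 * e) ^+ 2
       - 2 * pos (x - s - 2 * e) * h)).
  rewrite /smooth_step /tent.
  rewrite (_ : x + h - s = x - s + h); last by ring.
  rewrite (_ : x - s + h - e = x - s - e + h); last by ring.
  rewrite (_ : x - s + h - 2 * e = x - s - 2 * e + h); last by ring.
  by field; rewrite gt_eqF.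
rewrite normrM gtr0_norm ?invr_gt0 ?mulr_gt0 ?exprn_gt0// /C -[leRHS]mulrA.
rewrite ler_wpM2l//; first by rewrite invr_ge0 pmulr_rge0// sqr_ge0.
move: h1 h2 h3; rewrite !ler_norml => /andP[? ?] /andP[? ?] /andP[? ?];
  apply/andP; split; lra.
Unshelve. all: by end_near. Qed.

Lemma tent_ge0 e s x : 0 < e -> 0 <= tent e s x.
Proof.
move=> e0; rewrite /tent mulr_ge0 ?invr_ge0 ?sqr_ge0// /pos.
by case: (leP 0 (x - s)) => ?; case: (leP 0 (x - s - e)) => ?;
  case: (leP 0 (x - s - 2 * e)) => ?; lra.
Qed.

Lemma tent_out e s x : 0 < e -> x \notin `[s, s + 2 * e] -> tent e s x = 0.
Proof.
move=> e0; rewrite in_itv/= /tent negb_and -!ltNge => h.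
apply/eqP; rewrite mulf_eq0 invr_eq0 sqrf_eq0 gt_eqF//= /pos; apply/eqP.
by case: (leP 0 (x - s)) => ?; case: (leP 0 (x - s - e)) => ?;
  case: (leP 0 (x - s - 2 * e)) => ?; case/orP: h => ?; lra.
Qed.

Lemma step_left e s x : 0 < e -> x <= s -> smooth_step e s x = 0.
Proof.
move=> e0 xs; rewrite /smooth_step /pos.
by rewrite !max_l; [ring|lra|lra|lra].
Qed.

Lemma step_right e s x : 0 < e -> s + 2 * e <= x -> smooth_step e s x = 1.
Proof.
move=> e0 xs; rewrite /smooth_step /pos.
rewrite !max_r; [|lra|lra|lra].
by field; rewrite gt_eqF.
Qed.

Lemma cont_tent e s : 0 < e -> continuous (tent e s).
Proof.
move=> e0 x; apply/cvgrPdist_le => eta eta0.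
set C := (e ^+ 2)^-1 * 4.
have C0 : 0 < C by rewrite mulr_gt0// invr_gt0 exprn_gt0.
near=> y.
have xy : `|x - y| <= eta / C.
  by near: y; apply: (@cvgr_dist_le _ R R^o) => //; exact: divr_gt0.
apply: (@le_trans _ _ (C * `|x - y|)); last by rewrite mulrC -ler_pdivlMr.
have h1 := pos_lip (x - s) (y - s).
have h2 := pos_lip (x - s - e) (y - s - e).
have h3 := pos_lip (x - s - 2 * e) (y - s - 2 * e).
rewrite /tent -mulrBr normrM gtr0_norm ?invr_gt0 ?exprn_gt0// /C -[leRHS]mulrA.
rewrite ler_wpM2l ?invr_ge0 ?sqr_ge0//.
rewrite (_ : x - s - (y - s) = x - y) in h1; last by ring.
rewrite (_ : x - s - e - (y - s - e) = x - y) in h2; last by ring.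
rewrite (_ : x - s - 2 * e - (y - s - 2 * e) = x - y) in h3; last by ring.
by move: h1 h2 h3; rewrite !(ler_norml _ `|x - y|) => /andP[? ?] /andP[? ?] /andP[? ?];
  rewrite ler_norml; apply/andP; split; lra.
Unshelve. all: by end_near. Qed.

End SmoothStep.

Lemma sint_derive (R : realType) (a b : R) (F f : R -> R) : a < b ->
  continuous f -> (forall t : R, is_derive t 1 F (f t)) -> sint a b f = F b - F a.
Proof.
move=> ab fc Ff; rewrite /sint /Rintegral.
have Fc : continuous F.
  by move=> t; apply: differentiable_continuous; apply/derivable1_diffP; case: (Ff t).
rewrite (@continuous_FTC2 R f F a b)//=.
- by move=> t; exact: continuous_subspaceT.
- split; [by move=> t _; case: (Ff t)| |].
    exact/cvg_at_right_filter/Fc.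
  exact/cvg_at_left_filter/Fc.
- by move=> t _; rewrite derive1E; case: (Ff t).
Qed.

Section WeakDerivative.
Context {R : realType} (T : R) (T0 : 0 < T).
Implicit Types (z v w : R -> R) (e s t eta : R).

Let tent_mean w e s eta : 0 < e -> 0 < s -> s + 2 * e < T -> cont_on 0 T w ->
  (forall x, x \in `[s, s + 2 * e] -> `|w x - w s| <= eta) ->
  `|sint 0 T (fun t => w t * tent e s t) - w s| <= eta.
Proof.
move=> e0 s0 sT wc h.
have tc : cont_on 0 T (tent e s) by apply: continuous_subspaceT; exact: cont_tent.
have ti : intg 0 T (tent e s) by exact: cont_intg.
have t1 : sint 0 T (tent e s) = 1.
  have -> := sint_derive T0 (@cont_tent _ e s e0) (fun t => @is_derive_step _ e s t e0).
  by rewrite step_right ?step_left ?subr0// ltW.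
have -> : sint 0 T (fun t => w t * tent e s t) - w s
        = sint 0 T (fun t => tent e s t * (w t - w s)).
  rewrite -[X in _ - X]mulr1 -t1 -sintZ// -sintB; last 2 first.
  - by apply: intgM => //; exact: cont_intg.
  - exact: intgZ.
  by apply: eq_sint => t _; rewrite mulrBr mulrC [tent _ _ _ * w s]mulrC.
have wc' : cont_on 0 T (fun t => w t - w s).
  by move=> x; apply: cvgB; [exact: wc|exact: cvg_cst].
have twi : intg 0 T (fun t => tent e s t * (w t - w s)) by exact: intgM.
apply: (le_trans (sint_norm twi)).
rewrite -[leRHS]mulr1 -t1 -sintZ//; apply: sint_le => [||t _].
- exact: intg_norm.
- exact: intgZ.
rewrite normrM ger0_norm; last exact: tent_ge0.
have [tin|tout] := boolP (t \in `[s, s + 2 * e]).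
  by rewrite mulrC ler_wpM2r ?tent_ge0// h.
by rewrite tent_out// mul0r mulr0.
Qed.

(** du Bois-Reymond.  For s < t the difference of two smooth steps at s and t is a
   test function, and its derivative is a difference of two approximate Dirac masses;
   hence w s = w t in the limit.  The end points follow by continuity. *)
Lemma weak_constant w : cont_on 0 T w ->
  (forall phi, test_function 0 T phi -> sint 0 T (fun t => w t * derive1 phi t) = 0) ->
  forall s t, s \in `[0, T] -> t \in `[0, T] -> w s = w t.
Proof.
move=> wc h.
suff inner s t : 0 < s -> s < t -> t < T -> w s = w t.
  pose c := w (T / 2).
  have inner' s : 0 < s -> s < T -> w s = c.
    move=> s0 sT; have [sh|hs|->//] := ltgtP s (T / 2).
      by apply: inner => //; lra.
    by apply/esym/inner => //; lra.
  suff all s : s \in `[0, T] -> w s = c by move=> s t /all -> /all ->.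
  move=> sT; apply/eqP; rewrite -subr_eq0 -normr_le0.
  apply/ler_addgt0Pr => e e0; rewrite add0r.
  have /within_continuousP /(_ s sT e e0) := wc.
  move=> /nbhs_ballP[dl /= dl0 hdl].
  move: sT; rewrite in_itv/= => /andP[s0 sT].
  pose r := Num.min (dl / 2) (T / 4).
  have r0 : 0 < r by rewrite lt_min !divr_gt0.
  have [r1 r2] : r <= dl / 2 /\ r <= T / 4 by rewrite /r !ge_min !lexx orbT.
  clearbody r; have [x [x0 xT xs]] : exists x, [/\ 0 < x, x < T & `|s - x| < dl].
    have [sh|hs] := leP s (T / 2).
      by exists (s + r); split; [lra|lra|rewrite ltr_norml; apply/andP; split; lra].
    by exists (s - r); split; [lra|lra|rewrite ltr_norml; apply/andP; split; lra].
  have xI : x \in `[0, T] by rewrite in_itv/= !ltW.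
  by have := hdl x xs xI; rewrite (inner' x x0 xT).
move=> s0 st tT; apply/eqP; rewrite -subr_eq0 -normr_le0.
apply/ler_addgt0Pr => e e0; rewrite add0r.
have osc u : 0 < u -> u < T -> exists2 dl, 0 < dl & forall r, 0 < r -> r < dl ->
    forall x, x \in `[u, u + 2 * r] -> `|w x - w u| <= e / 2.
  move=> u0 uT; have /within_continuousP /(_ u) := wc.
  rewrite /= in_itv/= !ltW// => /(_ isT _ (divr_gt0 e0 (ltr0Sn _ 1))).
  move=> /nbhs_ballP[dl /= dl0 hdl].
  exists (Num.min (dl / 2) ((T - u) / 2)) => [|r r0].
    by rewrite lt_min !divr_gt0// subr_gt0.
  rewrite lt_min => /andP[r1 r2] x; rewrite in_itv/= => /andP[ux xr].
  rewrite distrC; apply: hdl; last by rewrite /= in_itv/=; apply/andP; split; lra.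
  by rewrite /ball/= ler0_norm ?subr_le0//; lra.
have [d1 d10 h1] := osc s s0 (lt_trans st tT).
have [d2 d20 h2] := osc t (lt_trans s0 st) tT.
pose r := Num.min (Num.min d1 d2) ((T - t) / 2) / 2.
have m0 : 0 < Num.min (Num.min d1 d2) ((T - t) / 2).
  by rewrite !lt_min d10 d20 divr_gt0// subr_gt0.
have r0 : 0 < r by rewrite divr_gt0.
have rm : r < Num.min (Num.min d1 d2) ((T - t) / 2).
  by rewrite /r ltr_pdivrMr// ltr_pMr// ltr1n.
move: rm; rewrite !lt_min -andbA => /and3P[r1 r2 r3].
pose phi x := smooth_step r s x - smooth_step r t x.
have dphi (x : R) : is_derive x 1 phi (tent r s x - tent r t x).
  by apply: is_deriveB; exact: is_derive_step.
have phiE : derive1 phi = fun x => tent r s x - tent r t x.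
  by apply/funext => x; rewrite derive1E; case: (dphi x).
have tphi : test_function 0 T phi.
  split.
  - by move=> x; case: (dphi x).
  - by rewrite phiE => x; apply: cvgB; exact: cont_tent.
  - exists s, (t + 2 * r); split=> //; first by lra.
    move=> x; rewrite in_itv/= negb_and -!ltNge /phi => /orP[xs|xt].
      by rewrite !step_left ?subrr// ltW// (lt_trans xs).
    by rewrite !step_right ?subrr// ltW// (lt_trans _ xt)//; lra.
have := h _ tphi; rewrite phiE.
have ti u : intg 0 T (fun x => w x * tent r u x).
  apply: intgM; first exact: cont_intg.
  by apply: continuous_subspaceT; exact: cont_tent.
have -> : sint 0 T (fun x => w x * (tent r s x - tent r t x)) =
  sint 0 T (fun x => w x * tent r s x) - sint 0 T (fun x => w x * tent r t x).
  by rewrite -sintB//; apply: eq_sint => x _; rewrite mulrBr.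
move=> /eqP; rewrite subr_eq0 => /eqP E.
have k1 : `|sint 0 T (fun x => w x * tent r s x) - w s| <= e / 2.
  by apply: tent_mean => //; [lra|exact: h1].
have k2 : `|sint 0 T (fun x => w x * tent r t x) - w t| <= e / 2.
  by apply: tent_mean => //; [lra|lra|exact: h2].
rewrite E in k1.
rewrite (_ : w s - w t = (sint 0 T (fun x => w x * tent r t x) - w t) -
   (sint 0 T (fun x => w x * tent r t x) - w s)); last by ring.
by rewrite (le_trans (ler_normB _ _))// [leRHS]splitr lerD.
Qed.

(** The difference between z and a primitive of v has weak derivative 0: integrating
   by parts against a test function leaves no boundary term. *)
Lemma weak_primitive z v : cont_on 0 T z -> intg 0 T v ->
  (forall phi, test_function 0 T phi ->
     sint 0 T (fun t => z t * derive1 phi t) = - sint 0 T (fun t => v t * phi t)) ->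
  primitive T z v.
Proof.
move=> zc vi h; split=> // s t s0 st tT.
pose V t := sint 0 t v.
have Vp : primitive T V v by exact: primitive_sint.
have Vc : cont_on 0 T V by apply: primitive_cont Vp; exact: ltW.
have wc : cont_on 0 T (fun t => z t - V t).
  by move=> x; apply: cvgB; [exact: zc|exact: Vc].
have test phi : test_function 0 T phi ->
    sint 0 T (fun t => (z t - V t) * derive1 phi t) = 0.
  move=> tphi; have [dphi cphi [c [d [c0 dT phi0]]]] := tphi.
  have cphi' : cont_on 0 T (derive1 phi) by apply: continuous_subspaceT.
  have pp : primitive T phi (derive1 phi).
    split; first exact: cont_intg.
    move=> a b a0 ab bT; move: ab; rewrite le_eqVlt => /predU1P[->|ab].
      by rewrite sintxx subrr.
    have dphi' (x : R) : is_derive x 1 phi (derive1 phi x).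
      by apply: DeriveDef; [exact: dphi|rewrite derive1E].
    by have -> := sint_derive ab cphi dphi'.
  have phic : cont_on 0 T phi by apply: primitive_cont pp; exact: ltW.
  have := primitive_mul T0 Vp pp.
  have phi00 : phi 0 = 0 by apply: phi0; rewrite in_itv/= negb_and -!ltNge c0.
  have phiT0 : phi T = 0 by apply: phi0; rewrite in_itv/= negb_and -!ltNge dT orbT.
  rewrite phi00 phiT0.
  rewrite !mulr0 subr0 => E.
  transitivity (sint 0 T (fun t => z t * derive1 phi t) -
                sint 0 T (fun t => derive1 phi t * V t)).
    rewrite -sintB; last 2 first.
    - by apply: intgM => //; exact: cont_intg.
    - by apply: intgM => //; exact: cont_intg.
    by apply: eq_sint => x _; ring.
  rewrite h// -opprD -sintD; last 2 first.
  - exact: intgM.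
  - by apply: intgM => //; exact: cont_intg.
  by rewrite -E oppr0.
have := weak_constant wc test.
move=> /(_ t s); rewrite !in_itv/= s0 tT (le_trans s0 st) (le_trans st tT).
move=> /(_ isT isT) E.
have [_ /(_ s t s0 st tT) <-] := Vp; lra.
Qed.

End WeakDerivative.

(** * The Sobolev space W_T *)

Section MatrixNorm.
Context {R : realType} {k l : nat}.
Implicit Types (A B : 'M[R]_(k, l)).

Lemma ler_mx_entry A i j : `|A i j| <= `|A|.
Proof. by rewrite [leRHS]mx_normrE; exact: (le_bigmax _ _ (i, j)). Qed.

Lemma ler_mx_norm A c : 0 <= c -> (forall i j, `|A i j| <= c) -> `|A| <= c.
Proof.
by move=> c0 h; rewrite [leLHS]mx_normrE; apply: bigmax_le => // -[i j] _ /=.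
Qed.

Lemma enorm2E A : enorm A ^+ 2 = \sum_i \sum_j A i j ^+ 2.
Proof.
by rewrite /enorm sqr_sqrtr// !sumr_ge0// => i _; rewrite sumr_ge0// => j _; exact: sqr_ge0.
Qed.

Lemma sqr_entry_le A i j : A i j ^+ 2 <= enorm A ^+ 2.
Proof.
rewrite enorm2E (bigD1 i)//= (bigD1 j)//= -addrA lerDl addr_ge0//.
  by apply: sumr_ge0 => ? _; exact: sqr_ge0.
by apply: sumr_ge0 => ? _; apply: sumr_ge0 => ? _; exact: sqr_ge0.
Qed.

Lemma enorm2B_le A B : enorm (A - B) ^+ 2 <= 2 * (enorm A ^+ 2 + enorm B ^+ 2).
Proof.
rewrite !enorm2E -big_split/= mulr_sumr; apply: ler_sum => i _.
rewrite -big_split/= mulr_sumr; apply: ler_sum => j _.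
rewrite !mxE -subr_ge0.
have -> : 2 * (A i j ^+ 2 + B i j ^+ 2) - (A i j - B i j) ^+ 2 = (A i j + B i j) ^+ 2.
  by ring.
exact: sqr_ge0.
Qed.

End MatrixNorm.

Section SobolevPaths.
Context {R : realType}.
Local Notation mu := (@lebesgue_measure R).
Implicit Types (a b s t T : R).

Lemma intg_le a b (f g : R -> R) : measurable_fun `[a, b] f -> intg a b g ->
  (forall t, t \in `[a, b] -> `|f t| <= g t) -> intg a b f.
Proof.
move=> mf gi fg.
have h t : `[a, b]%classic t -> (`|(EFin \o f) t| <= `|(EFin \o g) t|)%E.
  by move=> tab; rewrite /= lee_fin (le_trans (fg t tab))// ler_norm.
by apply: (@le_integrable _ _ _ mu _ _ _ _ _ h gi) => //; exact/measurable_EFinP.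
Qed.

Lemma L2_meas_enorm k a b (v : R -> 'cV[R]_k) : L2 a b v ->
  measurable_fun `[a, b] (fun t => enorm (v t) ^+ 2).
Proof.
move=> [mv _]; apply: (eq_measurable_fun (fun t => \sum_i v t i 0 ^+ 2)).
  by move=> t _; rewrite enorm2E; apply: eq_bigr => i _; rewrite big_ord1.
apply: measurable_sum => i; exact: measurable_funX.
Qed.

(** The finiteness condition in the definition of L2, as integrability. *)
Lemma intg_ge0P a b (f : R -> R) : measurable_fun `[a, b] f ->
  (forall t, 0 <= f t) ->
  intg a b f <-> (\int[mu]_(t in `[a, b]) (f t)%:E < +oo)%E.
Proof.
move=> mf f0.
have -> : (\int[mu]_(t in `[a, b]) (f t)%:E)%E = (\int[mu]_(t in `[a, b]) `|(EFin \o f) t|)%E.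
  by apply: eq_integral => t _ /=; rewrite ger0_norm.
split=> [/integrableP[]//|h]; apply/integrableP; split=> //.
exact/measurable_EFinP.
Qed.

Lemma L2_intg_enorm k a b (v : R -> 'cV[R]_k) : L2 a b v ->
  intg a b (fun t => enorm (v t) ^+ 2).
Proof.
move=> vL; apply/intg_ge0P; [exact: L2_meas_enorm|by move=> t; exact: sqr_ge0|].
by case: vL.
Qed.

(** On a bounded interval |x| <= 1 + x^2 replaces the Cauchy-Schwarz inequality. *)
Lemma L2_intg k a b (v : R -> 'cV[R]_k) i : L2 a b v ->
  intg a b (fun t => v t i 0).
Proof.
move=> vL; have [mv _] := vL.
have gi : intg a b (fun t => 1 + enorm (v t) ^+ 2).
  apply: intgD; last exact: L2_intg_enorm.
  by apply: cont_intg => x; exact: cvg_cst.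
apply: (intg_le (mv i) gi) => t _.
apply: (@le_trans _ _ (1 + v t i 0 ^+ 2)); last by rewrite lerD2l sqr_entry_le.
by rewrite ler_norml; apply/andP; split; nra.
Qed.

Lemma L2B k a b (v w : R -> 'cV[R]_k) : L2 a b v -> L2 a b w ->
  L2 a b (fun t => v t - w t).
Proof.
move=> vL wL; have [mv _] := vL; have [mw _] := wL.
have mB i : measurable_fun `[a, b] (fun t => (v t - w t) i 0).
  apply: (eq_measurable_fun (fun t => v t i 0 - w t i 0)).
    by move=> t _; rewrite !mxE.
  exact: measurable_funB.
split=> //.
have gi : intg a b (fun t => 2 * (enorm (v t) ^+ 2 + enorm (w t) ^+ 2)).
  by apply/intgZ/intgD; exact: L2_intg_enorm.
have mn : measurable_fun `[a, b] (fun t => enorm (v t - w t) ^+ 2).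
  apply: (eq_measurable_fun (fun t => \sum_i (v t - w t) i 0 ^+ 2)).
    by move=> t _; rewrite enorm2E; apply: eq_bigr => i _; rewrite big_ord1.
  by apply: measurable_sum => i; exact: measurable_funX.
apply/intg_ge0P => // [t|]; first exact: sqr_ge0.
by apply: (intg_le mn gi) => t _; rewrite ger0_norm ?sqr_ge0// enorm2B_le.
Qed.

Lemma cont_entry k l a b (y : R -> 'M[R]_(k, l)) i j :
  {within `[a, b], continuous y} -> cont_on a b (fun t => y t i j).
Proof.
move=> /within_continuousP yc; apply/within_continuousP => x xab e e0.
have := yc x xab e e0; apply: filterS => t h tab.
by apply: le_trans (h tab); rewrite (le_trans _ (ler_mx_entry _ i j))// !mxE.
Qed.

Lemma wderiv_primitive k T (y v : R -> 'cV[R]_k) i : 0 < T ->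
  {within `[0, T], continuous y} -> is_wderiv 0 T y v ->
  primitive T (fun t => y t i 0) (fun t => v t i 0).
Proof.
move=> T0 yc [vL h]; apply: weak_primitive => //.
- exact: cont_entry.
- exact: L2_intg.
- by move=> phi tphi; exact: h.
Qed.

Lemma is_wderivB k T (y z v w : R -> 'cV[R]_k) : 0 < T ->
  {within `[0, T], continuous y} -> {within `[0, T], continuous z} ->
  is_wderiv 0 T y v -> is_wderiv 0 T z w ->
  is_wderiv 0 T (fun t => y t - z t) (fun t => v t - w t).
Proof.
move=> T0 yc zc [vL yv] [wL zw]; split; first exact: L2B.
move=> phi tphi i; have [dphi cphi _] := tphi.
have cphi' : cont_on 0 T (derive1 phi) by exact: continuous_subspaceT.
have phic : cont_on 0 T phi.
  apply: continuous_subspaceT => t.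
  by apply: differentiable_continuous; apply/derivable1_diffP.
have int (u : R -> 'cV[R]_k) psi : intg 0 T (fun t => u t i 0) -> cont_on 0 T psi ->
    intg 0 T (fun t => u t i 0 * psi t) by move=> ? ?; exact: intgM.
transitivity (sint 0 T (fun t => y t i 0 * derive1 phi t - z t i 0 * derive1 phi t)).
  by apply: eq_sint => t _; rewrite !mxE mulrBl.
rewrite sintB; last 2 first.
- by apply: int => //; apply/cont_intg/cont_entry.
- by apply: int => //; apply/cont_intg/cont_entry.
have vi : intg 0 T (fun t => v t i 0 * phi t) by apply: int => //; exact: L2_intg.
have wi : intg 0 T (fun t => w t i 0 * phi t) by apply: int => //; exact: L2_intg.
rewrite yv// zw// opprK addrC -opprB -sintB//; congr (- _).
by apply: eq_sint => t _; rewrite !mxE mulrBl.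
Qed.

Lemma H1B k T (y z : R -> 'cV[R]_k) : 0 < T -> H1 0 T y -> H1 0 T z ->
  H1 0 T (fun t => y t - z t).
Proof.
move=> T0 [yc [v yv]] [zc [w zw]]; split; last first.
  by exists (fun t => v t - w t); exact: is_wderivB.
by move=> x; apply: cvgB; [exact: yc|exact: zc].
Qed.

Lemma wderivP k T (y : R -> 'cV[R]_k) : H1 0 T y ->
  is_wderiv 0 T y (wderiv 0 T y).
Proof. by move=> [_ yw]; exact: (xgetPex (fun=> 0) yw). Qed.

(** From |x| <= (a + x^2 / a) / 2, which plays the role of Cauchy-Schwarz without
   square roots. *)
Lemma L1_le_L2 k T (v : R -> 'cV[R]_k) a i : 0 < T -> 0 < a -> L2 0 T v ->
  sint 0 T (fun t => enorm (v t) ^+ 2) <= a ^+ 2 ->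
  sint 0 T (fun t => `|v t i 0|) <= a * (T + 1) / 2.
Proof.
move=> T0 a0 vL h.
have ei := L2_intg_enorm vL.
have ci : intg 0 T (fun=> a) by apply: cont_intg => x; exact: cvg_cst.
apply: (@le_trans _ _ (sint 0 T (fun t => 2^-1 * (a + a^-1 * enorm (v t) ^+ 2)))).
  apply: sint_le => [||t _]; [exact/intg_norm/L2_intg|exact/intgZ/intgD/intgZ|].
  apply: (@le_trans _ _ (2^-1 * (a + a^-1 * v t i 0 ^+ 2))); last first.
    by rewrite ler_wpM2l ?invr_ge0// lerD2l ler_wpM2l ?invr_ge0 ?sqr_entry_le// ltW.
  rewrite -(real_normK (num_real (v t i 0))).
  set x := `|v t i 0|.
  rewrite -subr_ge0 (_ : _ - x = (2 * a)^-1 * (x - a) ^+ 2).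
    by rewrite mulr_ge0 ?sqr_ge0// invr_ge0 mulr_ge0// ltW.
  by field; rewrite gt_eqF.
rewrite sintZ; last exact/intgD/intgZ.
rewrite sintD//; last exact: intgZ.
rewrite sintZ// sint_cst ?(ltW T0)// subr0.
have : a^-1 * sint 0 T (fun t => enorm (v t) ^+ 2) <= a.
  by rewrite mulrC ler_pdivrMr// -expr2.
lra.
Qed.

(** The Sobolev embedding of W_T into C([0, T]): by absolute continuity |z t| is at
   most |z s| plus the L^1 norm of z', for every s; average over s. *)
Lemma H1norm_sup k T (z : R -> 'cV[R]_k) a t i : 0 < T -> 0 < a ->
  H1 0 T z -> H1norm 0 T z <= a -> t \in `[0, T] ->
  `|z t i 0| <= (T^-1 + 1) * ((T + 1) / 2) * a.
Proof.
move=> T0 a0 zH za tT.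
have [zc _] := zH; have zv := wderivP zH; set v := wderiv 0 T z in zv.
have [vL _] := zv.
have nonneg (u : R -> 'cV[R]_k) : 0 <= sint 0 T (fun t => enorm (u t) ^+ 2).
  by apply: sint_ge0 => s _; exact: sqr_ge0.
have zL : L2 0 T z.
  split=> [j|]; first by apply: cont_meas; exact: cont_entry.
  have ec : cont_on 0 T (fun t => enorm (z t) ^+ 2).
    apply: (@cont_on_eq _ 0 T (fun t => \sum_j z t j 0 * z t j 0)).
      by move=> s _; rewrite enorm2E; apply: eq_bigr => j _; rewrite big_ord1 expr2.
    by apply: cont_on_sum => j; apply: cont_onM; exact: cont_entry.
  apply/(intg_ge0P (cont_meas ec)) => [s|]; first exact: sqr_ge0.
  exact: cont_intg.
have Ha : sint 0 T (fun t => enorm (v t) ^+ 2) + sint 0 T (fun t => enorm (z t) ^+ 2) <= a ^+ 2.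
  move: za; rewrite /H1norm /L2norm !sqr_sqrtr// => za.
  rewrite -[leLHS]sqr_sqrtr; last exact: addr_ge0.
  by rewrite ler_sqr// ?nnegrE ?sqrtr_ge0// ltW.
have z1 : sint 0 T (fun t => `|z t i 0|) <= a * (T + 1) / 2.
  by apply: L1_le_L2 => //; apply: le_trans Ha; rewrite lerDr.
have v1 : sint 0 T (fun t => `|v t i 0|) <= a * (T + 1) / 2.
  by apply: L1_le_L2 => //; apply: le_trans Ha; rewrite lerDl.
have [vi zE] := wderiv_primitive i T0 zc zv.
have osc s : s \in `[0, T] -> `|z t i 0| <= `|z s i 0| + sint 0 T (fun t => `|v t i 0|).
  move: tT; rewrite !in_itv/= => /andP[t0 tT] /andP[s0 sT].
  have bd x y : 0 <= x -> x <= y -> y <= T ->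
      `|z y i 0 - z x i 0| <= sint 0 T (fun t => `|v t i 0|).
    move=> x0 xy yT; rewrite zE//.
    have vi' : intg x y (fun t => v t i 0) by apply: intg_sub vi.
    apply: (le_trans (sint_norm vi')); apply: sint_sub => //.
    exact: intg_norm.
  rewrite -lerBlDl (le_trans (lerB_dist _ _))//.
  by have [st|/ltW ts] := leP s t; [exact: bd|rewrite distrC; exact: bd].
have zi : intg 0 T (fun t => `|z t i 0|) by exact/intg_norm/cont_intg/cont_entry.
have ci (c : R) : intg 0 T (fun=> c) by apply: cont_intg => x; exact: cvg_cst.
have : sint 0 T (fun=> `|z t i 0|) <=
       sint 0 T (fun s => `|z s i 0| + sint 0 T (fun t => `|v t i 0|)).
  by apply: sint_le => //; exact: intgD.
rewrite sintD// !sint_cst ?(ltW T0)// subr0 => h.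
rewrite -(ler_pM2r T0) (le_trans h)//.
have -> : (T^-1 + 1) * ((T + 1) / 2) * a * T = a * (T + 1) / 2 + a * (T + 1) / 2 * T.
  by field; rewrite gt_eqF.
by rewrite lerD// ler_wpM2r// ltW.
Qed.

End SobolevPaths.

(** * Differential calculus relative to a set *)

Section DifferentiableOn.
Context {R : realType}.
Implicit Types (U V W : normedModType R).

Lemma linear_sub U W (L : U -> W) x y : linear L -> L (x - y) = L x - L y.
Proof. by move=> Ll; rewrite addrC -scaleN1r Ll scaleN1r addrC. Qed.

Lemma linear_0 U W (L : U -> W) : linear L -> L 0 = 0.
Proof. by move=> Ll; rewrite -(subrr 0) linear_sub// subrr. Qed.

Lemma linear_scale U W (L : U -> W) (a : R) x : linear L -> L (a *: x) = a *: L x.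
Proof. by move=> Ll; rewrite -[a *: x]addr0 Ll linear_0// addr0. Qed.

Lemma linear_add U W (L : U -> W) x y : linear L -> L (x + y) = L x + L y.
Proof. by move=> Ll; rewrite -[x in x + y]scale1r Ll scale1r. Qed.

Lemma near_withinP U (K : set U) (x : U) (P : U -> Prop) :
  (\forall z \near within K (nbhs x), P z) <->
  exists2 dl : R, 0 < dl & forall z, `|x - z| < dl -> K z -> P z.
Proof.
split=> [/nbhs_ballP[dl /= dl0 h]|[dl dl0 h]].
  by exists dl => // z xz; apply: h; rewrite -ball_normE.
by apply/nbhs_ballP; exists dl => //= z; rewrite -ball_normE /= => xz; exact: h.
Qed.

Lemma nbhs_normP U (x : U) (P : U -> Prop) :
  (\forall z \near x, P z) <-> exists2 dl : R, 0 < dl & forall z, `|x - z| < dl -> P z.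
Proof.
split=> [/nbhs_ballP[dl /= dl0 h]|[dl dl0 h]].
  by exists dl => // z xz; apply: h; rewrite -ball_normE.
by apply/nbhs_ballP; exists dl => //= z; rewrite -ball_normE /= => xz; exact: h.
Qed.

Lemma bounded_linear_continuous U W (L : U -> W) (C : R) : linear L -> 0 < C ->
  (forall v, `|L v| <= C * `|v|) -> continuous L.
Proof.
move=> Ll C0 Lb x; apply/cvgrPdist_le => e e0; apply/nbhs_normP.
exists (e / C); first exact: divr_gt0.
move=> y; rewrite ltr_pdivlMr// => xy.
by rewrite -linear_sub// (le_trans (Lb _))// mulrC ltW.
Qed.

Lemma linear_bound U W (L : U -> W) : linear L -> continuous L ->
  exists2 C : R, 0 < C & forall v, `|L v| <= C * `|v|.
Proof.
move=> Ll Lc; have /cvgrPdist_le /(_ 1 ltr01) := Lc 0.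
move=> /nbhs_normP[dl dl0 h]; exists (2 / dl); first exact: divr_gt0.
move=> v; have [->|v0] := eqVneq v 0; first by rewrite linear_0// !normr0 mulr0.
have nv : 0 < `|v| by rewrite normr_gt0.
pose c := dl / 2 / `|v|; have c0 : 0 < c by rewrite !divr_gt0.
have cv : `|0 - c *: v| < dl.
  rewrite sub0r normrN normrZ gtr0_norm// /c mulfVK ?gt_eqF//.
  by rewrite ltr_pdivrMr// ltr_pMr// ltr1n.
have := h _ cv; rewrite linear_0// sub0r normrN linear_scale// normrZ gtr0_norm//.
rewrite mulrC -ler_pdivlMr// => /le_trans; apply.
have dn : dl != 0 by rewrite gt_eqF.
have vn : `|v| != 0 by rewrite normr_eq0.
rewrite le_eqVlt; apply/orP; left; apply/eqP; rewrite /c; field; apply/andP; split; [exact: dn|exact: vn].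
Qed.

Lemma open_near U (O : set U) (x : U) :
  open O -> O x -> \forall h \near (0 : U), O (x + h).
Proof.
move=> Oo Ox; have := Oo; rewrite openE => /(_ x Ox) /nbhs_normP[dl dl0 hO].
apply/nbhs_normP; exists dl => // h; rewrite sub0r normrN => hdl; apply: hO.
by rewrite opprD addrA subrr sub0r normrN.
Qed.

Lemma Ck_on_eq k U W (K : set U) (F G : U -> W) :
  (forall x, K x -> F x = G x) -> Ck_on k K F -> Ck_on k K G.
Proof.
move=> FG; have FGc : {within K, continuous F} -> {within K, continuous G}.
  move=> /within_continuousP Fc; apply/within_continuousP => x Kx e e0.
  have := Fc x Kx e e0; apply: filterS => z h Kz.
  by rewrite -!FG//; exact: h.
case: k => [[/FGc ? _]//|k [/FGc Gc [DF [DFd DFC]]]]; split=> //.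
exists DF; split=> // x Kx; have [lin cont h] := DFd x Kx; split=> // e e0.
have /near_withinP[dl dl0 hdl] := h e e0.
apply/near_withinP; exists dl => // z xz Kz.
by rewrite -!FG//; exact: hdl.
Qed.

(** Contractions suffice for the entries of a matrix and for the reordering or
   dropping of variables. *)
Lemma Ck_on_comp k U V W W' (K : set U) (K' : set V) (F : U -> W)
    (iota : V -> U) (phi : W -> W') :
  linear iota -> (forall v, `|iota v| <= `|v|) ->
  linear phi -> (forall w, `|phi w| <= `|w|) ->
  (forall x, K' x -> K (iota x)) ->
  Ck_on k K F -> Ck_on k K' (fun z => phi (F (iota z))).
Proof.
move=> il ib pl pb KK.
have contraction (X Y : normedModType R) (L : X -> Y) :
    linear L -> (forall v, `|L v| <= `|v|) -> continuous L.
  by move=> Ll Lb; apply: (bounded_linear_continuous Ll ltr01) => v; rewrite mul1r.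
have cc (G : U -> W) : {within K, continuous G} ->
    {within K', continuous (fun z => phi (G (iota z)))}.
  move=> /within_continuousP Gc; apply/within_continuousP => x Kx e e0.
  have /nbhs_normP[dl dl0 h] := Gc _ (KK x Kx) e e0.
  apply/nbhs_normP; exists dl => // z xz Kz.
  rewrite -linear_sub// (le_trans (pb _))// h; [by []| |exact: KK].
  by rewrite -linear_sub// (le_lt_trans (ib _)).
elim: k F => [|k IH] F [Fc]; first by move=> _; split=> //; exact: cc.
move=> [DF [DFd DFC]]; split; first exact: cc.
exists (fun x v => phi (DF (iota x) (iota v))); split=> [x Kx|v]; last first.
  exact: IH (DFC (iota v)).
have [lin cont h] := DFd _ (KK x Kx); split.
- by move=> a u w; rewrite il lin pl.
- move=> v; apply: (@continuous_comp _ _ _ iota (phi \o DF (iota x))).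
    exact: contraction.
  apply: continuous_comp; [exact: cont|exact: contraction].
- move=> e e0; have /near_withinP[dl dl0 hdl] := h e e0.
  apply/near_withinP; exists dl => // z xz Kz.
  rewrite (linear_sub _ _ il) -2!(linear_sub _ _ pl) (le_trans (pb _))//.
  apply: (@le_trans _ _ (e * `|iota z - iota x|)).
    apply: hdl; last exact: KK.
    by rewrite -(linear_sub _ _ il) (le_lt_trans (ib _)).
  by rewrite -(linear_sub _ _ il) ler_wpM2l// ltW.
Qed.

Lemma Ck_on_pred k U W (K : set U) (F : U -> W) : Ck_on k.+1 K F -> Ck_on k K F.
Proof.
elim: k F => [|k IH] F [Fc [DF [DFd DFC]]]; split=> //.
by exists DF; split=> // v; apply: IH; exact: DFC.
Qed.

Lemma C1_cst U (K : set U) (c : R) : Ck_on 1 K (fun=> c).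
Proof.
split; first by move=> x; exact: cvg_cst.
exists (fun _ _ => 0); split=> [x Kx|v]; last by split=> // x; exact: cvg_cst.
split=> [a u v||e e0]; first by rewrite scaler0 addr0.
  by move=> x'; exact: cvg_cst.
by apply/near_withinP; exists 1 => // z _ _; rewrite !subrr normr0 mulr_ge0// ltW.
Qed.

Lemma C1D U (K : set U) (F G : U -> R) :
  Ck_on 1 K F -> Ck_on 1 K G -> Ck_on 1 K (fun z => F z + G z).
Proof.
move=> [Fc [DF [DFd DFC]]] [Gc [DG [DGd DGC]]].
have cD (A B : U -> R) : {within K, continuous A} -> {within K, continuous B} ->
    {within K, continuous (fun z => A z + B z)}.
  by move=> Ac Bc x; apply: cvgD; [exact: Ac|exact: Bc].
split; first exact: cD.
exists (fun x v => DF x v + DG x v); split=> [x Kx|v]; last first.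
  by have [? _] := DFC v; have [? _] := DGC v; split=> //; exact: cD.
have [Fl Fk Fh] := DFd x Kx; have [Gl Gk Gh] := DGd x Kx; split.
- by move=> a u v; rewrite Fl Gl scalerDr addrACA.
- by move=> v; apply: cvgD; [exact: Fk|exact: Gk].
- move=> e e0.
  have /near_withinP[d1 d10 h1] := Fh (e / 2) (divr_gt0 e0 (ltr0Sn _ 1)).
  have /near_withinP[d2 d20 h2] := Gh (e / 2) (divr_gt0 e0 (ltr0Sn _ 1)).
  apply/near_withinP; exists (Num.min d1 d2) => [|z]; first by rewrite lt_min d10.
  rewrite lt_min => /andP[z1 z2] Kz.
  have -> : F z + G z - (F x + G x) - (DF x (z - x) + DG x (z - x)) =
    (F z - F x - DF x (z - x)) + (G z - G x - DG x (z - x)) by ring.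
  rewrite (le_trans (ler_normD _ _))// [e]splitr mulrDl lerD//.
    exact: h1.
  exact: h2.
Qed.

(** The increment of the product splits into two remainders and the product of two
   increments, the last being small because F is continuous and G is Lipschitz at x. *)
Lemma C1M U (K : set U) (F G : U -> R) :
  Ck_on 1 K F -> Ck_on 1 K G -> Ck_on 1 K (fun z => F z * G z).
Proof.
move=> [Fc [DF [DFd DFC]]] [Gc [DG [DGd DGC]]].
have cM (A B : U -> R) : {within K, continuous A} -> {within K, continuous B} ->
    {within K, continuous (fun z => A z * B z)}.
  by move=> Ac Bc x; apply: cvgM; [exact: Ac|exact: Bc].
have cD (A B : U -> R) : {within K, continuous A} -> {within K, continuous B} ->
    {within K, continuous (fun z => A z + B z)}.
  by move=> Ac Bc x; apply: cvgD; [exact: Ac|exact: Bc].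
split; first exact: cM.
exists (fun x v => F x * DG x v + DF x v * G x); split=> [x Kx|v]; last first.
  by have [? _] := DFC v; have [? _] := DGC v; split=> //; apply: cD; exact: cM.
have [Fl Fk Fh] := DFd x Kx; have [Gl Gk Gh] := DGd x Kx; split.
- by move=> a u v; rewrite Fl Gl /GRing.scale/=; ring.
- move=> v; apply: cvgD; apply: cvgM; try exact: cvg_cst.
    exact: Gk.
  exact: Fk.
- move=> e e0.
  have [C C0 hC] := linear_bound Gl Gk.
  pose a := `|F x| + 1; pose b := `|G x| + 1.
  have a0 : 0 < a by rewrite ltr_wpDl.
  have b0 : 0 < b by rewrite ltr_wpDl.
  have e3 : 0 < e / 3 by rewrite divr_gt0.
  have /near_withinP[d1 d10 h1] := Fh _ (divr_gt0 e3 b0).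
  have /near_withinP[d2 d20 h2] := Gh _ (divr_gt0 e3 a0).
  have C1 : 0 < C + 1 by rewrite ltr_wpDl// ltW.
  have /near_withinP[d3 d30 h3] := Gh _ ltr01.
  move/within_continuousP : Fc => /(_ x Kx _ (divr_gt0 e3 C1)) /nbhs_normP[d4 d40 h4].
  apply/near_withinP; exists (Num.min (Num.min d1 d2) (Num.min d3 d4)) => [|z].
    by rewrite !lt_min d10 d20 d30.
  rewrite !lt_min -andbA => /and4P[z1 z2 z3 z4] Kz.
  have -> : F z * G z - F x * G x - (F x * DG x (z - x) + DF x (z - x) * G x) =
    F x * (G z - G x - DG x (z - x)) + (F z - F x - DF x (z - x)) * G x
    + (F z - F x) * (G z - G x) by ring.
  have r1 := h1 z z1 Kz; have r2 := h2 z z2 Kz.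
  have r3 : `|G z - G x| <= (C + 1) * `|z - x|.
    rewrite -[G z - G x](subrK (DG x (z - x))) (le_trans (ler_normD _ _))//.
    by rewrite addrC mulrDl lerD// h3.
  have r4 := h4 z z4 Kz; rewrite distrC in r4.
  have -> : e * `|z - x| = e / 3 * `|z - x| + e / 3 * `|z - x| + e / 3 * `|z - x|.
    by field.
  rewrite (le_trans (ler_normD _ _))// lerD//.
    rewrite (le_trans (ler_normD _ _))// lerD// normrM.
      apply: (@le_trans _ _ (a * (e / 3 / a * `|z - x|))); last first.
        by rewrite mulrA mulrCA divff ?gt_eqF// mulr1.
      by rewrite ler_pM// lerDl.
    apply: (@le_trans _ _ ((e / 3 / b * `|z - x|) * b)); last first.
      by rewrite mulrAC mulfVK ?gt_eqF.
    by rewrite ler_pM// lerDl.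
  rewrite normrM; apply: (@le_trans _ _ (e / 3 / (C + 1) * ((C + 1) * `|z - x|))).
    by rewrite ler_pM.
  by rewrite mulrA mulfVK ?gt_eqF.
Qed.

End DifferentiableOn.

(** * Line derivatives and symmetry of second derivatives *)

Section LineDerivative.
Context {R : realType} (U : normedModType R).
Implicit Types (K : set U) (F A B : U -> R) (x v w : U).

(** A derivative relative to K is an ordinary directional derivative along every
   direction in which K is a union of full lines; this covers the directions
   without time component at the end points of [0, T]. *)
Lemma fderiv_is_derive K F x (L : U -> R) v : is_fderiv_on K F x L ->
  (forall s : R, K (x + s *: v)) -> is_derive x v F (L v).
Proof.
move=> [Ll Lc h] Kv; apply: is_derive_epsP => e e0.
have nv : 0 < `|v| + 1 by rewrite ltr_wpDl.
have /near_withinP[dl dl0 hdl] := h _ (divr_gt0 e0 nv).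
apply/nbhs_normP; exists (dl / (`|v| + 1)); first exact: divr_gt0.
move=> s; rewrite sub0r normrN ltr_pdivlMr// => sv.
have sv' : `|s| * `|v| <= `|s| * (`|v| + 1) by rewrite ler_wpM2l// lerDl.
have xs : `|x - (x + s *: v)| < dl.
  by rewrite opprD addrA subrr sub0r normrN normrZ (le_lt_trans sv').
have := hdl _ xs (Kv s).
rewrite (_ : x + s *: v - x = s *: v); last by rewrite addrAC subrr add0r.
rewrite (linear_scale _ _ Ll) normrZ => /le_trans; apply.
rewrite mulrAC ler_pdivrMr// -mulrA ler_wpM2l// ltW//.
Qed.

Lemma is_derive_line F x v (s l : R) :
  is_derive (x + s *: v) v F l -> is_derive s 1 (fun r : R => F (x + r *: v)) l.
Proof.
move=> [dF <-].
have E : (fun h : R => h^-1 *: ((F \o shift (x + s *: v)) (h *: v) - F (x + s *: v))) =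
    (fun h : R => h^-1 *: (((fun r : R => F (x + r *: v)) \o shift s) (h *: 1)
       - F (x + s *: v))).
  apply/funext => h /=; congr (_ *: (F _ - _)).
  have -> : h *: (1 : R) = h by rewrite /GRing.scale/= mulr1.
  by rewrite scalerDl addrCA.
by split; rewrite /derivable /derive -E.
Qed.

Lemma is_derive_translate F x v a (l : R) :
  is_derive (x + a) v F l -> is_derive x v (fun z => F (z + a)) l.
Proof.
move=> [dF <-].
have E : (fun h : R => h^-1 *: ((F \o shift (x + a)) (h *: v) - F (x + a))) =
    (fun h : R => h^-1 *: (((fun z => F (z + a)) \o shift x) (h *: v) - F (x + a))).
  by apply/funext => h /=; rewrite addrA.
by split; rewrite /derivable /derive -E.
Qed.

Lemma mvt_line F x v (A : U -> R) (h : R) : 0 < h ->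
  (forall s : R, is_derive (x + s *: v) v F (A (x + s *: v))) ->
  exists2 c : R, 0 < c < h & F (x + h *: v) - F x = h * A (x + c *: v).
Proof.
move=> h0 dF; pose f r := F (x + r *: v).
have df (s : R) : is_derive s 1 f (A (x + s *: v)) by exact: is_derive_line.
have [|c c01 E] := @MVT R f (fun s => A (x + s *: v)) 0 h h0 (fun s _ => df s).
  apply: continuous_subspaceT => s.
  by apply: differentiable_continuous; apply/derivable1_diffP; case: (df s).
exists c; first by move: c01; rewrite in_itv.
by move: E; rewrite /f scale0r addr0 subr0 mulrC.
Qed.

(** The second difference of F over the parallelogram spanned by h v and h w is
   h^2 times AB at a nearby point, by the mean value theorem applied in v and then in
   w, and h^2 times BA at another one in the other order. *)
Lemma schwarz K F A B AB BA v w :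
  (forall x s, K x -> K (x + s *: v)) -> (forall x s, K x -> K (x + s *: w)) ->
  (forall x, K x -> is_derive x v F (A x)) ->
  (forall x, K x -> is_derive x w F (B x)) ->
  (forall x, K x -> is_derive x w A (AB x)) ->
  (forall x, K x -> is_derive x v B (BA x)) ->
  {within K, continuous AB} -> {within K, continuous BA} ->
  forall x, K x -> AB x = BA x.
Proof.
move=> Kv Kw dA dB dAB dBA ABc BAc x Kx.
apply/eqP; rewrite -subr_eq0 -normr_le0; apply/ler_addgt0Pr => e e0; rewrite add0r.
have e2 : 0 < e / 2 by rewrite divr_gt0.
move/within_continuousP : ABc => /(_ x Kx _ e2) /nbhs_normP[d1 d10 h1].
move/within_continuousP : BAc => /(_ x Kx _ e2) /nbhs_normP[d2 d20 h2].
pose dl := Num.min d1 d2; have dl0 : 0 < dl by rewrite lt_min d10.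
pose C := `|v| + `|w| + 1; have C0 : 0 < C by rewrite ltr_wpDl// addr_ge0.
pose h := dl / (2 * C); have h0 : 0 < h by rewrite divr_gt0// mulr_gt0.
have hC : h * C < dl.
  have -> : h * C = dl / 2 by rewrite /h; field; rewrite gt_eqF.
  by rewrite ltr_pdivrMr// ltr_pMr// ltr1n.
have near_x a b : 0 < a < h -> 0 < b < h -> `|x - (x + a *: v + b *: w)| < dl.
  move=> /andP[a0 a1] /andP[b0 b1].
  rewrite -addrA opprD addrA subrr sub0r normrN (le_lt_trans _ hC)//.
  rewrite (le_trans (ler_normD _ _))// !normrZ !gtr0_norm// /C !mulrDr mulr1.
  apply: (@le_trans _ _ (h * `|v| + h * `|w|)); last by rewrite lerDl ltW.
  by rewrite lerD// ler_wpM2r// ltW.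
pose S := F (x + h *: v + h *: w) - F (x + h *: v) - (F (x + h *: w) - F x).
have [a a0h [b b0h Ea]] : exists2 a : R, 0 < a < h & exists2 b : R, 0 < b < h &
    S = h * (h * AB (x + a *: v + b *: w)).
  pose u z := F (z + h *: w) - F z.
  have [|a a0h Ea] := @mvt_line u x v (fun z => A (z + h *: w) - A z) h h0.
    move=> s; apply: is_deriveB; first apply: is_derive_translate.
      by apply: dA; exact/Kw/Kv.
    by apply: dA; exact: Kv.
  have [|b b0h Eb] := @mvt_line A (x + a *: v) w AB h h0.
    by move=> s; apply: dAB; exact/Kw/Kv.
  exists a => //; exists b => //.
  have -> : S = u (x + h *: v) - u x by [].
  by rewrite Ea Eb.
have [a' a'0h [b' b'0h Ea']] : exists2 a : R, 0 < a < h & exists2 b : R, 0 < b < h &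
    S = h * (h * BA (x + a *: v + b *: w)).
  pose u z := F (z + h *: v) - F z.
  have [|b1 b1h Eb] := @mvt_line u x w (fun z => B (z + h *: v) - B z) h h0.
    move=> s; apply: is_deriveB; first apply: is_derive_translate.
      by apply: dB; exact/Kv/Kw.
    by apply: dB; exact: Kw.
  have [|a1 a1h Ea'] := @mvt_line B (x + b1 *: w) v BA h h0.
    by move=> s; apply: dBA; exact/Kv/Kw.
  exists a1 => //; exists b1 => //.
  have -> : S = u (x + h *: w) - u x by rewrite /S /u (addrAC x (h *: w)); ring.
  by rewrite Eb Ea' addrAC.
have Kab s r : K (x + s *: v + r *: w) by exact/Kw/Kv.
have k1 := h1 (x + a *: v + b *: w) _ (Kab a b).
have k2 := h2 (x + a' *: v + b' *: w) _ (Kab a' b').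
have E : AB (x + a *: v + b *: w) = BA (x + a' *: v + b' *: w).
  have hn := lt0r_neq0 h0.
  by apply: (mulfI hn); apply: (mulfI hn); rewrite -Ea.
have {}k1 := k1 (lt_le_trans (near_x a b a0h b0h) _).
have {}k2 := k2 (lt_le_trans (near_x a' b' a'0h b'0h) _).
rewrite E in k1; rewrite -[AB x - _](subrKA (BA (x + a' *: v + b' *: w))).
rewrite (le_trans (ler_normD _ _))// [leRHS]splitr lerD//.
  by apply: k1; rewrite /dl ge_min lexx.
by rewrite distrC k2// /dl ge_min lexx orbT.
Qed.

End LineDerivative.

(** * Functions of time, parameter and state *)

Section ParametricPaths.
Context {R : realType} (d n : nat) (T : R).
Local Notation E := (R * 'cV[R]_d * 'cV[R]_n)%type.
Implicit Types (F G : E -> R) (x : E).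

Lemma triple_eq (x : E) a b c : x.1.1 = a -> x.1.2 = b -> x.2 = c -> x = (a, b, c).
Proof. by case: x => -[? ?] ? /= -> -> ->. Qed.

(** The domain of the data of the control problem as functions of (t, theta, y). *)
Definition strip : set E := [set z | z.1.1 \in `[0, T]].

Definition pd_param F j x := pd j (fun th => F (x.1.1, th, x.2)) x.1.2.
Definition pd_state F j x := pd j (fun y => F (x.1.1, x.1.2, y)) x.2.

(** Differential in (theta, y) at fixed t.  Partial derivatives are used, rather than
   the derivative relative to the strip, since the latter is only given as some witness. *)
Definition dFxy F x (h : 'cV[R]_d) (k : 'cV[R]_n) : R :=
  \sum_j h j 0 * pd_param F j x + \sum_j k j 0 * pd_state F j x.

Lemma dFxyE F t th y h k : dFxy F (t, th, y) h k =
  dotv h (grad (fun th' => F (t, th', y)) th) +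
  dotv k (grad (fun z => F (t, th, z)) y).
Proof. by rewrite /dFxy /dotv; congr (_ + _); apply: eq_bigr => j _; rewrite mxE. Qed.

Lemma strip_dir x (h : 'cV[R]_d) (k : 'cV[R]_n) (s : R) :
  strip x -> strip (x + s *: (0, h, k)).
Proof. by rewrite /strip/= scaler0 addr0. Qed.

Lemma linear_delta l (L : 'cV[R]_l -> R) (h : 'cV[R]_l) : linear L ->
  L h = \sum_j h j 0 * L (delta_mx j 0).
Proof.
move=> Ll; have {1}-> : h = \sum_j h j 0 *: delta_mx j 0.
  by rewrite {1}[h]matrix_sum_delta; apply: eq_bigr => i _; rewrite big_ord1.
elim/big_ind2 : _ => [|a u b w <- <-|j _].
- exact: linear_0.
- by rewrite linear_add.
- by rewrite linear_scale.
Qed.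

Lemma is_derive_param F x (h : 'cV[R]_d) (l : R) :
  is_derive x (0, h, 0) F l -> is_derive x.1.2 h (fun th => F (x.1.1, th, x.2)) l.
Proof.
move=> [dF <-]; case: x dF => -[t th] y dF /=.
have E0 : (fun s : R => s^-1 *: ((F \o shift (t, th, y)) (s *: (0, h, 0)) - F (t, th, y))) =
  (fun s : R => s^-1 *: (((fun th => F (t, th, y)) \o shift th) (s *: h) - F (t, th, y))).
  apply/funext => s /=; congr (_ *: (F _ - _)).
  by apply: triple_eq; rewrite /= ?scaler0 ?add0r.
by split; rewrite /derivable /derive -E0.
Qed.

Lemma is_derive_state F x (k : 'cV[R]_n) (l : R) :
  is_derive x (0, 0, k) F l -> is_derive x.2 k (fun y => F (x.1.1, x.1.2, y)) l.
Proof.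
move=> [dF <-]; case: x dF => -[t th] y dF /=.
have E0 : (fun s : R => s^-1 *: ((F \o shift (t, th, y)) (s *: (0, 0, k)) - F (t, th, y))) =
  (fun s : R => s^-1 *: (((fun y => F (t, th, y)) \o shift y) (s *: k) - F (t, th, y))).
  apply/funext => s /=; congr (_ *: (F _ - _)).
  by apply: triple_eq; rewrite /= ?scaler0 ?add0r.
by split; rewrite /derivable /derive -E0.
Qed.

Section FirstOrder.
Variables (F : E -> R) (DF : E -> E -> R).
Hypothesis DFd : forall x, strip x -> is_fderiv_on strip F x (DF x).

Lemma fderiv_dir x h k : strip x -> is_derive x (0, h, k) F (DF x (0, h, k)).
Proof.
move=> Kx; apply: fderiv_is_derive; first exact: DFd.
by move=> s; exact: strip_dir.
Qed.

Lemma pd_paramE x j : strip x -> pd_param F j x = DF x (0, delta_mx j 0, 0).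
Proof. by move=> Kx; case: (is_derive_param (fderiv_dir (delta_mx j 0) 0 Kx)). Qed.

Lemma pd_stateE x j : strip x -> pd_state F j x = DF x (0, 0, delta_mx j 0).
Proof. by move=> Kx; case: (is_derive_state (fderiv_dir 0 (delta_mx j 0) Kx)). Qed.

Lemma fderiv_dFxy x h k : strip x -> DF x (0, h, k) = dFxy F x h k.
Proof.
move=> Kx; have [Ll _ _] := DFd Kx.
have -> : (0, h, k) = (0, h, 0) + (0, 0, k) :> E.
  by apply/esym/triple_eq; rewrite /= ?addr0 ?add0r.
rewrite linear_add//; congr (_ + _).
  rewrite (@linear_delta _ (fun h => DF x (0, h, 0))).
    by apply: eq_bigr => j _; rewrite pd_paramE.
  move=> a u v; rewrite -Ll; congr (DF x _).
  by apply/esym/triple_eq; rewrite /= ?scaler0 ?addr0.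
rewrite (@linear_delta _ (fun k => DF x (0, 0, k))).
  by apply: eq_bigr => j _; rewrite pd_stateE.
move=> a u v; rewrite -Ll; congr (DF x _).
by apply/esym/triple_eq; rewrite /= ?scaler0 ?addr0.
Qed.

End FirstOrder.

Lemma Ck_pd_param k F j : Ck_on k.+1 strip F -> Ck_on k strip (pd_param F j).
Proof.
move=> [_ [DF [DFd DFC]]]; apply: Ck_on_eq (DFC (0, delta_mx j 0, 0)) => x Kx.
by rewrite (pd_paramE DFd).
Qed.

Lemma Ck_pd_state k F j : Ck_on k.+1 strip F -> Ck_on k strip (pd_state F j).
Proof.
move=> [_ [DF [DFd DFC]]]; apply: Ck_on_eq (DFC (0, 0, delta_mx j 0)) => x Kx.
by rewrite (pd_stateE DFd).
Qed.

Lemma is_derive_dFxy F x h k : Ck_on 1 strip F -> strip x ->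
  is_derive x (0, h, k) F (dFxy F x h k).
Proof.
move=> [_ [DF [DFd DFC]]] Kx; rewrite -(fderiv_dFxy DFd)//; exact: fderiv_dir.
Qed.

Lemma is_derive_pd_param F x j : Ck_on 1 strip F -> strip x ->
  is_derive x.1.2 (delta_mx j 0) (fun th => F (x.1.1, th, x.2)) (pd_param F j x).
Proof.
move=> [_ [DF [DFd DFC]]] Kx; rewrite (pd_paramE DFd)//.
exact/is_derive_param/fderiv_dir.
Qed.

Lemma is_derive_pd_state F x j : Ck_on 1 strip F -> strip x ->
  is_derive x.2 (delta_mx j 0) (fun y => F (x.1.1, x.1.2, y)) (pd_state F j x).
Proof.
move=> [_ [DF [DFd DFC]]] Kx; rewrite (pd_stateE DFd)//.
exact/is_derive_state/fderiv_dir.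
Qed.

Lemma pd_state_sym F i j x : Ck_on 2 strip F -> strip x ->
  pd_state (pd_state F i) j x = pd_state (pd_state F j) i x.
Proof.
move=> F2 Kx; have F1 := Ck_on_pred F2.
have dir (G : E -> R) l x' : Ck_on 1 strip G -> strip x' ->
    is_derive x' (0, 0, delta_mx l 0) G (pd_state G l x').
  by move=> [_ [DG [DGd _]]] Kx'; rewrite (pd_stateE DGd)//; exact: fderiv_dir.
have c1 := (Ck_pd_state j (Ck_pd_state i F2)).1.
have c2 := (Ck_pd_state i (Ck_pd_state j F2)).1.
have d1 z (Kz : strip z) := dir F i z F1 Kz.
have d2 z (Kz : strip z) := dir F j z F1 Kz.
have d12 z (Kz : strip z) := dir _ j z (Ck_pd_state i F2) Kz.
have d21 z (Kz : strip z) := dir _ i z (Ck_pd_state j F2) Kz.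
have mv k z (s : R) (Kz : strip z) := strip_dir 0 (delta_mx k 0 : 'cV[R]_n) s Kz.
exact: (schwarz (mv i) (mv j) d1 d2 d12 d21 c1 c2 Kx).
Qed.

Lemma ltr_pair_norm (U V : normedModType R) (u : U) (v : V) e :
  `|u| < e -> `|v| < e -> `|(u, v)| < e.
Proof. by move=> ue ve; rewrite prod_normE gt_max ue. Qed.

Lemma ltr_triple_norm (x : E) e :
  `|x.1.1| < e -> `|x.1.2| < e -> `|x.2| < e -> `|x| < e.
Proof. by move=> ? ? ?; rewrite !prod_normE !gt_max; apply/andP; split=> //; apply/andP. Qed.

Section Path.
Variables (th : 'cV[R]_d) (y : R -> 'cV[R]_n).
Hypothesis yc : {within `[0, T], continuous y}.

Lemma path_cont G : {within strip, continuous G} -> cont_on 0 T (fun t => G (t, th, y t)).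
Proof.
move=> /within_continuousP Gc; apply/within_continuousP => t tT e e0.
have /nbhs_normP[dl dl0 h] := Gc (t, th, y t) tT e e0.
move/within_continuousP : yc => /(_ t tT (dl / 2) (divr_gt0 dl0 (ltr0Sn _ 1))).
move=> /nbhs_normP[dl' dl'0 h'].
apply/nbhs_normP; exists (Num.min dl dl') => [|s]; first by rewrite lt_min dl0.
rewrite lt_min => /andP[s1 s2] sT; apply: h => //.
apply: ltr_triple_norm => //=; first by rewrite subrr normr0.
by rewrite (le_lt_trans (h' s s2 sT))// ltr_pdivrMr// ltr_pMr// ltr1n.
Qed.

(** Continuity of G along the compact graph of y, made uniform in t: near each t0
   the bound holds for all t close to t0 and all small (h, k), and finitely many such
   neighbourhoods cover [0, T]. *)
Lemma path_unif G e : {within strip, continuous G} -> 0 < e ->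
  exists2 dl : R, 0 < dl & forall t h k, t \in `[0, T] -> `|h| < dl -> `|k| < dl ->
    `|G (t, th + h, y t + k) - G (t, th, y t)| <= e.
Proof.
move=> Gc e0.
pose P (i : 'cV[R]_d * 'cV[R]_n) (t : R) := t \in `[0, T] ->
  `|G (t, th + i.1, y t + i.2) - G (t, th, y t)| <= e.
have cov := (compact_near_coveringP _).1 (@segment_compact R 0 T).
suff : \forall i \near (nbhs (0 : 'cV[R]_d * 'cV[R]_n)), `[0, T]%classic `<=` P i.
  move=> /nbhs_normP[dl dl0 H]; exists dl => // t h k tT hdl kdl.
  by apply: (H (h, k)) => //; rewrite sub0r normrN; exact: ltr_pair_norm.
apply: cov => t0 t0T.
move/within_continuousP : Gc => /(_ (t0, th, y t0) t0T _ (divr_gt0 e0 (ltr0Sn _ 1))).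
move=> /nbhs_normP[dl dl0 H].
have dl2 : 0 < dl / 2 by rewrite divr_gt0.
move/within_continuousP : yc => /(_ t0 t0T (dl / 4) (divr_gt0 dl0 (ltr0Sn _ 3))).
move=> /nbhs_normP[dl' dl'0 H'].
have nA : \forall t \near t0, `|t0 - t| < Num.min dl dl'.
  by apply/nbhs_normP; exists (Num.min dl dl') => //; rewrite lt_min dl0.
have nB : \forall i \near (0 : 'cV[R]_d * 'cV[R]_n), `|i| < dl / 2.
  by apply/nbhs_normP; exists (dl / 2) => // z; rewrite sub0r normrN.
exists ([set t | `|t0 - t| < Num.min dl dl'], [set i | `|i| < dl / 2]).
  by split; [exact: nA|exact: nB].
move=> [t i] [/= ]; rewrite lt_min => /andP[t1 t2] idl tT.
have yt := H' t t2 tT.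
have lt2 : dl / 2 < dl by rewrite ltr_pdivrMr// ltr_pMr// ltr1n.
have i12 : `|i.1| < dl / 2 /\ `|i.2| < dl / 2.
  by move: idl; rewrite prod_normE gt_max => /andP[].
have k1 : `|G (t0, th, y t0) - G (t, th + i.1, y t + i.2)| <= e / 2.
  apply: H => //; apply: ltr_triple_norm => //=.
    by rewrite opprD addrA subrr sub0r normrN (lt_trans i12.1).
  rewrite opprD addrA (le_lt_trans (ler_normB _ _))//.
  by move: yt i12.2 => yt i2; lra.
have k2 : `|G (t0, th, y t0) - G (t, th, y t)| <= e / 2.
  apply: H => //; apply: ltr_triple_norm => //=; first by rewrite subrr normr0.
  by rewrite (le_lt_trans yt)//; lra.
rewrite -[X in `|X|](subrKA (G (t0, th, y t0))) (le_trans (ler_normD _ _))//.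
by rewrite [leRHS]splitr lerD// distrC.
Qed.

End Path.

End ParametricPaths.

(** * Curves depending differentiably on the parameter *)

Lemma near_finite (R : realType) (U : normedModType R) (I : finType) (x : U)
    (P : I -> U -> Prop) :
  (forall i, \forall u \near x, P i u) -> \forall u \near x, forall i, P i u.
Proof. by move=> h; apply: (@filter_forall _ _ P (nbhs x)). Qed.

Section UniformlyDifferentiable.
Context {R : realType} (d n : nat) (T : R).
Hypothesis T0 : 0 < T.
Local Notation E := (R * 'cV[R]_d * 'cV[R]_n)%type.

(** By the mean value theorem on the segment from (th, y t) to (th + h, y t + k), the
   remainder is the variation of the partial derivatives along it, uniformly small
   by path_unif. *)
Lemma path_remainder (F : E -> R) (th : 'cV[R]_d) (y : R -> 'cV[R]_n) e :
  Ck_on 1 (strip T) F -> {within `[0, T], continuous y} -> 0 < e ->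
  exists2 dl : R, 0 < dl & forall t h k, t \in `[0, T] -> `|h| < dl -> `|k| < dl ->
    `|F (t, th + h, y t + k) - F (t, th, y t) - dFxy F (t, th, y t) h k|
       <= e * (`|h| + `|k|).
Proof.
move=> F1 yc e0.
pose D : R := (d + n).+1%:R; have D0 : 0 < D by rewrite ltr0n.
have e'0 : 0 < e / D by rewrite divr_gt0.
have unif (G : E -> R) : {within strip T, continuous G} ->
    \forall i \near (0 : 'cV[R]_d * 'cV[R]_n), forall t, t \in `[0, T] ->
      `|G (t, th + i.1, y t + i.2) - G (t, th, y t)| <= e / D.
  move=> Gc; have [dl dl0 h] := path_unif th yc Gc e'0.
  apply/nbhs_normP; exists dl => // -[h' k']; rewrite sub0r normrN prod_normE gt_max.
  by move=> /andP[h1 k1] t tT; exact: h.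
have up : \forall i \near (0 : 'cV[R]_d * 'cV[R]_n), forall j t, t \in `[0, T] ->
    `|pd_param F j (t, th + i.1, y t + i.2) - pd_param F j (t, th, y t)| <= e / D.
  by apply: near_finite => j; apply: unif; have [] := Ck_pd_param j F1.
have us : \forall i \near (0 : 'cV[R]_d * 'cV[R]_n), forall j t, t \in `[0, T] ->
    `|pd_state F j (t, th + i.1, y t + i.2) - pd_state F j (t, th, y t)| <= e / D.
  by apply: near_finite => j; apply: unif; have [] := Ck_pd_state j F1.
move/nbhs_normP : up => [d1 d10 up]; move/nbhs_normP : us => [d2 d20 us].
exists (Num.min d1 d2) => [|t h k tT]; first by rewrite lt_min d10.
rewrite !lt_min => /andP[h1 h2] /andP[k1 k2].
have Kx : strip T (t, th, y t) by [].
have [|c /andP[c0 c1] Ec] := @mvt_line _ _ F (t, th, y t) (0, h, k)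
    (fun z => dFxy F z h k) 1 ltr01.
  by move=> s; apply: (is_derive_dFxy h k F1); exact: strip_dir.
have xE (s : R) : (t, th, y t) + s *: (0, h, k) = (t, th + s *: h, y t + s *: k) :> E.
  by apply: triple_eq; rewrite /= ?scaler0 ?addr0.
rewrite !xE !scale1r mul1r in Ec; rewrite Ec.
have small (l : nat) (v : 'cV[R]_l) dl : `|v| < dl -> `|c *: v| < dl.
  by move=> vl; rewrite normrZ gtr0_norm// (le_lt_trans _ vl)// ler_piMl// ltW.
have ic dl : `|h| < dl -> `|k| < dl -> `|0 - (c *: h, c *: k)| < dl.
  by move=> hl kl; rewrite sub0r normrN; apply: ltr_pair_norm; exact: small.
have sumB l (v : 'cV[R]_l) (a b : 'I_l -> R) : (forall j, `|a j - b j| <= e / D) ->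
    `|\sum_j v j 0 * a j - \sum_j v j 0 * b j| <= l%:R * (`|v| * (e / D)).
  move=> ab; rewrite -sumrB (le_trans (ler_norm_sum _ _ _))//.
  apply: (@le_trans _ _ (\sum_(j < l) `|v| * (e / D))).
    apply: ler_sum => j _; rewrite -mulrBr normrM ler_pM//; exact: ler_mx_entry.
  by rewrite sumr_const card_ord -[X in X <= _]mulr_natl.
rewrite /dFxy opprD addrACA (le_trans (ler_normD _ _))// mulrDr.
have final l (v : 'cV[R]_l) : (l <= (d + n).+1)%N -> l%:R * (`|v| * (e / D)) <= e * `|v|.
  move=> ld; have -> : e * `|v| = D * (`|v| * (e / D)) by field; rewrite gt_eqF.
  by rewrite ler_wpM2r ?ler_nat// mulr_ge0// ltW.
rewrite lerD//.
  apply: le_trans (final _ h _); last by rewrite -addnS leq_addr.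
  by apply: sumB => j; apply: (up (c *: h, c *: k)) => //; exact: ic.
apply: le_trans (final _ k _); last by rewrite -addSn leq_addl.
by apply: sumB => j; apply: (us (c *: h, c *: k)) => //; exact: ic.
Qed.

Variable th : 'cV[R]_d.
Implicit Types (phi psi : 'cV[R]_d -> R -> R) (dphi dpsi : 'cV[R]_d -> R -> R).

(** Frechet differentiability at th of th' |-> phi th' as a map into C([0, T]) with the
   sup norm, the derivative in direction h being dphi h. *)
Definition curve_diff phi dphi : Prop :=
  [/\ \forall h \near (0 : 'cV[R]_d), cont_on 0 T (phi (th + h)),
      forall h, cont_on 0 T (dphi h),
      exists2 C : R, 0 < C & forall h t, t \in `[0, T] -> `|dphi h t| <= C * `|h| &
      forall e : R, 0 < e -> \forall h \near (0 : 'cV[R]_d), forall t, t \in `[0, T] ->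
        `|phi (th + h) t - phi th t - dphi h t| <= e * `|h|].

(** The increment dj h is determined up to o(h) only, a freedom that scalar_diff_null
   exploits. *)
Definition scalar_diff (j dj : 'cV[R]_d -> R) : Prop :=
  forall e : R, 0 < e -> \forall h \near (0 : 'cV[R]_d),
    `|j (th + h) - j th - dj h| <= e * `|h|.

Lemma curve_diff_cont phi dphi : curve_diff phi dphi -> cont_on 0 T (phi th).
Proof. by move=> [+ _ _ _] => /nbhs_singleton; rewrite addr0. Qed.

Lemma curve_diff_lip phi dphi : curve_diff phi dphi ->
  exists2 C : R, 0 < C & \forall h \near (0 : 'cV[R]_d), forall t, t \in `[0, T] ->
    `|phi (th + h) t - phi th t| <= C * `|h|.
Proof.
move=> [_ _ [C C0 hC] hd]; exists (1 + C); first by rewrite addr_gt0.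
have := hd 1 ltr01; apply: filterS => h hh t tT.
rewrite -[X in `|X|](subrK (dphi h t)) (le_trans (ler_normD _ _))//.
by rewrite mulrDl lerD ?hh// hC.
Qed.

Lemma curve_diff_near_eq phi dphi psi dpsi :
  (\forall h \near (0 : 'cV[R]_d), forall t, t \in `[0, T] ->
     phi (th + h) t = psi (th + h) t) ->
  (forall h t, t \in `[0, T] -> dphi h t = dpsi h t) ->
  curve_diff phi dphi -> curve_diff psi dpsi.
Proof.
move=> e1 e2 [h1 h2 [C C0 h3] h4].
have e0 t : t \in `[0, T] -> phi th t = psi th t.
  by move/nbhs_singleton : (e1); rewrite addr0; apply.
split.
- by apply: filterS2 e1 h1 => h hE; apply: cont_on_eq => t tT; rewrite hE.
- by move=> h; apply: cont_on_eq (h2 h) => t tT; rewrite e2.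
- by exists C => // h t tT; rewrite -e2// h3.
- move=> e e_gt0; apply: filterS2 e1 (h4 e e_gt0) => h hE hh t tT.
  by rewrite -hE// -e0// -e2// hh.
Qed.

Lemma curve_diff_eq phi dphi psi dpsi :
  (forall th' t, t \in `[0, T] -> phi th' t = psi th' t) ->
  (forall h t, t \in `[0, T] -> dphi h t = dpsi h t) ->
  curve_diff phi dphi -> curve_diff psi dpsi.
Proof.
move=> e1 e2; apply: curve_diff_near_eq e2.
by apply: filterE => h t; exact: e1.
Qed.

Lemma scalar_diff_near_eq j k dj :
  (\forall h \near (0 : 'cV[R]_d), j (th + h) = k (th + h)) ->
  scalar_diff j dj -> scalar_diff k dj.
Proof.
move=> jk hj e e0; have jk0 : j th = k th.
  by move/nbhs_singleton : (jk); rewrite addr0.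
by apply: filterS2 jk (hj e e0) => h hE; rewrite -hE -jk0.
Qed.

Lemma scalar_diff_eq j k dj dk :
  (forall th', j th' = k th') -> (forall h, dj h = dk h) ->
  scalar_diff j dj -> scalar_diff k dk.
Proof.
move=> jk djk hj e e0; apply: filterS (hj e e0) => h.
by rewrite !jk djk.
Qed.

Lemma curve_diff_cst (f : R -> R) : cont_on 0 T f ->
  curve_diff (fun _ => f) (fun _ _ => 0).
Proof.
move=> fc; split.
- exact: filterE.
- by move=> _; exact: cont_on_cst.
- by exists 1 => // h t _; rewrite normr0 mul1r.
- by move=> e e0; apply: filterE => h t _; rewrite !subrr normr0 mulr_ge0// ltW.
Qed.

Lemma curve_diffD phi dphi psi dpsi :
  curve_diff phi dphi -> curve_diff psi dpsi ->
  curve_diff (fun th' t => phi th' t + psi th' t) (fun h t => dphi h t + dpsi h t).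
Proof.
move=> [f1 f2 [C C0 f3] f4] [g1 g2 [C' C'0 g3] g4]; split.
- by apply: filterS2 f1 g1 => h; exact: cont_onD.
- by move=> h; exact: cont_onD.
- exists (C + C'); first exact: addr_gt0.
  by move=> h t tT; rewrite mulrDl (le_trans (ler_normD _ _))// lerD ?f3 ?g3.
- move=> e e0; have e2 : 0 < e / 2 by rewrite divr_gt0.
  apply: filterS2 (f4 _ e2) (g4 _ e2) => h hf hg t tT.
  have -> : phi (th + h) t + psi (th + h) t - (phi th t + psi th t) - (dphi h t + dpsi h t)
    = (phi (th + h) t - phi th t - dphi h t) + (psi (th + h) t - psi th t - dpsi h t).
    by ring.
  by rewrite (le_trans (ler_normD _ _))// [e]splitr mulrDl lerD ?hf ?hg.
Qed.

Lemma curve_diffM phi dphi psi dpsi :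
  curve_diff phi dphi -> curve_diff psi dpsi ->
  curve_diff (fun th' t => phi th' t * psi th' t)
             (fun h t => phi th t * dpsi h t + dphi h t * psi th t).
Proof.
move=> fd gd; have fc := curve_diff_cont fd; have gc := curve_diff_cont gd.
have [B1 B10 b1] := cont_bounded fc; have [B2 B20 b2] := cont_bounded gc.
have [L1 L10 l1] := curve_diff_lip fd; have [L2 L20 l2] := curve_diff_lip gd.
move: fd gd => [f1 f2 [C C0 f3] f4] [g1 g2 [C' C'0 g3] g4]; split.
- by apply: filterS2 f1 g1 => h; exact: cont_onM.
- by move=> h; apply: cont_onD; exact: cont_onM.
- exists (B1 * C' + C * B2); first by rewrite addr_gt0// mulr_gt0.
  move=> h t tT; rewrite mulrDl (le_trans (ler_normD _ _))// lerD//.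
    by rewrite normrM -mulrA ler_pM ?b1 ?g3.
  by rewrite normrM mulrAC ler_pM ?b2 ?f3.
- move=> e e0; have e3 : 0 < e / 3 by rewrite divr_gt0.
  have L0 : 0 < L1 * L2 by rewrite mulr_gt0.
  have near0 : \forall h \near (0 : 'cV[R]_d), `|h| < e / 3 / (L1 * L2).
    apply/nbhs_normP; exists (e / 3 / (L1 * L2)); first exact: divr_gt0.
    by move=> h; rewrite sub0r normrN.
  near=> h.
  have hf : forall t, t \in `[0, T] ->
      `|phi (th + h) t - phi th t - dphi h t| <= e / 3 / B2 * `|h|.
    by near: h; exact: f4 _ (divr_gt0 e3 B20).
  have hg : forall t, t \in `[0, T] ->
      `|psi (th + h) t - psi th t - dpsi h t| <= e / 3 / B1 * `|h|.
    by near: h; exact: g4 _ (divr_gt0 e3 B10).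
  have lf : forall t, t \in `[0, T] -> `|phi (th + h) t - phi th t| <= L1 * `|h|.
    by near: h.
  have lg : forall t, t \in `[0, T] -> `|psi (th + h) t - psi th t| <= L2 * `|h|.
    by near: h.
  have hs : `|h| < e / 3 / (L1 * L2) by near: h.
  move=> t tT; have {}hf := hf t tT; have {}hg := hg t tT.
  have {}lf := lf t tT; have {}lg := lg t tT.
  have -> : phi (th + h) t * psi (th + h) t - phi th t * psi th t
      - (phi th t * dpsi h t + dphi h t * psi th t)
    = phi th t * (psi (th + h) t - psi th t - dpsi h t)
      + (phi (th + h) t - phi th t - dphi h t) * psi th t
      + (phi (th + h) t - phi th t) * (psi (th + h) t - psi th t) by ring.
  have -> : e * `|h| = e / 3 * `|h| + e / 3 * `|h| + e / 3 * `|h| by field.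
  rewrite (le_trans (ler_normD _ _))// lerD//.
    rewrite (le_trans (ler_normD _ _))// lerD// normrM.
      apply: (@le_trans _ _ (B1 * (e / 3 / B1 * `|h|))); first by rewrite ler_pM// b1.
      by rewrite mulrA mulrCA divff ?gt_eqF// mulr1.
    apply: (@le_trans _ _ ((e / 3 / B2 * `|h|) * B2)); first by rewrite ler_pM// b2.
    by rewrite mulrAC mulfVK ?gt_eqF.
  rewrite normrM; apply: (@le_trans _ _ ((L1 * `|h|) * (L2 * `|h|))); first by rewrite ler_pM.
  rewrite mulrACA mulrA ler_wpM2r// -ler_pdivlMl// mulrC.
  exact: ltW.
Unshelve. all: by end_near. Qed.

Lemma curve_diff_sum (I : Type) (r : seq I) (phi dphi : I -> 'cV[R]_d -> R -> R) :
  (forall i, curve_diff (phi i) (dphi i)) ->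
  curve_diff (fun th' t => \sum_(i <- r) phi i th' t)
             (fun h t => \sum_(i <- r) dphi i h t).
Proof.
move=> H; elim: r => [|i r IH].
  apply: (curve_diff_eq _ _ (curve_diff_cst (@cont_on_cst R 0 T 0))).
    by move=> th' t _; rewrite big_nil.
  by move=> h t _; rewrite big_nil.
apply: (curve_diff_eq _ _ (curve_diffD (H i) IH)).
  by move=> th' t _; rewrite big_cons.
by move=> h t _; rewrite big_cons.
Qed.

Lemma curve_diffZ (f : R -> R) phi dphi : cont_on 0 T f -> curve_diff phi dphi ->
  curve_diff (fun th' t => f t * phi th' t) (fun h t => f t * dphi h t).
Proof.
move=> fc pd; apply: (curve_diff_eq _ _ (curve_diffM (curve_diff_cst fc) pd)) => //.
by move=> h t _; rewrite mul0r addr0.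
Qed.

Lemma curve_diffB phi dphi psi dpsi :
  curve_diff phi dphi -> curve_diff psi dpsi ->
  curve_diff (fun th' t => phi th' t - psi th' t) (fun h t => dphi h t - dpsi h t).
Proof.
move=> fd gd.
apply: (curve_diff_eq _ _ (curve_diffD fd (curve_diffZ (@cont_on_cst R 0 T (-1)) gd))).
  by move=> th' t _; rewrite mulN1r.
by move=> h t _; rewrite mulN1r.
Qed.

Lemma curve_diff_eval phi dphi t : t \in `[0, T] -> curve_diff phi dphi ->
  scalar_diff (fun th' => phi th' t) (fun h => dphi h t).
Proof.
by move=> tT [_ _ _ h] e e0; apply: filterS (h e e0) => h'; apply.
Qed.

Lemma scalar_diffD j dj k dk : scalar_diff j dj -> scalar_diff k dk ->
  scalar_diff (fun th' => j th' + k th') (fun h => dj h + dk h).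
Proof.
move=> hj hk e e0; have e2 : 0 < e / 2 by rewrite divr_gt0.
apply: filterS2 (hj _ e2) (hk _ e2) => h h1 h2.
have -> : j (th + h) + k (th + h) - (j th + k th) - (dj h + dk h)
  = (j (th + h) - j th - dj h) + (k (th + h) - k th - dk h) by ring.
by rewrite (le_trans (ler_normD _ _))// [e]splitr mulrDl lerD.
Qed.

Lemma scalar_diffZ c j dj : scalar_diff j dj ->
  scalar_diff (fun th' => c * j th') (fun h => c * dj h).
Proof.
move=> hj e e0; have c1 : 0 < `|c| + 1 by rewrite ltr_wpDl.
apply: filterS (hj _ (divr_gt0 e0 c1)) => h hh.
rewrite -!mulrBr normrM (le_trans (ler_wpM2l _ hh))//.
rewrite mulrA ler_wpM2r// mulrCA ler_piMr ?(ltW e0)// ler_pdivrMr// mul1r.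
by rewrite lerDl.
Qed.

Lemma scalar_diff_sum (I : Type) (r : seq I) (j dj : I -> 'cV[R]_d -> R) :
  (forall i, scalar_diff (j i) (dj i)) ->
  scalar_diff (fun th' => \sum_(i <- r) j i th') (fun h => \sum_(i <- r) dj i h).
Proof.
move=> H; elim: r => [|i r IH] e e0.
  by apply: filterE => h; rewrite !big_nil !subrr normr0 mulr_ge0// ltW.
by apply: filterS (scalar_diffD (H i) IH e0) => h; rewrite !big_cons.
Qed.

(** The weight is only integrable, so the sup norm on phi is exactly what is needed.
   Tails over [t, T] are those of the cost-to-go; t = 0 gives the integral over [0, T]. *)
Lemma curve_diff_tail_int (w : R -> R) phi dphi : intg 0 T w -> curve_diff phi dphi ->
  curve_diff (fun th' t => sint t T (fun s => w s * phi th' s))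
             (fun h t => sint t T (fun s => w s * dphi h s)).
Proof.
move=> wi pd; have pc := curve_diff_cont pd.
have tail f t : t \in `[0, T] -> intg 0 T f -> intg t T f.
  by rewrite in_itv/= => /andP[t0 tT] fi; apply: intg_sub fi.
have W0 : 0 <= sint 0 T (fun s => `|w s|) by apply: sint_ge0.
pose W := sint 0 T (fun s => `|w s|) + 1; have W1 : 0 < W by rewrite ltr_wpDl.
have bound f c t : 0 <= c -> cont_on 0 T f -> (forall s, s \in `[0, T] -> `|f s| <= c) ->
    t \in `[0, T] -> `|sint t T (fun s => w s * f s)| <= c * W.
  move=> c0 fc fb tT; have := tT; rewrite in_itv/= => /andP[t0 tT'].
  have wi' : intg t T w by exact: tail.
  have wfi : intg t T (fun s => w s * f s) by apply: tail => //; exact: intgM.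
  apply: (le_trans (@sint_mul_le _ _ _ _ _ c wi' wfi _)) => [s|].
    rewrite in_itv/= => /andP[ts sT]; apply: fb.
    by rewrite in_itv/= (le_trans t0 ts).
  rewrite ler_wpM2l// /W (@le_trans _ _ (sint 0 T (fun s => `|w s|))) ?lerDl//.
  by apply: sint_sub => //; exact: intg_norm.
move: pd => [f1 f2 [C C0 f3] f4]; split.
- by apply: filterS f1 => h hc; apply: (cont_tail T0); exact: intgM.
- by move=> h; apply: (cont_tail T0); exact: intgM.
- exists (C * W); first by rewrite mulr_gt0.
  move=> h t tT; rewrite mulrAC; apply: bound => //; first by rewrite mulr_ge0// ltW.
  by move=> s sT; exact: f3.
- move=> e e0; apply: filterS2 f1 (f4 _ (divr_gt0 e0 W1)) => h hc hh t tT.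
  have -> : sint t T (fun s => w s * phi (th + h) s) - sint t T (fun s => w s * phi th s)
      - sint t T (fun s => w s * dphi h s)
    = sint t T (fun s => w s * (phi (th + h) s - phi th s - dphi h s)).
    have i1 : intg t T (fun s => w s * phi (th + h) s) by apply: tail => //; exact: intgM.
    have i2 : intg t T (fun s => w s * phi th s) by apply: tail => //; exact: intgM.
    have i3 : intg t T (fun s => w s * dphi h s) by apply: tail => //; exact: intgM.
    rewrite -sintB// -sintB//; last exact: intgB.
    by apply: eq_sint => s _; rewrite !mulrBr.
  have -> : e * `|h| = (e / W * `|h|) * W by field; rewrite gt_eqF.
  apply: bound => //; first by rewrite mulr_ge0// divr_ge0// ltW.
  by apply: cont_onB => //; exact: cont_onB.
Qed.

Lemma scalar_diff_int (w : R -> R) phi dphi : intg 0 T w -> curve_diff phi dphi ->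
  scalar_diff (fun th' => sint 0 T (fun s => w s * phi th' s))
              (fun h => sint 0 T (fun s => w s * dphi h s)).
Proof.
move=> wi pd; apply: (curve_diff_eval _ (curve_diff_tail_int wi pd)).
by rewrite in_itv/= lexx ltW.
Qed.

Definition vcurve_diff k (phi dphi : 'cV[R]_d -> R -> 'cV[R]_k) : Prop :=
  forall i, curve_diff (fun th' t => phi th' t i 0) (fun h t => dphi h t i 0).

Lemma cont_vec k a b (y : R -> 'cV[R]_k) :
  (forall i, cont_on a b (fun t => y t i 0)) -> {within `[a, b], continuous y}.
Proof.
move=> yc; apply/within_continuousP => x xab e e0.
have : \forall t \near x, forall i, `[a, b]%classic t -> `|y x i 0 - y t i 0| <= e.
  by apply: near_finite => i; move/within_continuousP : (yc i); apply.
apply: filterS => t h tab; apply: ler_mx_norm => [|i j]; first exact: ltW.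
by rewrite !mxE (ord1 j); exact: h.
Qed.

(** Chain rule: path_remainder bounds the error of F at the true increment k of Y, and
   replacing k by dY costs the remainder of Y times the bounded partial derivatives. *)
Lemma curve_diff_comp (F : E -> R) (Y dY : 'cV[R]_d -> R -> 'cV[R]_n) :
  Ck_on 1 (strip T) F -> vcurve_diff Y dY ->
  curve_diff (fun th' t => F (t, th', Y th' t))
             (fun h t => dFxy F (t, th, Y th t) h (dY h t)).
Proof.
move=> F1 YD; have [Fc _] := F1.
have yc : {within `[0, T], continuous (Y th)}.
  by apply: cont_vec => i; exact: curve_diff_cont (YD i).
have ppc j : cont_on 0 T (fun t => pd_param F j (t, th, Y th t)).
  by apply: path_cont => //; have [] := Ck_pd_param j F1.
have psc j : cont_on 0 T (fun t => pd_state F j (t, th, Y th t)).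
  by apply: path_cont => //; have [] := Ck_pd_state j F1.
have /choice[Bp hBp] : forall j : 'I_d, exists c : R, 0 < c /\
    forall t, t \in `[0, T] -> `|pd_param F j (t, th, Y th t)| <= c.
  by move=> j; have [C C0 h] := cont_bounded (ppc j); exists C.
have /choice[Bs hBs] : forall j : 'I_n, exists c : R, 0 < c /\
    forall t, t \in `[0, T] -> `|pd_state F j (t, th, Y th t)| <= c.
  by move=> j; have [C C0 h] := cont_bounded (psc j); exists C.
have /choice[Cy hCy] : forall j : 'I_n, exists c : R, 0 < c /\
    forall h t, t \in `[0, T] -> `|dY h t j 0| <= c * `|h|.
  by move=> j; have [_ _ [C C0 h] _] := YD j; exists C.
have /choice[L hL] : forall j : 'I_n, exists c : R, 0 < c /\
    \forall h \near (0 : 'cV[R]_d), forall t, t \in `[0, T] ->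
      `|Y (th + h) t j 0 - Y th t j 0| <= c * `|h|.
  by move=> j; have [C C0 h] := curve_diff_lip (YD j); exists C.
(* a Lipschitz constant for all components of Y at once *)
pose LL := \sum_j L j.
have LL0 : 0 <= LL by apply: sumr_ge0 => j _; case: (hL j) => /ltW.
have lip : \forall h \near (0 : 'cV[R]_d), forall t, t \in `[0, T] ->
    `|Y (th + h) t - Y th t| <= LL * `|h|.
  have : \forall h \near (0 : 'cV[R]_d), forall j t, t \in `[0, T] ->
      `|Y (th + h) t j 0 - Y th t j 0| <= L j * `|h|.
    by apply: near_finite => j; case: (hL j).
  apply: filterS => h hh t tT; apply: ler_mx_norm => [|i j]; first by rewrite mulr_ge0.
  rewrite !mxE (ord1 j) (le_trans (hh i t tT))// ler_wpM2r// /LL (bigD1 i)//= lerDl.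
  by apply: sumr_ge0 => l _; case: (hL l) => /ltW.
split.
- have : \forall h \near (0 : 'cV[R]_d), forall j, cont_on 0 T (fun t => Y (th + h) t j 0).
    by apply: near_finite => j; case: (YD j).
  by apply: filterS => h hc; apply: path_cont => //; exact: cont_vec.
- move=> h; apply: cont_onD; apply: cont_on_sum => j; apply: cont_onM => //.
    exact: cont_on_cst.
  by case: (YD j).
- exists (\sum_j Bp j + \sum_j Cy j * Bs j + 1).
    rewrite ltr_wpDl// addr_ge0// sumr_ge0// => j _; first by case: (hBp j) => /ltW.
    by rewrite mulr_ge0//; [case: (hCy j) => /ltW|case: (hBs j) => /ltW].
  move=> h t tT; rewrite mulrDl (le_trans (ler_normD _ _))//.
  rewrite -[leLHS]addr0 lerD// ?mul1r// mulrDl lerD//.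
    rewrite mulr_suml (le_trans (ler_norm_sum _ _ _))//; apply: ler_sum => j _.
    rewrite normrM mulrC ler_pM//; last exact: ler_mx_entry.
    by case: (hBp j) => _; apply.
  rewrite mulr_suml (le_trans (ler_norm_sum _ _ _))//; apply: ler_sum => j _.
  rewrite normrM mulrAC ler_pM//; first by case: (hCy j) => _; apply.
  by case: (hBs j) => _; apply.
- move=> e e0; have e2 : 0 < e / 2 by rewrite divr_gt0.
  have L1 : 0 < 1 + LL by rewrite ltr_wpDr.
  have [dl dl0 rem] := path_remainder th F1 yc (divr_gt0 e2 L1).
  pose BB := \sum_j Bs j + 1.
  have BB0 : 0 < BB.
    by rewrite ltr_wpDl// sumr_ge0// => j _; case: (hBs j) => /ltW.
  have yd : \forall h \near (0 : 'cV[R]_d), forall j t, t \in `[0, T] ->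
      `|Y (th + h) t j 0 - Y th t j 0 - dY h t j 0| <= e / 2 / BB * `|h|.
    by apply: near_finite => j; case: (YD j) => _ _ _; apply; exact: divr_gt0.
  have near0 : \forall h \near (0 : 'cV[R]_d), `|h| < dl / (1 + LL).
    apply/nbhs_normP; exists (dl / (1 + LL)); first exact: divr_gt0.
    by move=> h; rewrite sub0r normrN.
  near=> h.
  have hdl : `|h| < dl / (1 + LL).
    by near: h.
  have hdl' : (1 + LL) * `|h| < dl by rewrite mulrC -ltr_pdivlMr.
  have lip' : forall t, t \in `[0, T] -> `|Y (th + h) t - Y th t| <= LL * `|h|.
    by near: h.
  have yd' : forall j t, t \in `[0, T] ->
      `|Y (th + h) t j 0 - Y th t j 0 - dY h t j 0| <= e / 2 / BB * `|h|.
    by near: h.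
  move=> t tT; set k := Y (th + h) t - Y th t.
  have kL : `|k| <= LL * `|h| by exact: lip'.
  have kd j : `|k j 0 - dY h t j 0| <= e / 2 / BB * `|h|.
    by rewrite /k !mxE yd'.
  have r1 : `|F (t, th + h, Y th t + k) - F (t, th, Y th t) - dFxy F (t, th, Y th t) h k|
      <= e / 2 * `|h|.
    apply: (le_trans (rem t h k tT _ _)).
    - by rewrite (le_lt_trans _ hdl')// mulrDl mul1r lerDl mulr_ge0.
    - by rewrite (le_lt_trans kL)// (le_lt_trans _ hdl')// mulrDl mul1r lerDr.
    rewrite mulrAC ler_pdivrMr// -[leRHS]mulrA ler_wpM2l ?(ltW e2)//.
    by rewrite mulrDr mulr1 lerD2l mulrC.
  have r2 : `|dFxy F (t, th, Y th t) h k - dFxy F (t, th, Y th t) h (dY h t)| <= e / 2 * `|h|.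
    rewrite /dFxy opprD addrACA subrr add0r -sumrB (le_trans (ler_norm_sum _ _ _))//.
    apply: (@le_trans _ _ (\sum_j (e / 2 / BB * `|h|) * Bs j)).
      apply: ler_sum => j _; rewrite -mulrBl normrM ler_pM// ?kd//.
      by case: (hBs j) => _; apply.
    rewrite -mulr_sumr mulrAC ler_wpM2r// mulrAC ler_pdivrMr//.
    by rewrite ler_wpM2l ?(ltW e2)// lerDl.
  rewrite [in F _](_ : Y (th + h) t = Y th t + k); last by rewrite /k [RHS]addrC subrK.
  rewrite -[X in `|X|](subrKA (dFxy F (t, th, Y th t) h k)) (le_trans (ler_normD _ _))//.
  by rewrite [e]splitr mulrDl lerD.
Unshelve. all: by end_near. Qed.

End UniformlyDifferentiable.

(** * Inner products and matrix-valued paths *)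

Section DotProduct.
Context {R : realType} {k : nat}.
Implicit Types (x y z : 'cV[R]_k) (a : R).

Lemma dotvE x y : dotv x y = (x^T *m y) 0 0.
Proof. by rewrite /dotv !mxE; apply: eq_bigr => i _; rewrite mxE. Qed.

Lemma dotvC x y : dotv x y = dotv y x.
Proof. by apply: eq_bigr => i _; rewrite mulrC. Qed.

Lemma dotvDl x y z : dotv (x + y) z = dotv x z + dotv y z.
Proof. by rewrite !dotvE linearD mulmxDl mxE. Qed.

Lemma dotvZl a x y : dotv (a *: x) y = a * dotv x y.
Proof. by rewrite !dotvE linearZ /= -scalemxAl mxE. Qed.

Lemma dotvNl x y : dotv (- x) y = - dotv x y.
Proof. by rewrite -scaleN1r dotvZl mulN1r. Qed.

Lemma dotvBl x y z : dotv (x - y) z = dotv x z - dotv y z.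
Proof. by rewrite dotvDl dotvNl. Qed.

Lemma dotvDr x y z : dotv z (x + y) = dotv z x + dotv z y.
Proof. by rewrite !(dotvC z) dotvDl. Qed.

Lemma dotvNr x y : dotv x (- y) = - dotv x y.
Proof. by rewrite !(dotvC x) dotvNl. Qed.

Lemma dotvBr x y z : dotv z (x - y) = dotv z x - dotv z y.
Proof. by rewrite dotvDr dotvNr. Qed.

Lemma dotv0l x : dotv 0 x = 0.
Proof. by rewrite -(scale0r 0) dotvZl mul0r. Qed.

Lemma enorm2_dotv x : enorm x ^+ 2 = dotv x x.
Proof. by rewrite enorm2E; apply: eq_bigr => i _; rewrite big_ord1 expr2. Qed.

End DotProduct.

Lemma dotv_mulr (R : realType) k l (M : 'M[R]_(k, l)) (x : 'cV[R]_k) (y : 'cV[R]_l) :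
  dotv x (M *m y) = dotv (M^T *m x) y.
Proof. by rewrite !dotvE trmx_mul trmxK mulmxA. Qed.

Section MatrixPaths.
Context {R : realType} (T : R).

Definition mcont k l (M : R -> 'M[R]_(k, l)) := forall i j, cont_on 0 T (fun t => M t i j).

Definition mintg k l (M : R -> 'M[R]_(k, l)) := forall i j, intg 0 T (fun t => M t i j).

Lemma mcont_cst k l (M : 'M[R]_(k, l)) : mcont (fun=> M).
Proof. by move=> i j; exact: cont_on_cst. Qed.

Lemma mcontD k l (M N : R -> 'M[R]_(k, l)) : mcont M -> mcont N -> mcont (fun t => M t + N t).
Proof.
move=> Mc Nc i j; apply: (@cont_on_eq _ _ _ (fun t => M t i j + N t i j)).
  by move=> t _; rewrite !mxE.
exact: cont_onD.
Qed.

Lemma mcontZ k l (a : R -> R) (M : R -> 'M[R]_(k, l)) :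
  cont_on 0 T a -> mcont M -> mcont (fun t => a t *: M t).
Proof.
move=> ac Mc i j; apply: (@cont_on_eq _ _ _ (fun t => a t * M t i j)).
  by move=> t _; rewrite !mxE.
exact: cont_onM.
Qed.

Lemma mcontB k l (M N : R -> 'M[R]_(k, l)) : mcont M -> mcont N -> mcont (fun t => M t - N t).
Proof.
move=> Mc Nc i j; apply: (@cont_on_eq _ _ _ (fun t => M t i j - N t i j)).
  by move=> t _; rewrite !mxE.
exact: cont_onB.
Qed.

Lemma mcont_tr k l (M : R -> 'M[R]_(k, l)) : mcont M -> mcont (fun t => (M t)^T).
Proof.
move=> Mc i j; apply: (@cont_on_eq _ _ _ (fun t => M t j i)) => // t _.
by rewrite mxE.
Qed.

Lemma mcontM k l r (M : R -> 'M[R]_(k, l)) (N : R -> 'M[R]_(l, r)) :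
  mcont M -> mcont N -> mcont (fun t => M t *m N t).
Proof.
move=> Mc Nc i j; apply: (@cont_on_eq _ _ _ (fun t => \sum_q M t i q * N t q j)).
  by move=> t _; rewrite mxE.
by apply: cont_on_sum => q; exact: cont_onM.
Qed.

Lemma mcont_vec k (y : R -> 'cV[R]_k) :
  (forall i, cont_on 0 T (fun t => y t i 0)) -> mcont y.
Proof. by move=> yc i j; rewrite (ord1 j). Qed.

Lemma mintg_vec k (y : R -> 'cV[R]_k) :
  (forall i, intg 0 T (fun t => y t i 0)) -> mintg y.
Proof. by move=> yc i j; rewrite (ord1 j). Qed.

Lemma mcont_intg k l (M : R -> 'M[R]_(k, l)) : mcont M -> mintg M.
Proof. by move=> Mc i j; exact: cont_intg. Qed.

Lemma cont_dotv k (x y : R -> 'cV[R]_k) : mcont x -> mcont y ->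
  cont_on 0 T (fun t => dotv (x t) (y t)).
Proof. by move=> xc yc; apply: cont_on_sum => i; exact: cont_onM. Qed.

Lemma intg_dotv k (x y : R -> 'cV[R]_k) : mintg x -> mcont y ->
  intg 0 T (fun t => dotv (x t) (y t)).
Proof. by move=> xi yc; apply: intg_sum => i; exact: intgM. Qed.

Lemma mintgM k l r (M : R -> 'M[R]_(k, l)) (N : R -> 'M[R]_(l, r)) :
  mcont M -> mintg N -> mintg (fun t => M t *m N t).
Proof.
move=> Mc Ni i j; apply: (@intg_eq _ _ _ (fun t => \sum_q N t q j * M t i q)).
  by move=> t _; rewrite mxE; apply: eq_bigr => q _; rewrite mulrC.
by apply: intg_sum => q; exact: intgM.
Qed.

Lemma mintgB k l (M N : R -> 'M[R]_(k, l)) : mintg M -> mintg N -> mintg (fun t => M t - N t).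
Proof.
move=> Mc Nc i j; apply: (@intg_eq _ _ _ (fun t => M t i j - N t i j)).
  by move=> t _; rewrite !mxE.
exact: intgB.
Qed.

Hypothesis T0 : 0 < T.

Lemma primitive_dotv k (z v w u : R -> 'cV[R]_k) :
  (forall i, primitive T (fun t => z t i 0) (fun t => v t i 0)) ->
  (forall i, primitive T (fun t => w t i 0) (fun t => u t i 0)) ->
  dotv (z T) (w T) - dotv (z 0) (w 0) =
  sint 0 T (fun t => dotv (v t) (w t)) + sint 0 T (fun t => dotv (z t) (u t)).
Proof.
move=> zv wu.
have zc i : cont_on 0 T (fun t => z t i 0) by apply: primitive_cont (zv i); exact: ltW.
have wc i : cont_on 0 T (fun t => w t i 0) by apply: primitive_cont (wu i); exact: ltW.
have vi i : intg 0 T (fun t => v t i 0) by case: (zv i).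
have ui i : intg 0 T (fun t => u t i 0) by case: (wu i).
have vw : intg 0 T (fun t => dotv (v t) (w t)).
  by apply: intg_dotv; [exact: mintg_vec|exact: mcont_vec].
have zu : intg 0 T (fun t => dotv (z t) (u t)).
  apply: (@intg_eq _ _ _ (fun t => dotv (u t) (z t))); first by move=> t _; exact: dotvC.
  by apply: intg_dotv; [exact: mintg_vec|exact: mcont_vec].
rewrite -sintD// /dotv -sumrB.
under eq_bigr do rewrite (primitive_mul T0 (zv _) (wu _)).
rewrite -sint_sum => [|i]; last by apply: intgD; exact: intgM.
apply: eq_sint => t _; rewrite -big_split/=; apply: eq_bigr => i _.
by rewrite [u t i 0 * _]mulrC.
Qed.

End MatrixPaths.

Section VectorCurves.
Context {R : realType} (d : nat) (T : R) (T0 : 0 < T) (th : 'cV[R]_d).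

Lemma curve_diff_dotv k (phi dphi psi dpsi : 'cV[R]_d -> R -> 'cV[R]_k) :
  vcurve_diff T th phi dphi -> vcurve_diff T th psi dpsi ->
  curve_diff T th (fun th' t => dotv (phi th' t) (psi th' t))
    (fun h t => dotv (phi th t) (dpsi h t) + dotv (dphi h t) (psi th t)).
Proof.
move=> fd gd.
apply: (curve_diff_eq _ _ (curve_diff_sum _ (fun i => curve_diffM (fd i) (gd i)))) => //.
by move=> h t _; rewrite /dotv -big_split.
Qed.

Lemma vcurve_diffB k (phi dphi psi dpsi : 'cV[R]_d -> R -> 'cV[R]_k) :
  vcurve_diff T th phi dphi -> vcurve_diff T th psi dpsi ->
  vcurve_diff T th (fun th' t => phi th' t - psi th' t) (fun h t => dphi h t - dpsi h t).
Proof.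
move=> fd gd i; apply: (curve_diff_eq _ _ (curve_diffB (fd i) (gd i))).
  by move=> th' t _; rewrite !mxE.
by move=> h t _; rewrite !mxE.
Qed.

Lemma vcurve_diffD k (phi dphi psi dpsi : 'cV[R]_d -> R -> 'cV[R]_k) :
  vcurve_diff T th phi dphi -> vcurve_diff T th psi dpsi ->
  vcurve_diff T th (fun th' t => phi th' t + psi th' t) (fun h t => dphi h t + dpsi h t).
Proof.
move=> fd gd i; apply: (curve_diff_eq _ _ (curve_diffD (fd i) (gd i))).
  by move=> th' t _; rewrite !mxE.
by move=> h t _; rewrite !mxE.
Qed.

Lemma vcurve_diffM k l (A dA : 'cV[R]_d -> R -> 'M[R]_(k, l))
    (phi dphi : 'cV[R]_d -> R -> 'cV[R]_l) :
  (forall i j, curve_diff T th (fun th' t => A th' t i j) (fun h t => dA h t i j)) ->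
  vcurve_diff T th phi dphi ->
  vcurve_diff T th (fun th' t => A th' t *m phi th' t)
    (fun h t => A th t *m dphi h t + dA h t *m phi th t).
Proof.
move=> Ad fd i.
apply: (curve_diff_eq _ _ (curve_diff_sum _ (fun j => curve_diffM (Ad i j) (fd j)))).
  by move=> th' t _; rewrite mxE.
by move=> h t _; rewrite !mxE -big_split.
Qed.

Lemma vcurve_diff_mulmx k l (M : 'M[R]_(k, l)) (phi dphi : 'cV[R]_d -> R -> 'cV[R]_l) :
  vcurve_diff T th phi dphi ->
  vcurve_diff T th (fun th' t => M *m phi th' t) (fun h t => M *m dphi h t).
Proof.
move=> fd i; have Md a b : curve_diff T th (fun _ _ => M a b) (fun _ _ => (0 : 'M[R]_(k, l)) a b).
  apply: (curve_diff_eq _ _ (curve_diff_cst th (@cont_on_cst R 0 T (M a b)))) => //.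
  by move=> h t _; rewrite mxE.
apply: (curve_diff_eq _ _ (vcurve_diffM (A := fun _ _ => M) (dA := fun _ _ => 0) Md fd i)) => //.
by move=> h t _; rewrite mul0mx addr0.
Qed.

Lemma vcurve_cont k (phi dphi : 'cV[R]_d -> R -> 'cV[R]_k) :
  vcurve_diff T th phi dphi -> mcont T (phi th).
Proof. by move=> fd; apply: mcont_vec => i; exact: curve_diff_cont (fd i). Qed.

Lemma vcurve_dcont k (phi dphi : 'cV[R]_d -> R -> 'cV[R]_k) h :
  vcurve_diff T th phi dphi -> mcont T (dphi h).
Proof. by move=> fd; apply: mcont_vec => i; case: (fd i) => _ /(_ h). Qed.

Lemma vcurve_near_cont k (phi dphi : 'cV[R]_d -> R -> 'cV[R]_k) :
  vcurve_diff T th phi dphi -> \forall h \near (0 : 'cV[R]_d), mcont T (phi (th + h)).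
Proof.
move=> fd; have : \forall h \near (0 : 'cV[R]_d), forall i, cont_on 0 T (fun t => phi (th + h) t i 0).
  by apply: near_finite => i; case: (fd i).
by apply: filterS => h; exact: mcont_vec.
Qed.

Lemma curve_diff_tail_dotv k (w : R -> 'cV[R]_k) (phi dphi : 'cV[R]_d -> R -> 'cV[R]_k) :
  mintg T w -> vcurve_diff T th phi dphi ->
  curve_diff T th (fun th' t => sint t T (fun s => dotv (w s) (phi th' s)))
    (fun h t => sint t T (fun s => dotv (w s) (dphi h s))).
Proof.
move=> wi fd.
have tail x t : mcont T x -> t \in `[0, T] ->
    \sum_i sint t T (fun s => w s i 0 * x s i 0) = sint t T (fun s => dotv (w s) (x s)).
  move=> xc; rewrite in_itv/= => /andP[t0 tT]; rewrite /dotv sint_sum// => i.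
  by apply: (@intg_sub _ 0 T) => //; exact: intgM.
apply: (curve_diff_near_eq _ _
  (curve_diff_sum _ (fun i => curve_diff_tail_int T0 (wi i 0) (fd i)))).
- by apply: filterS (vcurve_near_cont fd) => h hc t tT; exact: tail.
- by move=> h t tT; apply: tail => //; exact: vcurve_dcont.
Qed.

Lemma scalar_diff_dotv k (w : R -> 'cV[R]_k) (phi dphi : 'cV[R]_d -> R -> 'cV[R]_k) :
  mintg T w -> vcurve_diff T th phi dphi ->
  scalar_diff th (fun th' => sint 0 T (fun s => dotv (w s) (phi th' s)))
    (fun h => sint 0 T (fun s => dotv (w s) (dphi h s))).
Proof.
move=> wi fd; apply: (curve_diff_eval _ (curve_diff_tail_dotv wi fd)).
by rewrite in_itv/= lexx ltW.
Qed.

End VectorCurves.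

(** * Regularity of the closed-loop data *)

Section SumDerivative.
Context {R : realType} (U : normedModType R).

(** Product rule in the form that matches the entries of matrix products. *)
Lemma is_derive_sumM (l : nat) (a b : 'I_l -> U -> R) (a' b' : 'I_l -> R) (x v : U) :
  (forall i, is_derive x v (a i) (a' i)) -> (forall i, is_derive x v (b i) (b' i)) ->
  is_derive x v (fun z => \sum_i a i z * b i z) (\sum_i (a i x * b' i + b i x * a' i)).
Proof.
move=> da db.
have -> : (fun z => \sum_i a i z * b i z) = \sum_i (a i * b i).
  by apply/funext => z; rewrite fct_sumE.
by apply: is_derive_sum => i; exact: is_deriveM.
Qed.

Lemma is_derive_add (f g : U -> R) (x v : U) (df dg : R) :
  is_derive x v f df -> is_derive x v g dg ->
  is_derive x v (fun z => f z + g z) (df + dg).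
Proof. by move=> ? ?; exact: is_deriveD. Qed.

End SumDerivative.

Section ControlRegularity.
Context (R : realType) (n m d : nat) (P : control_data R n m).
Context (V : 'cV[R]_d -> R -> 'cV[R]_n -> R).
Local Notation T := (horizon P).
Local Notation f := (drift P).
Local Notation g := (control_map P).
Local Notation E := (R * 'cV[R]_d * 'cV[R]_n)%type.
Local Notation F := (feedback P V).
Local Notation A := (Amx P V).

Hypothesis Hf : Ck_on 2 [set z : R * 'cV[R]_n | z.1 \in `[0, T]] (fun z => f z.1 z.2).
Hypothesis Hg : Ck_on 2 [set z : R * 'cV[R]_n | z.1 \in `[0, T]] (fun z => g z.1 z.2).
Hypothesis HV : Ck_on 4 [set: 'cV[R]_d * R * 'cV[R]_n] (fun z => V z.1.1 z.1.2 z.2).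

Lemma drop_param_contraction (z : E) : `|(z.1.1, z.2)| <= `|z|.
Proof.
case: z => -[t th] y; by rewrite !prod_normE /= ge_max !le_max !lexx /= !orbT.
Qed.

Lemma entry_linear k l (i : 'I_k) (j : 'I_l) : linear (fun M : 'M[R]_(k, l) => M i j).
Proof. by move=> a M N; rewrite !mxE. Qed.

Lemma Ck_entry k l (h : R -> 'cV[R]_n -> 'M[R]_(k, l)) i j :
  Ck_on 2 [set z : R * 'cV[R]_n | z.1 \in `[0, T]] (fun z => h z.1 z.2) ->
  Ck_on 2 (strip T) (fun z : E => h z.1.1 z.2 i j).
Proof.
move=> hC; apply: (Ck_on_comp (F := fun z => h z.1 z.2)
  (iota := fun z : E => (z.1.1, z.2)) (phi := fun M : 'M[R]_(k, l) => M i j) _ _ _ _ _ hC).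
- by move=> a u v.
- exact: drop_param_contraction.
- exact: entry_linear.
- by move=> M; exact: ler_mx_entry.
- by move=> x.
Qed.

Lemma Ck_drift i : Ck_on 2 (strip T) (fun z : E => f z.1.1 z.2 i 0).
Proof. exact: Ck_entry. Qed.

Lemma Ck_control_map i j : Ck_on 2 (strip T) (fun z : E => g z.1.1 z.2 i j).
Proof. exact: Ck_entry. Qed.

Definition Vfun (z : E) : R := V z.1.2 z.1.1 z.2.

Lemma Ck_Vfun : Ck_on 4 (strip T) Vfun.
Proof.
apply: (Ck_on_comp (F := fun z => V z.1.1 z.1.2 z.2)
  (iota := fun z : E => (z.1.2, z.1.1, z.2)) (phi := id) _ _ _ _ _ HV) => //.
case=> -[t th] y; by rewrite !prod_normE /= !ge_max !le_max !lexx /= !orbT.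
Qed.

Lemma Ck_gradV i : Ck_on 3 (strip T) (fun z : E => grad (V z.1.2 z.1.1) z.2 i 0).
Proof.
by apply: (Ck_on_eq _ (Ck_pd_state i Ck_Vfun)) => z _; rewrite mxE.
Qed.

Lemma C1_V : Ck_on 1 (strip T) Vfun.
Proof. exact/Ck_on_pred/Ck_on_pred/Ck_on_pred/Ck_Vfun. Qed.

Lemma C1_gradV i : Ck_on 1 (strip T) (fun z : E => grad (V z.1.2 z.1.1) z.2 i 0).
Proof. exact/Ck_on_pred/Ck_on_pred/Ck_gradV. Qed.

Lemma C1_sum (I : Type) (r : seq I) (G : I -> E -> R) :
  (forall i, Ck_on 1 (strip T) (G i)) ->
  Ck_on 1 (strip T) (fun z => \sum_(i <- r) G i z).
Proof.
move=> H; elim: r => [|i r IH].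
  by apply: (Ck_on_eq _ (C1_cst (strip T) 0)) => z _; rewrite big_nil.
by apply: (Ck_on_eq _ (C1D (H i) IH)) => z _; rewrite big_cons.
Qed.

Lemma C1_drift i : Ck_on 1 (strip T) (fun z : E => f z.1.1 z.2 i 0).
Proof. exact/Ck_on_pred/Ck_drift. Qed.

Lemma C1_control_map i j : Ck_on 1 (strip T) (fun z : E => g z.1.1 z.2 i j).
Proof. exact/Ck_on_pred/Ck_control_map. Qed.

Lemma C1_pd_control_map k i j :
  Ck_on 1 (strip T) (fun z : E => pd k (fun y => g z.1.1 y i j) z.2).
Proof. exact: Ck_pd_state (Ck_control_map i j). Qed.

Lemma C1_feedback i : Ck_on 1 (strip T) (fun z : E => F z.1.2 z.1.1 z.2 i 0).
Proof.
have H := C1M (C1_cst (strip T) (- (beta P)^-1))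
  (C1_sum (index_enum 'I_n) (fun j => C1M (C1_control_map j i) (C1_gradV j))).
apply: (Ck_on_eq _ H) => z _; rewrite !mxE; congr (_ * _).
by apply: eq_bigr => j _; rewrite !mxE.
Qed.

(** The right-hand side of the state equation. *)
Definition closed_loop_field (t : R) (th : 'cV[R]_d) (y : 'cV[R]_n) : 'cV[R]_n :=
  f t y + g t y *m F th t y.

Lemma C1_field i : Ck_on 1 (strip T) (fun z : E => closed_loop_field z.1.1 z.1.2 z.2 i 0).
Proof.
have H := C1D (C1_drift i)
  (C1_sum (index_enum 'I_m) (fun j => C1M (C1_control_map i j) (C1_feedback j))).
by apply: (Ck_on_eq _ H) => z _; rewrite !mxE.
Qed.

Lemma C1_Amx k l : Ck_on 1 (strip T) (fun z : E => A z.1.2 z.1.1 z.2 k l).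
Proof.
have H := C1D (Ck_pd_state k (Ck_drift l))
  (C1_sum (index_enum 'I_m) (fun j => C1M (C1_pd_control_map k l j) (C1_feedback j))).
by apply: (Ck_on_eq _ H) => z _; rewrite !mxE.
Qed.

Lemma derive_state (G : E -> R) j t th y : Ck_on 1 (strip T) G -> t \in `[0, T] ->
  is_derive y (delta_mx j 0) (fun z => G (t, th, z)) (pd_state G j (t, th, y)).
Proof. by move=> GC tT; apply: (is_derive_pd_state j GC (x := (t, th, y))). Qed.

Lemma derive_param (G : E -> R) j t th y : Ck_on 1 (strip T) G -> t \in `[0, T] ->
  is_derive th (delta_mx j 0) (fun z => G (t, z, y)) (pd_param G j (t, th, y)).
Proof. by move=> GC tT; apply: (is_derive_pd_param j GC (x := (t, th, y))). Qed.

(** The feedback depends on y, hence the second term; the first one, which comes from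
   f and g alone, is the transpose of the matrix of the adjoint equation. *)
Lemma Jac_field_state t th y : t \in `[0, T] ->
  Jac (closed_loop_field t th) y = (A th t y)^T + g t y *m Jac (F th t) y.
Proof.
move=> tT; apply/matrixP => i k.
have := is_derive_add (derive_state k th y (C1_drift i) tT)
  (is_derive_sumM (fun j => derive_state k th y (C1_control_map i j) tT)
     (fun j => derive_state k th y (C1_feedback j) tT)).
set D := (X in is_derive _ _ _ X) => dD.
have -> : Jac (closed_loop_field t th) y i k = D.
  rewrite mxE; case: dD => _ <-; rewrite /pd; congr ('D_ _ _ _).
  by apply/funext => z; rewrite !mxE.
rewrite !mxE /D -addrA; congr (_ + _); rewrite -big_split/=.
apply: eq_bigr => j _; rewrite !mxE addrC; congr (_ + _).
by rewrite mulrC.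
Qed.

Lemma Jac_field_param t th y : t \in `[0, T] ->
  Jac (fun th' => closed_loop_field t th' y) th =
  g t y *m Jac (fun th' => F th' t y) th.
Proof.
move=> tT; apply/matrixP => i k.
have := is_derive_add (is_derive_cst (f t y i 0) th (delta_mx k 0))
  (is_derive_sumM (fun j => is_derive_cst (g t y i j) th (delta_mx k 0))
     (fun j => derive_param k th y (C1_feedback j) tT)).
set D := (X in is_derive _ _ _ X) => dD.
have -> : Jac (fun th' => closed_loop_field t th' y) th i k = D.
  rewrite mxE; case: dD => _ <-; rewrite /pd; congr ('D_ _ _ _).
  by apply/funext => z; rewrite !mxE.
rewrite /D add0r mxE; apply: eq_bigr => j _; rewrite !mxE.
by rewrite [X in _ + X](_ : _ = 0) ?addr0//; exact: mulr0.
Qed.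

Lemma Jac_Amx_state t th y p k j : t \in `[0, T] ->
  (DyAT P V th t y p)^T k j = \sum_l pd_state (fun z : E => A z.1.2 z.1.1 z.2 k l) j (t, th, y) * p l 0.
Proof.
move=> tT; rewrite /DyAT trmxK mxE.
have := is_derive_sumM (fun l => derive_state j th y (C1_Amx k l) tT)
     (fun l => is_derive_cst (p l 0) y (delta_mx j 0)).
set D := (X in is_derive _ _ _ X) => dD.
transitivity D.
  case: dD => _ <-; rewrite /pd; congr ('D_ _ _ _).
  by apply/funext => z; rewrite !mxE.
rewrite /D; apply: eq_bigr => l _.
by rewrite mulr0 add0r mulrC.
Qed.

(** The parameter enters A through the feedback only. *)
Lemma Jac_Amx_param t th y (p : 'cV[R]_n) k j : t \in `[0, T] ->
  \sum_l pd_param (fun z : E => A z.1.2 z.1.1 z.2 k l) j (t, th, y) * p l 0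
  = \sum_l \sum_q pd k (fun z => g t z l q) y * p l 0
      * (Jac (fun th' => F th' t y) th) q j.
Proof.
move=> tT; apply: eq_bigr => l _.
have := is_derive_add (is_derive_cst (pd k (fun z => f t z l 0) y) th (delta_mx j 0))
  (is_derive_sumM (fun q => is_derive_cst (pd k (fun z => g t z l q) y) th (delta_mx j 0))
     (fun q => derive_param j th y (C1_feedback q) tT)).
set D := (X in is_derive _ _ _ X) => dD.
have -> : pd_param (fun z : E => A z.1.2 z.1.1 z.2 k l) j (t, th, y) = D.
  case: dD => _ <-; rewrite /pd_param /pd; congr ('D_ _ _ _).
  by apply/funext => z; rewrite !mxE.
rewrite /D add0r mulr_suml; apply: eq_bigr => q _; rewrite !mxE.
rewrite [X in _ + X](_ : _ = 0) ?addr0; last exact: mulr0.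
by rewrite mulrAC.
Qed.

Lemma hessian_sym t th y : t \in `[0, T] ->
  (Jac (grad (V th t)) y)^T = Jac (grad (V th t)) y.
Proof.
move=> tT; apply/matrixP => i j; rewrite !mxE.
have F2 : Ck_on 2 (strip T) Vfun by exact/Ck_on_pred/Ck_on_pred/Ck_Vfun.
have gE k : (fun z => grad (V th t) z k 0) = (fun z => pd_state Vfun k (t, th, z)).
  by apply/funext => z; rewrite mxE.
rewrite !gE; exact: (pd_state_sym j i F2 (x := (t, th, y))).
Qed.

End ControlRegularity.

(** * Derivative of the cost *)

Section CurvesInWT.
Context {R : realType} (d n : nat) (T : R) (T0 : 0 < T) (th : 'cV[R]_d).

(** The remainder estimate in the norm of W_T becomes one in the sup norm by
   H1norm_sup; the bound on the derivative comes from its linearity and from the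
   continuity of its values on the canonical basis. *)
Lemma C1_into_WT_curve (U : set 'cV[R]_d) (Y : 'cV[R]_d -> R -> 'cV[R]_n) :
  open U -> U th -> C1_into_WT T U Y -> exists dY, vcurve_diff T th Y dY.
Proof.
move=> Uo Uth [YH [D hD]]; have [DH Dlin Drem _] := hD th Uth.
have Unear := open_near Uo Uth.
have D0 t : t \in `[0, T] -> D th 0 t = 0.
  by move=> tT; have := Dlin (-1) 0 0 t tT; rewrite scaler0 add0r scaleN1r addNr.
have Dc h i : cont_on 0 T (fun t => D th h t i 0) by case: (DH h) => + _; exact: cont_entry.
exists (D th) => i; split.
- by apply: filterS Unear => h /YH[+ _]; exact: cont_entry.
- by move=> h.
- have /choice[C hC] : forall j : 'I_d, exists C : R, 0 < C /\
      forall t, t \in `[0, T] -> `|D th (delta_mx j 0) t i 0| <= C.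
    by move=> j; have [C C0 h] := cont_bounded (Dc (delta_mx j 0) i); exists C.
  have sC : 0 <= \sum_j C j by apply: sumr_ge0 => j _; case: (hC j) => /ltW.
  exists (\sum_j C j + 1); first by rewrite ltr_wpDl.
  move=> h t tT; rewrite (@linear_delta _ _ (fun h => D th h t i 0)); last first.
    by move=> a u v; rewrite Dlin// !mxE.
  rewrite (le_trans (ler_norm_sum _ _ _))// mulrDl mul1r -[leLHS]addr0 lerD//.
  rewrite mulr_suml; apply: ler_sum => j _; rewrite normrM mulrC ler_pM//.
    by case: (hC j) => _; apply.
  exact: ler_mx_entry.
- move=> e e0; pose C := (T^-1 + 1) * ((T + 1) / 2).
  have C0 : 0 < C by rewrite mulr_gt0 ?divr_gt0 ?addr_gt0 ?invr_gt0.
  apply: filterS2 Unear (Drem _ (divr_gt0 e0 C0)) => h hU hh t tT.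
  have [h0|h0] := eqVneq h 0.
    by rewrite h0 addr0 D0// subrr !mxE subrr normr0 normr0 mulr0.
  have zH : H1 0 T (fun t => Y (th + h) t - Y th t - D th h t).
    by apply: H1B => //; apply: H1B => //; exact: YH.
  have a0 : 0 < e / C * `|h| by rewrite mulr_gt0 ?divr_gt0 ?normr_gt0.
  have := H1norm_sup i T0 a0 zH hh tT.
  rewrite -/C !mxE => /le_trans; apply.
  by rewrite mulrA [C * _]mulrCA divff ?gt_eqF// mulr1.
Qed.

Variables (Y dY : 'cV[R]_d -> R -> 'cV[R]_n).
Hypothesis YD : vcurve_diff T th Y dY.
Local Notation E := (R * 'cV[R]_d * 'cV[R]_n)%type.

Lemma vcurve_comp l (G : R -> 'cV[R]_d -> 'cV[R]_n -> 'cV[R]_l) :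
  (forall i, Ck_on 1 (strip T) (fun z : E => G z.1.1 z.1.2 z.2 i 0)) ->
  vcurve_diff T th (fun th' t => G t th' (Y th' t))
    (fun h t => Jac (G t th) (Y th t) *m dY h t
                + Jac (fun th' => G t th' (Y th t)) th *m h).
Proof.
move=> GC i; apply: (curve_diff_eq _ _ (curve_diff_comp (GC i) YD)) => // h t tT.
rewrite !mxE /dFxy addrC; congr (_ + _); apply: eq_bigr => j _; rewrite !mxE mulrC//.
Qed.

Lemma curve_comp (G : R -> 'cV[R]_d -> 'cV[R]_n -> R) :
  Ck_on 1 (strip T) (fun z : E => G z.1.1 z.1.2 z.2) ->
  curve_diff T th (fun th' t => G t th' (Y th' t))
    (fun h t => dotv (grad (G t th) (Y th t)) (dY h t)
                + dotv (grad (fun th' => G t th' (Y th t)) th) h).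
Proof.
move=> GC; apply: (curve_diff_eq _ _ (curve_diff_comp GC YD)) => // h t tT.
by rewrite dFxyE addrC !(dotvC (grad _ _)).
Qed.

Lemma curve_diff_freeze (phi dphi : 'cV[R]_d -> R -> R) :
  curve_diff T th phi dphi ->
  curve_diff T th (fun th' _ => phi th' T) (fun h _ => dphi h T).
Proof.
have TT : T \in `[0, T] by rewrite in_itv/= lexx ltW.
move=> [h1 h2 [C C0 h3] h4]; split.
- by apply: filterE => h; exact: cont_on_cst.
- by move=> h; exact: cont_on_cst.
- by exists C => // h t _; exact: h3.
- by move=> e e0; apply: filterS (h4 e e0) => h hh t _; exact: hh.
Qed.

Lemma vcurve_diff_const k (w : R -> 'cV[R]_k) : mcont T w ->
  vcurve_diff T th (fun _ => w) (fun _ _ => 0).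
Proof.
move=> wc i; apply: (curve_diff_eq _ _ (curve_diff_cst th (wc i 0))) => //.
by move=> h t _; rewrite mxE.
Qed.

End CurvesInWT.

Section CostDerivative.
Context (R : realType) (n m d : nat) (P : control_data R n m).
Context (V : 'cV[R]_d -> R -> 'cV[R]_n -> R).
Local Notation T := (horizon P).
Local Notation f := (drift P).
Local Notation g := (control_map P).
Local Notation E := (R * 'cV[R]_d * 'cV[R]_n)%type.
Local Notation F := (feedback P V).
Local Notation A := (Amx P V).
Local Notation S1 := ((Q1 P)^T *m Q1 P).
Local Notation S2 := ((Q2 P)^T *m Q2 P).

Hypothesis T0 : 0 < T.
Hypothesis ydL2 : L2 0 T (y_d P).
Hypothesis Hf : Ck_on 2 [set z : R * 'cV[R]_n | z.1 \in `[0, T]] (fun z => f z.1 z.2).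
Hypothesis Hg : Ck_on 2 [set z : R * 'cV[R]_n | z.1 \in `[0, T]] (fun z => g z.1 z.2).
Hypothesis HV : Ck_on 4 [set: 'cV[R]_d * R * 'cV[R]_n] (fun z => V z.1.1 z.1.2 z.2).

Variables (th : 'cV[R]_d) (Y dY Pp dP : 'cV[R]_d -> R -> 'cV[R]_n).
Hypothesis YD : vcurve_diff T th Y dY.
Hypothesis PD : vcurve_diff T th Pp dP.

Local Notation y := (Y th).
Local Notation p := (Pp th).
Local Notation DyF t := (Jac (F th t) (y t)).
Local Notation DthF t := (Jac (fun th' => F th' t (y t)) th).

Definition dF h t : 'cV[R]_m := DyF t *m dY h t + DthF t *m h.

Lemma feedback_curve : vcurve_diff T th (fun th' t => F th' t (Y th' t)) dF.
Proof. exact: (vcurve_comp YD (G := fun t th' y => F th' t y) (C1_feedback Hg HV)). Qed.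

Lemma quad_diff k (Q : 'M[R]_k) (phi dphi : 'cV[R]_d -> R -> 'cV[R]_k) :
  Q^T = Q -> vcurve_diff T th phi dphi ->
  curve_diff T th (fun th' t => dotv (phi th' t) (Q *m phi th' t))
    (fun h t => 2 * dotv (Q *m phi th t) (dphi h t)).
Proof.
move=> QT fd; apply: (curve_diff_eq _ _ (curve_diff_dotv fd (vcurve_diff_mulmx Q fd))) => //.
by move=> h t _; rewrite dotv_mulr QT [dotv (dphi h t) _]dotvC mulr2n mulrDl mul1r.
Qed.

Lemma S1_sym : S1^T = S1. Proof. by rewrite trmx_mul trmxK. Qed.
Lemma S2_sym : S2^T = S2. Proof. by rewrite trmx_mul trmxK. Qed.

Lemma enorm_mul k l (Q : 'M[R]_(k, l)) x :
  enorm (Q *m x) ^+ 2 = dotv x ((Q^T *m Q) *m x).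
Proof. by rewrite enorm2_dotv dotv_mulr mulmxA dotvC. Qed.

(** The square is expanded because y_d is only square integrable: its products
   with y become integrals of y against a fixed weight, and its own square is
   integrated separately. *)
Lemma enorm_mulB (Q : 'M[R]_n) x a :
  enorm (Q *m (x - a)) ^+ 2 = dotv x ((Q^T *m Q) *m x)
    - 2 * dotv ((Q^T *m Q) *m a) x + dotv a ((Q^T *m Q) *m a).
Proof.
rewrite enorm_mul mulmxBr !dotvBr !dotvBl.
have -> : dotv a (Q^T *m Q *m x) = dotv (Q^T *m Q *m a) x.
  by rewrite dotv_mulr trmx_mul trmxK.
have -> : dotv x (Q^T *m Q *m a) = dotv (Q^T *m Q *m a) x by rewrite dotvC.
ring.
Qed.

Lemma yd_intg : mintg T (y_d P).
Proof. by apply: mintg_vec => i; exact: L2_intg. Qed.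

Lemma yd_quad_intg : intg 0 T (fun t => dotv (y_d P t) (S1 *m y_d P t)).
Proof.
have [ym _] := ydL2.
have yy i j : intg 0 T (fun t => y_d P t i 0 * y_d P t j 0).
  apply: (@intg_le _ _ _ _ (fun t => enorm (y_d P t) ^+ 2)).
  - exact: measurable_funM.
  - exact: L2_intg_enorm.
  - move=> t _; have := sqr_entry_le (y_d P t) i 0; have := sqr_entry_le (y_d P t) j 0.
    rewrite normrM -(real_normK (num_real (y_d P t i 0))) -(real_normK (num_real (y_d P t j 0))).
    have := sqr_ge0 (`|y_d P t i 0| - `|y_d P t j 0|); nra.
apply: (@intg_eq _ _ _ (fun t => \sum_i \sum_j S1 i j * (y_d P t i 0 * y_d P t j 0))).
  move=> t _; rewrite /dotv; apply: eq_bigr => i _; rewrite [in RHS]mxE mulr_sumr.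
  by apply: eq_bigr => j _; rewrite mulrCA mulrA.
by apply: intg_sum => i; apply: intg_sum => j; exact: intgZ.
Qed.

(** Derivative of half the running cost in direction h; dcost_end is the terminal part. *)
Definition dcost_rate h s : R :=
  dotv (S1 *m (y s - y_d P s)) (dY h s) + beta P * dotv (F th s (y s)) (dF h s).

Definition dcost_end h : R := dotv (S2 *m (y T - y_dT P)) (dY h T).

Lemma dcost_rate_intg h : intg 0 T (dcost_rate h).
Proof.
apply: intgD.
  apply: intg_dotv; last exact: vcurve_dcont YD.
  apply: mintgM; first exact: mcont_cst.
  by apply: mintgB; [exact/mcont_intg/vcurve_cont/YD|exact: yd_intg].
apply: intgZ; apply: intg_dotv.
  exact: mcont_intg (vcurve_cont feedback_curve).
exact: vcurve_dcont feedback_curve.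
Qed.

(** The cost-to-go, expanded by enorm_mulB: a quadratic integrand in the curves y and
   F, an integral of y against the weight w, a constant, and the terminal cost. *)
Lemma cost_curve : curve_diff T th (fun th' t => cl_cost P V th' (Y th') t)
  (fun h t => sint t T (dcost_rate h) + dcost_end h).
Proof.
have one : intg 0 T (fun=> 1) by apply: cont_intg; exact: cont_on_cst.
pose phi th' t := dotv (Y th' t) (S1 *m Y th' t)
                  + beta P * dotv (F th' t (Y th' t)) (1%:M *m F th' t (Y th' t)).
pose dphi h t := 2 * dotv (S1 *m y t) (dY h t)
                  + beta P * (2 * dotv (1%:M *m F th t (y t)) (dF h t)).
have phid : curve_diff T th phi dphi.
  apply: curve_diffD; first exact: quad_diff S1_sym YD.
  apply: curve_diffZ; first exact: cont_on_cst.
  by apply: quad_diff feedback_curve; rewrite trmx1.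
(* the weight of y in the expanded square *)
pose w t : 'cV[R]_n := (-2)%:M *m (S1 *m y_d P t).
have wi : mintg T w.
  by apply: mintgM; [exact: mcont_cst|apply: mintgM; [exact: mcont_cst|exact: yd_intg]].
have c1 := curve_diff_tail_int T0 one phid.
have c2 := curve_diff_tail_dotv T0 wi YD.
pose yq t := sint t T (fun s => dotv (y_d P s) (S1 *m y_d P s)).
have yqc : cont_on 0 T yq by exact: (cont_tail T0 yd_quad_intg).
have c3 := curve_diff_cst th yqc.
have yT : vcurve_diff T th (fun th' t => Y th' t - y_dT P) (fun h t => dY h t - 0).
  by apply: vcurve_diffB => //; apply: vcurve_diff_const; exact: mcont_cst.
have c4 := curve_diff_freeze T0 (quad_diff S2_sym yT).
have half := @cont_on_cst R 0 T 2^-1.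
have := curve_diffD (curve_diffZ half (curve_diffD (curve_diffD c1 c2) c3)) (curve_diffZ half c4).
have sub a t : intg 0 T a -> t \in `[0, T] -> intg t T a.
  by move=> ai; rewrite in_itv/= => /andP[t0 tT]; exact: intg_sub ai.
have wE th' t : dotv (w t) (Y th' t) = - (2 * dotv (S1 *m y_d P t) (Y th' t)).
  by rewrite /w mul_scalar_mx dotvZl mulNr.
apply: curve_diff_near_eq => [|h t tT].
- apply: filterS2 (vcurve_near_cont YD) (vcurve_near_cont feedback_curve) => h Yc Fc t tT.
  rewrite /cl_cost /cost_from enorm_mul; congr (_ * _ + _ * _).
  rewrite /yq -sintD; last 2 first.
  + apply: sub => //; apply: intgM => //; apply: cont_onD.
      by apply: cont_dotv => //; apply: mcontM => //; exact: mcont_cst.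
    apply: cont_onM; first exact: cont_on_cst.
    by apply: cont_dotv => //; apply: mcontM => //; exact: mcont_cst.
  + by apply: sub => //; exact: intg_dotv.
  rewrite -sintD; last 2 first.
  + apply: sub => //; apply: intgD; last exact: intg_dotv.
    apply: intgM => //; apply: cont_onD.
      by apply: cont_dotv => //; apply: mcontM => //; exact: mcont_cst.
    apply: cont_onM; first exact: cont_on_cst.
    by apply: cont_dotv => //; apply: mcontM => //; exact: mcont_cst.
  + by apply: sub => //; exact: yd_quad_intg.
  apply: eq_sint => s _; rewrite mul1r /phi wE enorm_mulB enorm2_dotv mul1mx.
  ring.
- have Yd := vcurve_dcont (h := h) YD; have Fd := vcurve_dcont (h := h) feedback_curve.
  have Yc := vcurve_cont YD; have Fc := vcurve_cont feedback_curve.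
  rewrite addr0 subr0 /dcost_end; congr (_ + _); last first.
    by rewrite mulrA mulVf ?mul1r.
  have i1 : intg 0 T (fun s => 1 * dphi h s).
    apply: intgM => //; apply: cont_onD.
      apply: cont_onM; first exact: cont_on_cst.
      by apply: cont_dotv => //; apply: mcontM => //; exact: mcont_cst.
    do 2 (apply: cont_onM; first exact: cont_on_cst).
    by apply: cont_dotv => //; apply: mcontM => //; exact: mcont_cst.
  have i2 : intg 0 T (fun s => dotv (w s) (dY h s)) by exact: intg_dotv.
  have j1 := sub _ t i1 tT; have j2 := sub _ t i2 tT.
  rewrite -(sintD j1 j2) -(sintZ _ (intgD j1 j2)).
  apply: eq_sint => s _; rewrite /dphi /dcost_rate mul1mx /w mul_scalar_mx (dotvZl (-2)).
  by rewrite mulmxBr dotvBl; field.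
Qed.

Local Notation c t := (cl_cost P V th y t).
Local Notation dyV t := (grad (V th t) (y t)).
Local Notation DyyV t := (Jac (grad (V th t)) (y t)).
Local Notation DythV t := (Jac (fun th' => grad (V th' t) (y t)) th).
Local Notation Vgap t := (V th t (y t) - c t).

Definition dV h t : R := dotv (dyV t) (dY h t) + dotv (grad (fun th' => V th' t (y t)) th) h.
Definition dgradV h t : 'cV[R]_n := DyyV t *m dY h t + DythV t *m h.

Lemma V_curve : curve_diff T th (fun th' t => V th' t (Y th' t)) dV.
Proof. exact: (curve_comp YD (G := fun t th' y => V th' t y) (C1_V P HV)). Qed.

Lemma gradV_curve : vcurve_diff T th (fun th' t => grad (V th' t) (Y th' t)) dgradV.
Proof. exact: (vcurve_comp YD (G := fun t th' y => grad (V th' t) y) (C1_gradV P HV)). Qed.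

Variables gam1 gam2 : R.

Definition dJeps h : R :=
  (sint 0 T (dcost_rate h) + dcost_end h) +
  sint 0 T (fun t => gam1 * (Vgap t * (dV h t - (sint t T (dcost_rate h) + dcost_end h)))
                     + gam2 * dotv (dyV t - p t) (dgradV h t - dP h t)).

Lemma Jeps_diff :
  scalar_diff th (fun th' => Jeps P V gam1 gam2 (Y th') (Pp th') th') dJeps.
Proof.
have one : intg 0 T (fun=> 1) by apply: cont_intg; exact: cont_on_cst.
have gapd := curve_diffB V_curve cost_curve.
have gap2 := curve_diffZ (@cont_on_cst R 0 T (gam1 / 2)) (curve_diffM gapd gapd).
have vd := vcurve_diffB gradV_curve PD.
have v2 := curve_diffZ (@cont_on_cst R 0 T (gam2 / 2)) (curve_diff_dotv vd vd).
have T00 : 0 \in `[0, T] by rewrite in_itv/= lexx ltW.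
apply: (scalar_diff_eq _ _ (scalar_diffD (curve_diff_eval T00 cost_curve)
  (scalar_diff_int T0 one (curve_diffD gap2 v2)))) => [th'|h].
  rewrite /Jeps; congr (_ + _); apply: eq_sint => s _.
  by rewrite mul1r real_normK ?num_real// enorm2_dotv expr2.
rewrite /dJeps; congr (_ + _); apply: eq_sint => s _.
by rewrite mul1r [dotv (dgradV h s - dP h s) _]dotvC; field.
Qed.

End CostDerivative.

(** * Null residuals of the state and adjoint equations *)

Section PointwiseDuality.
Context {R : realType} (n m d : nat).

(** The algebra of the adjoint calculus at a fixed time.  Each operator applied to dy
   or dp is moved to the other side by transposition; the costate right-hand sides are
   chosen so that the resulting coefficients of dy and dp vanish. *)
Lemma pointwise_duality (A S1 DyAT DyyV : 'M[R]_n) (DyF : 'M[R]_(m, n))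
    (DthF : 'M[R]_(m, d)) (g Dgk : 'M[R]_(n, m)) (DythV : 'M[R]_(n, d))
    (DthV h : 'cV[R]_d) (e p kappa zeta dyV dy dp dAp yhat phat : 'cV[R]_n)
    (u : 'cV[R]_m) (gap gam1 gam2 beta Phi : R) :
  S1^T = S1 -> DyyV^T = DyyV ->
  dotv kappa dAp = dotv (DyAT *m kappa) dy + dotv (Dgk^T *m p) (DthF *m h) ->
  yhat = (1 - gam1 * Phi) *: (S1 *m e) + (beta * (1 - gam1 * Phi)) *: (DyF^T *m u)
         + (gam1 * gap) *: dyV + gam2 *: (DyyV *m (dyV - p)) ->
  phat = gam2 *: (p - dyV) ->
  (1 - gam1 * Phi) * (dotv (S1 *m e) dy + beta * dotv u (DyF *m dy + DthF *m h))
  + gam1 * (gap * (dotv dyV dy + dotv DthV h))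
  + gam2 * dotv (dyV - p) (DyyV *m dy + DythV *m h - dp)
  + dotv (- (A *m zeta + DyF^T *m (g^T *m zeta) + DyAT *m kappa + S1 *m kappa + yhat)) dy
  + dotv zeta ((A^T + g *m DyF) *m dy + (g *m DthF) *m h)
  - dotv (A^T *m kappa + phat) dp
  + dotv kappa (A *m dp + dAp + S1 *m dy)
  = gam1 * gap * dotv DthV h + beta * (1 - gam1 * Phi) * dotv u (DthF *m h)
    + gam2 * dotv (dyV - p) (DythV *m h)
    + dotv (g^T *m zeta + Dgk^T *m p) (DthF *m h).
Proof.
move=> S1T VT Ap -> ->.
have Sk : dotv kappa (S1 *m dy) = dotv (S1 *m kappa) dy by rewrite dotv_mulr S1T.
have Ad : dotv kappa (A *m dp) = dotv (A^T *m kappa) dp by rewrite dotv_mulr.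
have uy : dotv u (DyF *m dy) = dotv (DyF^T *m u) dy by rewrite dotv_mulr.
have Vy : dotv (dyV - p) (DyyV *m dy) = dotv (DyyV *m (dyV - p)) dy.
  by rewrite dotv_mulr VT.
have zA : dotv zeta (A^T *m dy) = dotv (A *m zeta) dy by rewrite dotv_mulr trmxK.
have zg : dotv zeta ((g *m DyF) *m dy) = dotv (DyF^T *m (g^T *m zeta)) dy.
  by rewrite dotv_mulr trmx_mul mulmxA.
have zh : dotv zeta ((g *m DthF) *m h) = dotv (g^T *m zeta) (DthF *m h).
  by rewrite -mulmxA dotv_mulr.
have pV : dotv (p - dyV) dp = - dotv (dyV - p) dp by rewrite -(opprB dyV p) dotvNl.
rewrite -(opprB dyV p) in pV *; move: (dyV - p) Vy pV => ev Vy pV.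
rewrite mulmxDl !dotvNl !dotvDl !dotvBr !dotvDr !dotvZl.
rewrite Ap Sk Ad uy Vy zA zg zh pV.
ring.
Qed.

End PointwiseDuality.

Section Residuals.
Context (R : realType) (n m d : nat) (P : control_data R n m).
Context (V : 'cV[R]_d -> R -> 'cV[R]_n -> R).
Local Notation T := (horizon P).
Local Notation f := (drift P).
Local Notation g := (control_map P).
Local Notation E := (R * 'cV[R]_d * 'cV[R]_n)%type.
Local Notation F := (feedback P V).
Local Notation A := (Amx P V).
Local Notation S1 := ((Q1 P)^T *m Q1 P).
Local Notation S2 := ((Q2 P)^T *m Q2 P).

Hypothesis T0 : 0 < T.
Hypothesis ydL2 : L2 0 T (y_d P).
Hypothesis Hf : Ck_on 2 [set z : R * 'cV[R]_n | z.1 \in `[0, T]] (fun z => f z.1 z.2).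
Hypothesis Hg : Ck_on 2 [set z : R * 'cV[R]_n | z.1 \in `[0, T]] (fun z => g z.1 z.2).
Hypothesis HV : Ck_on 4 [set: 'cV[R]_d * R * 'cV[R]_n] (fun z => V z.1.1 z.1.2 z.2).

Variables (th : 'cV[R]_d) (Y dY Pp dP : 'cV[R]_d -> R -> 'cV[R]_n).
Hypothesis YD : vcurve_diff T th Y dY.
Hypothesis PD : vcurve_diff T th Pp dP.
Variable y0 : 'cV[R]_n.
Hypothesis state : \forall h \near (0 : 'cV[R]_d), state_eq P V (th + h) y0 (Y (th + h)).
Hypothesis adjoint : \forall h \near (0 : 'cV[R]_d), adjoint_eq P V (th + h) (Y (th + h)) (Pp (th + h)).

Local Notation y := (Y th).
Local Notation p := (Pp th).

Lemma scalar_diff_at_end (a : 'cV[R]_n) (phi dphi : 'cV[R]_d -> R -> 'cV[R]_n) :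
  vcurve_diff T th phi dphi ->
  scalar_diff th (fun th' => dotv a (phi th' T)) (fun h => dotv a (dphi h T)).
Proof.
move=> fd; have TT : T \in `[0, T] by rewrite in_itv/= lexx ltW.
apply: (scalar_diff_eq _ _ (curve_diff_eval TT (curve_diff_dotv
  (vcurve_diff_const th (@mcont_cst R T _ _ a)) fd))) => // h.
by rewrite dotv0l addr0.
Qed.

Definition dfield h t : 'cV[R]_n :=
  Jac (closed_loop_field P V t th) (y t) *m dY h t
  + Jac (fun th' => closed_loop_field P V t th' (y t)) th *m h.

Lemma field_curve :
  vcurve_diff T th (fun th' t => closed_loop_field P V t th' (Y th' t)) dfield.
Proof.
exact: (vcurve_comp YD (G := fun t th' y => closed_loop_field P V t th' y) (C1_field Hf Hg HV)).
Qed.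

(** After integration by parts the tested state equation reads
   zeta T . y T - (integral of zeta' . y) - (integral of zeta . field) = zeta 0 . y0
   for all parameters, so the derivative of the left-hand side is that of a constant. *)
Lemma state_residual (zeta zeta' : R -> 'cV[R]_n) :
  (forall i, primitive T (fun t => zeta t i 0) (fun t => zeta' t i 0)) ->
  scalar_diff th (fun _ => dotv (zeta 0) y0)
    (fun h => dotv (zeta T) (dY h T)
       - sint 0 T (fun t => dotv (zeta' t) (dY h t))
       - sint 0 T (fun t => dotv (zeta t) (dfield h t))).
Proof.
move=> zp.
have z'i : mintg T zeta' by apply: mintg_vec => i; case: (zp i).
have zi : mintg T zeta.
  by apply: mintg_vec => i; apply/cont_intg/primitive_cont/zp; exact: ltW.
apply: (scalar_diff_near_eq _ (scalar_diff_eq (fun _ => erefl) _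
  (scalar_diffD (scalar_diffD (scalar_diff_at_end (zeta T) YD)
     (scalar_diffZ (-1) (scalar_diff_dotv T0 z'i YD)))
     (scalar_diffZ (-1) (scalar_diff_dotv T0 zi field_curve))))); last first.
  by move=> h; rewrite !mulN1r.
apply: filterS state => h [[Yc _] wY Y0].
have Yp i := wderiv_primitive i T0 Yc wY.
have := primitive_dotv T0 zp Yp; rewrite Y0 !mulN1r => E.
apply/eqP; rewrite -addrA -opprD subr_eq; apply/eqP.
by rewrite -E [RHS]addrC subrK.
Qed.

Definition dA h t : 'M[R]_n :=
  \matrix_(k, l) dFxy (fun z : E => A z.1.2 z.1.1 z.2 k l) (t, th, y t) h (dY h t).

Lemma Ap_curve : vcurve_diff T th (fun th' t => A th' t (Y th' t) *m Pp th' t)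
  (fun h t => A th t (y t) *m dP h t + dA h t *m p t).
Proof.
apply: (vcurve_diffM (A := fun th' t => A th' t (Y th' t))) PD => k l.
apply: (curve_diff_eq _ _ (curve_diff_comp (C1_Amx Hf Hg HV k l) YD)) => //.
by move=> h t _; rewrite mxE.
Qed.

(** The derivative of A p with p frozen has a part in dy, by definition of DyAT, and a
   part through the feedback, in which the sums over states and controls are exchanged
   to bring D_theta F h to one side. *)
Lemma dA_dual h t (kappa : 'cV[R]_n) : t \in `[0, T] ->
  dotv kappa (dA h t *m p t) =
  dotv (DyAT P V th t (y t) (p t) *m kappa) (dY h t)
  + dotv ((Dgdir P t (y t) kappa)^T *m p t)
      (Jac (fun th' => F th' t (y t)) th *m h).
Proof.
move=> tT.
have -> : dA h t *m p t = (DyAT P V th t (y t) (p t))^T *m dY h t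
    + \col_k \sum_j h j 0 * \sum_l \sum_q pd k (fun z => g t z l q) (y t) * p t l 0
        * (Jac (fun th' => F th' t (y t)) th) q j.
  apply/matrixP => k i; rewrite (ord1 i) !mxE.
  under eq_bigr do rewrite mxE /dFxy mulrDl.
  rewrite big_split/= addrC; congr (_ + _).
    under [RHS]eq_bigr do rewrite (Jac_Amx_state Hf Hg HV)// mulr_suml.
    rewrite exchange_big/=; apply: eq_bigr => l _; rewrite mulr_suml.
    by apply: eq_bigr => j _; rewrite -mulrA mulrC.
  under [RHS]eq_bigr do rewrite -(Jac_Amx_param Hg HV)// mulr_sumr.
  rewrite exchange_big/=; apply: eq_bigr => l _; rewrite mulr_suml.
  by apply: eq_bigr => j _; rewrite mulrA.
rewrite dotvDr dotv_mulr trmxK; congr (_ + _).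
set J := Jac _ th; pose G k l q : R := pd k (fun z => g t z l q) (y t).
transitivity (\sum_k kappa k 0 * \sum_l \sum_q G k l q * p t l 0 * (J *m h) q 0).
  apply: eq_bigr => k _; rewrite mxE; congr (_ * _).
  under eq_bigr do rewrite mulr_sumr.
  rewrite exchange_big/=; apply: eq_bigr => l _.
  under eq_bigr do rewrite mulr_sumr.
  rewrite exchange_big/=; apply: eq_bigr => q _; rewrite mxE mulr_sumr.
  by apply: eq_bigr => j _; rewrite /G mulrC mulrA.
under eq_bigr do rewrite mulr_sumr.
rewrite exchange_big/=.
under eq_bigr do under eq_bigr do rewrite mulr_sumr.
under eq_bigr do rewrite exchange_big/=.
rewrite exchange_big/= /dotv; apply: eq_bigr => q _.
rewrite [in RHS]mxE mulr_suml; apply: eq_bigr => l _.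
rewrite !mxE !mulr_suml; apply: eq_bigr => k _.
by rewrite -/(G k l q); ring.
Qed.

(** The same for the adjoint equation tested with kappa.  Since kappa vanishes at 0
   and p is prescribed at T, the boundary terms involve y T only; the terms with y_d do
   not depend on the parameter and form the constant c. *)
Lemma adjoint_residual (kappa kappa' : R -> 'cV[R]_n) :
  (forall i, primitive T (fun t => kappa t i 0) (fun t => kappa' t i 0)) ->
  kappa 0 = 0 ->
  exists c : R, scalar_diff th (fun _ => c)
    (fun h => dotv (kappa T) (S2 *m dY h T)
       - sint 0 T (fun t => dotv (kappa' t) (dP h t))
       + sint 0 T (fun t => dotv (kappa t)
           (A th t (y t) *m dP h t + dA h t *m p t + S1 *m dY h t))).
Proof.
move=> kp k0.
have kc : mcont T kappa.
  by apply: mcont_vec => i; apply: primitive_cont (kp i); exact: ltW.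
have ki := mcont_intg kc.
have k'i : mintg T kappa' by apply: mintg_vec => i; case: (kp i).
have S2Y := vcurve_diff_mulmx S2 YD.
have ApS : vcurve_diff T th (fun th' t => A th' t (Y th' t) *m Pp th' t + S1 *m Y th' t)
    (fun h t => A th t (y t) *m dP h t + dA h t *m p t + S1 *m dY h t).
  exact: vcurve_diffD Ap_curve (vcurve_diff_mulmx S1 YD).
exists (dotv (kappa T) (S2 *m y_dT P) + sint 0 T (fun t => dotv (kappa t) (S1 *m y_d P t))).
apply: (scalar_diff_near_eq _ (scalar_diff_eq (fun _ => erefl) _
  (scalar_diffD (scalar_diffD (scalar_diff_at_end (kappa T) S2Y)
     (scalar_diffZ (-1) (scalar_diff_dotv T0 k'i PD)))
     (scalar_diff_dotv T0 ki ApS)))); last by move=> h; rewrite mulN1r.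
apply: filterS3 adjoint (vcurve_near_cont Ap_curve) (vcurve_near_cont YD).
move=> h [[Pc _] wP PT] Apc Yc.
have Pprim i := wderiv_primitive i T0 Pc wP.
have := primitive_dotv T0 kp Pprim; rewrite PT k0 dotv0l subr0 mulmxBr dotvBr => E.
have i1 : intg 0 T (fun t => dotv (kappa t) (A (th + h) t (Y (th + h) t) *m Pp (th + h) t
    + S1 *m Y (th + h) t)).
  apply/cont_intg/cont_dotv => //; apply: mcontD => //; apply: mcontM => //; exact: mcont_cst.
have i2 : intg 0 T (fun t => dotv (S1 *m y_d P t) (kappa t)).
  apply: intg_dotv => //; apply: mintgM; first exact: mcont_cst.
  by apply: mintg_vec => i; exact: L2_intg.
have -> : sint 0 T (fun t => dotv (kappa t) (S1 *m y_d P t))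
    = sint 0 T (fun t => dotv (S1 *m y_d P t) (kappa t)).
  by apply: eq_sint => t _; exact: dotvC.
have E2 : sint 0 T (fun t => dotv (kappa t) (- (A (th + h) t (Y (th + h) t) *m Pp (th + h) t
    + S1 *m (Y (th + h) t - y_d P t)))) =
  sint 0 T (fun t => dotv (S1 *m y_d P t) (kappa t))
  - sint 0 T (fun t => dotv (kappa t) (A (th + h) t (Y (th + h) t) *m Pp (th + h) t
    + S1 *m Y (th + h) t)).
  rewrite -sintB//; apply: eq_sint => t _.
  by rewrite mulmxBr addrA dotvNr dotvBr opprB [dotv (kappa t) (S1 *m y_d P t)]dotvC.
by rewrite E2 in E; lra.
Qed.

End Residuals.

(** * The gradient for one trajectory *)

Section LinearCombination.
Context {R : realType} (T : R).

Lemma sint_lin4 (c1 c2 c3 c4 : R) (f1 f2 f3 f4 : R -> R) :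
  intg 0 T f1 -> intg 0 T f2 -> intg 0 T f3 -> intg 0 T f4 ->
  sint 0 T (fun t => c1 * f1 t + c2 * f2 t + c3 * f3 t + c4 * f4 t) =
  c1 * sint 0 T f1 + c2 * sint 0 T f2 + c3 * sint 0 T f3 + c4 * sint 0 T f4.
Proof.
move=> i1 i2 i3 i4.
have j1 := intgZ c1 i1; have j2 := intgZ c2 i2; have j3 := intgZ c3 i3; have j4 := intgZ c4 i4.
by rewrite (sintD (intgD (intgD j1 j2) j3) j4) (sintD (intgD j1 j2) j3) (sintD j1 j2) !sintZ.
Qed.

End LinearCombination.

Section ReducedGradient.
Context (R : realType) (n m d : nat) (P : control_data R n m).
Context (V : 'cV[R]_d -> R -> 'cV[R]_n -> R) (ip : 'cV[R]_d -> 'cV[R]_d -> R).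
Local Notation T := (horizon P).
Local Notation f := (drift P).
Local Notation g := (control_map P).
Local Notation E := (R * 'cV[R]_d * 'cV[R]_n)%type.
Local Notation F := (feedback P V).
Local Notation A := (Amx P V).
Local Notation S1 := ((Q1 P)^T *m Q1 P).
Local Notation S2 := ((Q2 P)^T *m Q2 P).

Hypothesis ipP : inner_product ip.
Hypothesis T0 : 0 < T.
Hypothesis ydL2 : L2 0 T (y_d P).
Hypothesis Hf : Ck_on 2 [set z : R * 'cV[R]_n | z.1 \in `[0, T]] (fun z => f z.1 z.2).
Hypothesis Hg : Ck_on 2 [set z : R * 'cV[R]_n | z.1 \in `[0, T]] (fun z => g z.1 z.2).
Hypothesis HV : Ck_on 4 [set: 'cV[R]_d * R * 'cV[R]_n] (fun z => V z.1.1 z.1.2 z.2).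

Variables (th : 'cV[R]_d) (Y dY Pp dP : 'cV[R]_d -> R -> 'cV[R]_n).
Hypothesis YD : vcurve_diff T th Y dY.
Hypothesis PD : vcurve_diff T th Pp dP.
Variable y0 : 'cV[R]_n.
Hypothesis state : \forall h \near (0 : 'cV[R]_d), state_eq P V (th + h) y0 (Y (th + h)).
Hypothesis adjoint : \forall h \near (0 : 'cV[R]_d), adjoint_eq P V (th + h) (Y (th + h)) (Pp (th + h)).
Variables (gam1 gam2 : R) (zeta kappa : R -> 'cV[R]_n).
Local Notation y := (Y th).
Local Notation p := (Pp th).
Hypothesis costate : costate_eqs P V gam1 gam2 th y p zeta kappa.

Local Notation DyF t := (Jac (F th t) (y t)).
Local Notation DthF t := (Jac (fun th' => F th' t (y t)) th).
Local Notation dyV t := (grad (V th t) (y t)).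
Local Notation DyyV t := (Jac (grad (V th t)) (y t)).
Local Notation DthV t := (grad (fun th' => V th' t (y t)) th).
Local Notation DythV t := (Jac (fun th' => grad (V th' t) (y t)) th).
Local Notation Vgap t := (V th t (y t) - cl_cost P V th y t).
Local Notation Phi := (Phi P V th y).
Local Notation w t := ((g t (y t))^T *m zeta t + (Dgdir P t (y t) (kappa t))^T *m p t).

Let zeta' t := - (A th t (y t) *m zeta t + (DyF t)^T *m ((g t (y t))^T *m zeta t)
  + DyAT P V th t (y t) (p t) *m kappa t + S1 *m kappa t
  + yhat P V gam1 gam2 th y p t).
Let kappa' t := (A th t (y t))^T *m kappa t + phat V gam2 th y p t.

Lemma zeta_primitive i : primitive T (fun t => zeta t i 0) (fun t => zeta' t i 0).
Proof. by case: costate => -[[zc _] _] wz _ _ _; exact: wderiv_primitive. Qed.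

Lemma kappa_primitive i : primitive T (fun t => kappa t i 0) (fun t => kappa' t i 0).
Proof. by case: costate => -[_ [kc _]] _ wk _ _; exact: wderiv_primitive. Qed.

Lemma zeta_cont : mcont T zeta.
Proof.
apply: mcont_vec => i; apply: primitive_cont (zeta_primitive i); exact: ltW.
Qed.

Lemma kappa_cont : mcont T kappa.
Proof.
apply: mcont_vec => i; apply: primitive_cont (kappa_primitive i); exact: ltW.
Qed.

Lemma y_continuous : {within `[0, T], continuous y}.
Proof. by apply: cont_vec => i; exact: curve_diff_cont (YD i). Qed.

Lemma Jac_param_cont l (G : R -> 'cV[R]_d -> 'cV[R]_n -> 'cV[R]_l) :
  (forall i, Ck_on 1 (strip T) (fun z : E => G z.1.1 z.1.2 z.2 i 0)) ->
  mcont T (fun t => Jac (fun th' => G t th' (y t)) th).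
Proof.
move=> GC i j; apply: (@cont_on_eq _ _ _
  (fun t => pd_param (fun z : E => G z.1.1 z.1.2 z.2 i 0) j (t, th, y t))).
  by move=> t _; rewrite mxE.
by apply: path_cont; [exact: y_continuous|case: (Ck_pd_param j (GC i))].
Qed.

Lemma Vgap_cont : cont_on 0 T (fun t => Vgap t).
Proof.
have H := curve_diffB (V_curve HV YD) (cost_curve T0 ydL2 Hg HV YD).
exact: curve_diff_cont H.
Qed.

Lemma Phi_cont : cont_on 0 T Phi.
Proof.
apply: primitive_cont (primitive_sint (cont_intg Vgap_cont)); exact: ltW.
Qed.

Lemma costate_weight_cont : mcont T (fun t => w t).
Proof.
have gc : mcont T (fun t => g t (y t)).
  move=> i j; have [gC _] := C1_control_map d Hg i j.
  by have := path_cont (th := th) y_continuous gC.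
have pc := vcurve_cont PD.
apply: mcontD; apply: mcontM => //; try exact: zeta_cont; apply: mcont_tr => //.
move=> i j; apply: (@cont_on_eq _ _ _
  (fun t => \sum_k pd k (fun z => g t z i j) (y t) * kappa t k 0)).
  by move=> t _; rewrite mxE.
apply: cont_on_sum => k; apply: cont_onM; last exact: kappa_cont.
have [gC _] := C1_pd_control_map d Hg k i j.
by have := path_cont (th := th) y_continuous gC.
Qed.

Lemma ip_vint (u : R -> 'cV[R]_d) h : mintg T u ->
  ip (vint 0 T u) h = sint 0 T (fun t => ip (u t) h).
Proof.
move=> ui; rewrite (inner_productE ipP).
transitivity (sint 0 T (fun t => dotv (u t) (gram ip *m h))).
  rewrite /dotv sint_sum => [|i].
    by apply: eq_bigr => i _; rewrite mxE mulrC -sintZ//; apply: eq_sint => t _; rewrite mulrC.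
  by apply: intgM => //; exact: cont_on_cst.
by apply: eq_sint => t _; rewrite (inner_productE ipP).
Qed.

(** What is left of the total derivative once the terms in dy and dp have cancelled. *)
Definition gradient_density h t : R :=
  gam1 * Vgap t * dotv (DthV t) h
  + beta P * (1 - gam1 * Phi t) * dotv (F th t (y t)) (DthF t *m h)
  + gam2 * dotv (dyV t - p t) (DythV t *m h)
  + dotv (w t) (DthF t *m h).

Lemma adj_cont k (M : R -> 'M[R]_(k, d)) : mcont T M -> mcont T (fun t => adj ip (M t)).
Proof. by move=> Mc; apply: mcontM; [exact: mcont_cst|exact: mcont_tr]. Qed.

Lemma ip_gradient h :
  ip (DthetaF_adj P ip V th y (fun t => w t) + thetahat P ip V gam1 gam2 th y p) h
  = sint 0 T (gradient_density h).
Proof.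
have DthFc : mcont T (fun t => DthF t).
  exact: (Jac_param_cont (G := fun t th' y => F th' t y) (C1_feedback Hg HV)).
have DythVc : mcont T (fun t => DythV t).
  exact: (Jac_param_cont (G := fun t th' y => grad (V th' t) y) (C1_gradV P HV)).
have DthVc : mcont T (fun t => (DthV t)^T).
  apply: mcont_tr; apply: mcont_vec => j.
  apply: (@cont_on_eq _ _ _ (fun t => pd_param (Vfun V) j (t, th, y t))).
    by move=> t _; rewrite mxE.
  by apply: path_cont; [exact: y_continuous|case: (Ck_pd_param j (C1_V P HV))].
have Fc := vcurve_cont (feedback_curve Hg HV YD).
have gVc := vcurve_cont (gradV_curve HV YD).
have pc := vcurve_cont PD.
have c1 : cont_on 0 T (fun t => gam1 * Vgap t).
  by apply: cont_onM; [exact: cont_on_cst|exact: Vgap_cont].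
have c2 : cont_on 0 T (fun t => beta P * (1 - gam1 * Phi t)).
  apply: cont_onM; first exact: cont_on_cst.
  apply: cont_onB; first exact: cont_on_cst.
  by apply: cont_onM; [exact: cont_on_cst|exact: Phi_cont].
have u1c : mcont T (fun t => adj ip (DthF t) *m w t).
  by apply: mcontM; [exact: adj_cont|exact: costate_weight_cont].
have [_ ipl _] := ipP.
have ipD a b : ip (a + b) h = ip a h + ip b h.
  by have := ipl 1 a b h; rewrite scale1r mul1r.
have ip0 : ip 0 h = 0.
  by have := ipl (-1) 0 0 h; rewrite scaler0 addr0 mulN1r addNr.
have ipZ a b : ip (a *: b) h = a * ip b h.
  by have := ipl a b 0 h; rewrite addr0 ip0 addr0.
have u2c : mcont T (fun t => (gam1 * Vgap t) *: adj ip (DthV t)^T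
    + (beta P * (1 - gam1 * Phi t)) *: (adj ip (DthF t) *m F th t (y t))
    + gam2 *: (adj ip (DythV t) *m (dyV t - p t))).
  apply: mcontD; last first.
    apply: mcontZ; first exact: cont_on_cst.
    by apply: mcontM; [exact: adj_cont|exact: mcontB].
  apply: mcontD; apply: mcontZ => //; first exact: adj_cont.
  by apply: mcontM => //; exact: adj_cont.
rewrite ipD /DthetaF_adj /thetahat !ip_vint//; try exact: mcont_intg.
rewrite -sintD; last 2 first.
- apply: cont_intg; apply: (@cont_on_eq _ _ _ (fun t => dotv (adj ip (DthF t) *m w t) (gram ip *m h))).
    by move=> t _; rewrite (inner_productE ipP).
  by apply: cont_dotv => //; exact: mcont_cst.
- apply: cont_intg; apply: (@cont_on_eq _ _ _ (fun t => dotv ((gam1 * Vgap t) *: adj ip (DthV t)^T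
    + (beta P * (1 - gam1 * Phi t)) *: (adj ip (DthF t) *m F th t (y t))
    + gam2 *: (adj ip (DythV t) *m (dyV t - p t))) (gram ip *m h))).
    by move=> t _; rewrite (inner_productE ipP).
  by apply: cont_dotv => //; exact: mcont_cst.
apply: eq_sint => t _; rewrite !ipD !ipZ !adjP// /gradient_density addrC.
congr (_ + _); congr (_ + _); congr (_ + _); congr (_ * _).
(* a column of height one, so that adjP applies with k = 1 *)
have -> : adj ip (DthV t)^T = adj ip (DthV t)^T *m (1%:M : 'cV[R]_1) by rewrite mulmx1.
rewrite adjP//; rewrite /dotv big_ord1 !mxE eqxx mul1r.
by apply: eq_bigr => i _; rewrite mxE.
Qed.

Local Notation r h := (dcost_rate P V th Y dY h).
Local Notation q h := (dcost_end P th Y dY h).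

(** Exchange of the order of integration on the triangle s <= t, obtained by
   integrating by parts: the product of the primitive of a and the tail of r vanishes at
   both ends. *)
Lemma tail_fubini (a r : R -> R) : cont_on 0 T a -> intg 0 T r ->
  sint 0 T (fun t => a t * sint t T r) = sint 0 T (fun t => r t * sint 0 t a).
Proof.
move=> ac ri; have ai := cont_intg ac.
have Ap := primitive_sint ai.
have Rp : primitive T (fun t => sint t T r) (fun t => - r t).
  split=> [|s t s0 st tT]; first exact: intgN.
  have ri' : intg s T r by apply: intg_sub ri.
  rewrite (@sint_cat _ s t T) ?st//.
  have ri2 : intg s t r by apply: intg_sub ri.
  by rewrite sintN// opprD addrCA subrr addr0.
have := primitive_mul T0 Ap Rp.
rewrite !sintxx mulr0 mul0r subrr => E0.
have Ac := primitive_cont (ltW T0) Ap; have Rc := primitive_cont (ltW T0) Rp.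
have i1 : intg 0 T (fun t => a t * sint t T r) by exact: intgM.
have i2 : intg 0 T (fun t => r t * sint 0 t a) by exact: intgM.
apply/eqP; rewrite -subr_eq0 -sintB//; apply/eqP; rewrite [RHS]E0.
by apply: eq_sint => t _; rewrite mulNr.
Qed.

(** Integrand of the derivative of J_eps once the tails of the cost-to-go are
   absorbed by tail_fubini, which turns the weight of the running cost into
   1 - gam1 * Phi. *)
Definition cost_density h t : R :=
  (1 - gam1 * Phi t) * r h t + gam1 * (Vgap t * dV V th Y dY h t)
  + gam2 * dotv (dyV t - p t) (dgradV V th Y dY h t - dP h t).

Let dVc h : cont_on 0 T (dV V th Y dY h).
Proof. by case: (V_curve HV YD) => _ /(_ h). Qed.

Let dotDc h : cont_on 0 T (fun t => dotv (dyV t - p t) (dgradV V th Y dY h t - dP h t)).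
Proof.
have gVc := vcurve_cont (gradV_curve HV YD).
have pc := vcurve_cont PD.
have gVd := vcurve_dcont (h := h) (gradV_curve HV YD).
have pd := vcurve_dcont (h := h) PD.
by apply: cont_dotv; exact: mcontB.
Qed.

Lemma cost_density_intg h : intg 0 T (cost_density h).
Proof.
have ri := dcost_rate_intg ydL2 Hg HV YD h.
apply: intgD; last by apply: intgZ; exact: cont_intg.
apply: intgD; last by apply/intgZ/cont_intg/cont_onM => //; exact: Vgap_cont.
apply: (@intg_eq _ _ _ (fun t => r h t * (1 - gam1 * Phi t))).
  by move=> t _; rewrite mulrC.
apply: intgM => //; apply: cont_onB; first exact: cont_on_cst.
by apply: cont_onM; [exact: cont_on_cst|exact: Phi_cont].
Qed.

Lemma dJepsE h : dJeps P V th Y dY Pp dP gam1 gam2 h =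
  sint 0 T (cost_density h) + (1 - gam1 * Phi T) * q h.
Proof.
have ri := dcost_rate_intg ydL2 Hg HV YD h.
have gapc := Vgap_cont; have gapi := cont_intg gapc.
have Rc := cont_tail T0 ri.
have i1 : intg 0 T (fun t => Vgap t * dV V th Y dY h t) by exact: intgM.
have i2 : intg 0 T (fun t => Vgap t * sint t T (r h)) by exact: intgM.
have i4 := cont_intg (@dotDc h).
have i5 : intg 0 T (fun t => r h t * Phi t) by apply: intgM => //; exact: Phi_cont.
have E1 : sint 0 T (fun t =>
    gam1 * (Vgap t * (dV V th Y dY h t - (sint t T (r h) + q h)))
    + gam2 * dotv (dyV t - p t) (dgradV V th Y dY h t - dP h t))
  = gam1 * sint 0 T (fun t => Vgap t * dV V th Y dY h t)
    + (- gam1) * sint 0 T (fun t => Vgap t * sint t T (r h))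
    + (- (gam1 * q h)) * sint 0 T (fun t => Vgap t)
    + gam2 * sint 0 T (fun t => dotv (dyV t - p t) (dgradV V th Y dY h t - dP h t)).
  by rewrite -sint_lin4//; apply: eq_sint => t _; ring.
have E2 : sint 0 T (cost_density h) = 1 * sint 0 T (r h)
    + (- gam1) * sint 0 T (fun t => r h t * Phi t)
    + gam1 * sint 0 T (fun t => Vgap t * dV V th Y dY h t)
    + gam2 * sint 0 T (fun t => dotv (dyV t - p t) (dgradV V th Y dY h t - dP h t)).
  by rewrite -sint_lin4//; apply: eq_sint => t _; rewrite /cost_density; ring.
rewrite /dJeps E1 E2 (tail_fubini gapc ri) -/(Phi T).
ring.
Qed.

(** The boundary terms cancel by the terminal condition of zeta, the integrands
   by pointwise_duality. *)
Lemma duality_identity h :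
  dJeps P V th Y dY Pp dP gam1 gam2 h
  - (dotv (zeta T) (dY h T)
     - sint 0 T (fun t => dotv (zeta' t) (dY h t))
     - sint 0 T (fun t => dotv (zeta t) (dfield P V th Y dY h t)))
  + (dotv (kappa T) (S2 *m dY h T)
     - sint 0 T (fun t => dotv (kappa' t) (dP h t))
     + sint 0 T (fun t => dotv (kappa t)
         (A th t (y t) *m dP h t + dA P V th Y dY h t *m p t + S1 *m dY h t)))
  = sint 0 T (gradient_density h).
Proof.
have Yd := vcurve_dcont (h := h) YD; have Pd := vcurve_dcont (h := h) PD.
have i0 := cost_density_intg h.
have i1 : intg 0 T (fun t => dotv (zeta' t) (dY h t)).
  by apply: intg_dotv => //; apply: mintg_vec => i; case: (zeta_primitive i).
have i2 : intg 0 T (fun t => dotv (zeta t) (dfield P V th Y dY h t)).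
  apply/cont_intg/cont_dotv; first exact: zeta_cont.
  exact: vcurve_dcont (field_curve Hf Hg HV YD).
have i3 : intg 0 T (fun t => dotv (kappa' t) (dP h t)).
  by apply: intg_dotv => //; apply: mintg_vec => i; case: (kappa_primitive i).
have i4 : intg 0 T (fun t => dotv (kappa t)
         (A th t (y t) *m dP h t + dA P V th Y dY h t *m p t + S1 *m dY h t)).
  apply/cont_intg/cont_dotv; first exact: kappa_cont.
  apply: mcontD; first exact: vcurve_dcont (Ap_curve Hf Hg HV YD PD).
  by apply: mcontM => //; exact: mcont_cst.
have bnd : (1 - gam1 * Phi T) * q h - dotv (zeta T) (dY h T)
    + dotv (kappa T) (S2 *m dY h T) = 0.
  case: costate => _ _ _ -> _; rewrite /yhatT dotvDl dotvZl -/(Phi T) /dcost_end.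
  by rewrite [dotv (kappa T) _]dotv_mulr S2_sym; ring.
have -> : sint 0 T (gradient_density h) =
   sint 0 T (cost_density h) + sint 0 T (fun t => dotv (zeta' t) (dY h t))
   + sint 0 T (fun t => dotv (zeta t) (dfield P V th Y dY h t))
   - sint 0 T (fun t => dotv (kappa' t) (dP h t))
   + sint 0 T (fun t => dotv (kappa t)
         (A th t (y t) *m dP h t + dA P V th Y dY h t *m p t + S1 *m dY h t)).
  rewrite -(sintD i0 i1) -(sintD (intgD i0 i1) i2) -(sintB (intgD (intgD i0 i1) i2) i3).
  rewrite -(sintD (intgB (intgD (intgD i0 i1) i2) i3) i4).
  apply: eq_sint => t tT; apply/esym.
  rewrite /cost_density /dfield Jac_field_state// Jac_field_param//.
  apply: pointwise_duality.
  - exact: S1_sym.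
  - exact: (hessian_sym HV _ _ tT).
  - exact: (dA_dual Hf Hg HV).
  - by [].
  - by [].
rewrite dJepsE; move: bnd.
set a1 := sint 0 T (cost_density h); set a2 := sint 0 T _.
lra.
Qed.

(** The derivatives of constants are o(h) and may be added freely. *)
Lemma scalar_diff_null (j dj : 'cV[R]_d -> R) (c c' : R) (s s' : 'cV[R]_d -> R) :
  scalar_diff th j dj -> scalar_diff th (fun _ => c) s -> scalar_diff th (fun _ => c') s' ->
  scalar_diff th j (fun h => dj h - s h + s' h).
Proof.
move=> jd sd sd' e e0.
apply: filterS (scalar_diffD (scalar_diffD jd (scalar_diffZ (-1) sd)) sd' e0) => h.
by apply: le_trans; rewrite le_eqVlt; apply/orP; left; apply/eqP; congr (`|_|); ring.
Qed.

Lemma Jeps_gradient :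
  scalar_diff th (fun th' => Jeps P V gam1 gam2 (Y th') (Pp th') th')
    (fun h => ip (DthetaF_adj P ip V th y (fun t => w t)
                  + thetahat P ip V gam1 gam2 th y p) h).
Proof.
have s1 := state_residual T0 Hf Hg HV YD state zeta_primitive.
have k0 : kappa 0 = 0 by case: costate.
have [c s2] := adjoint_residual T0 ydL2 Hf Hg HV YD PD adjoint kappa_primitive k0.
have := scalar_diff_null (Jeps_diff T0 ydL2 Hg HV YD PD gam1 gam2) s1 s2.
apply: scalar_diff_eq => // h.
by rewrite ip_gradient -duality_identity.
Qed.

End ReducedGradient.

(** * Riesz representation and the gradient formula *)

Section RieszGradient.
Context (R : realType) (d : nat) (ip : 'cV[R]_d -> 'cV[R]_d -> R).
Hypothesis ipP : inner_product ip.
Implicit Types (x y v h : 'cV[R]_d).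

Lemma ip_linear v : linear (ip v : 'cV[R]_d -> R).
Proof.
by have [ipC ipl _] := ipP => a x y; rewrite ipC ipl !(ipC _ v).
Qed.

Lemma ip_bound : exists2 C : R, 0 < C & forall x y, `|ip x y| <= C * (`|x| * `|y|).
Proof.
pose C := \sum_i \sum_j `|gram ip i j|.
have C0 : 0 <= C by apply: sumr_ge0 => i _; apply: sumr_ge0.
exists (C + 1) => [|x y]; first by rewrite ltr_wpDl.
have xy0 : 0 <= `|x| * `|y| by rewrite mulr_ge0.
rewrite mulrDl mul1r -[leLHS]addr0 lerD// (inner_productE ipP) /dotv.
rewrite (le_trans (ler_norm_sum _ _ _))// mulr_suml; apply: ler_sum => i _.
rewrite [in leLHS]mxE normrM mulrC mulr_suml.
apply: (@le_trans _ _ ((\sum_j `|gram ip i j * y j 0|) * `|x|)).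
  by rewrite ler_pM//; [exact: ler_norm_sum|exact: ler_mx_entry].
rewrite mulr_suml; apply: ler_sum => j _; rewrite normrM -mulrA ler_wpM2l// mulrC.
by rewrite ler_wpM2l// ler_mx_entry.
Qed.

Lemma sqnorm_diff (th : 'cV[R]_d) c :
  scalar_diff th (fun th' => c / 2 * ip th' th') (fun h => c * ip th h).
Proof.
have [C C0 hC] := ip_bound; move=> e e0.
pose b := `|c / 2| + 1; have b0 : 0 < b by rewrite ltr_wpDl.
pose D := b * C; have D0 : 0 < D by rewrite mulr_gt0.
apply/nbhs_normP; exists (e / D); first exact: divr_gt0.
move=> h; rewrite sub0r normrN ltr_pdivlMr// => hD.
have [ipC ipl _] := ipP.
have ipD x y z : ip (x + y) z = ip x z + ip y z.
  by have := ipl 1 x y z; rewrite scale1r mul1r.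
have -> : c / 2 * ip (th + h) (th + h) - c / 2 * ip th th - c * ip th h = c / 2 * ip h h.
  by rewrite ipD !(ipC _ (th + h)) !ipD (ipC h th); field.
rewrite normrM; apply: (@le_trans _ _ (b * (C * (`|h| * `|h|)))).
  by rewrite ler_pM// lerDl.
have -> : b * (C * (`|h| * `|h|)) = (`|h| * D) * `|h| by rewrite /D; ring.
by rewrite ler_wpM2r// ltW.
Qed.

(** The form h |-> ip v h is linear and continuous, so the o(h) expansion identifies
   it with the differential. *)
Lemma scalar_diff_gradient (J : 'cV[R]_d -> R) x v :
  scalar_diff x J (ip v) -> is_gradient ip J x v.
Proof.
move=> H.
pose L : {linear 'cV[R]_d -> R} :=
  HB.pack (ip v : 'cV[R]_d -> R) (GRing.isLinear.Build _ _ _ _ _ (ip_linear v)).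
have [C C0 hC] := ip_bound.
have Lc : continuous L.
  have Cv : 0 < C * (`|v| + 1) by rewrite mulr_gt0// ltr_wpDl.
  apply: (bounded_linear_continuous (ip_linear v) Cv) => h.
  rewrite (le_trans (hC _ _))// mulrA ler_wpM2r// ler_wpM2l ?(ltW C0)//.
  by rewrite lerDl.
have E : J \o shift x = cst (J x) + L +o_ (0 : 'cV[R]_d) id.
  apply/eqaddoP => e e0; have := H e e0; apply: filterS => h.
  apply: le_trans; rewrite le_eqVlt; apply/orP; left; apply/eqP; congr (`|_|).
  by rewrite -addrA -opprD [x + h]addrC.
have dE : 'd J x = L :> ('cV[R]_d -> R) by apply: diff_unique.
split; last by move=> h; rewrite dE.
by apply/diff_locallyP; rewrite dE.
Qed.

End RieszGradient.

Theorem theorem23 (R : realType) (n m : nat) (P : control_data R n m)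
    (Y0 : set 'cV[R]_n) (M : R) (eps0 : R) (A : value_family R n)
    (eps : R) (N : nat) (y0s : 'I_N -> 'cV[R]_n) (om : 'I_N -> R)
    (gam1 gam2 game : R)
    (ys ps : 'I_N -> R -> 'cV[R]_n) (th0 : 'cV[R]_(param_dim A eps))
    (U : set 'cV[R]_(param_dim A eps))
    (Ym Pm : 'I_N -> 'cV[R]_(param_dim A eps) -> R -> 'cV[R]_n)
    (th : 'cV[R]_(param_dim A eps)) (zeta kappa : 'I_N -> R -> 'cV[R]_n) :
  let T := horizon P in
  let g := control_map P in
  let V := V_approx A eps in
  let ipe := param_ip A eps in
  control_data_ok P ->
  compact Y0 ->
  regularity_assumption P Y0 M ->
  approximation_assumption P M eps0 A ->
  0 < eps <= eps0 ->
  (forall i, Y0 (y0s i)) ->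
  (forall i, 0 < om i) ->
  0 <= gam1 -> 0 <= gam2 -> 0 < game ->
  admissible P V y0s ys ps th0 ->
  solution_maps P V y0s ys ps th0 U Ym Pm ->
  U th ->
  (forall i, costate_eqs P V gam1 gam2 th (Ym i th) (Pm i th) (zeta i) (kappa i)) ->
  is_gradient ipe (JN P ipe V om gam1 gam2 game Ym Pm) th
    (\sum_(i < N) om i *:
       (DthetaF_adj P ipe V th (Ym i th)
          (fun t => (g t (Ym i th t))^T *m zeta i t
                    + (Dgdir P t (Ym i th t) (kappa i t))^T *m Pm i th t)
        + thetahat P ipe V gam1 gam2 th (Ym i th) (Pm i th))
     + game *: th).
Proof.
move=> T g V ipe [T0 _ _ _ ydL2] _ [[[Hf _ _] [Hg _ _]] _ _] [_ approx _] heps.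
move=> _ _ _ _ _ _ [[Uo _] YPC1 _ adm] Uth costate.
have [ipP0 HV _] := approx eps heps.
have ipP : inner_product ipe := ipP0.
have Unear := open_near Uo Uth.
apply: scalar_diff_gradient => //.
have term i : scalar_diff th
    (fun th' => om i * Jeps P V gam1 gam2 (Ym i th') (Pm i th') th')
    (fun h => om i * ipe (DthetaF_adj P ipe V th (Ym i th)
          (fun t => (g t (Ym i th t))^T *m zeta i t
                    + (Dgdir P t (Ym i th t) (kappa i t))^T *m Pm i th t)
        + thetahat P ipe V gam1 gam2 th (Ym i th) (Pm i th)) h).
  apply: scalar_diffZ.
  have [YC PC] := YPC1 i.
  have [dY YD] := C1_into_WT_curve T0 Uo Uth YC.
  have [dP PD] := C1_into_WT_curve T0 Uo Uth PC.
  have state : \forall h \near (0 : 'cV[R]_(param_dim A eps)),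
      state_eq P V (th + h) (y0s i) (Ym i (th + h)).
    by apply: filterS Unear => h /adm /(_ i) [].
  have adjoint : \forall h \near (0 : 'cV[R]_(param_dim A eps)),
      adjoint_eq P V (th + h) (Ym i (th + h)) (Pm i (th + h)).
    by apply: filterS Unear => h /adm /(_ i) [].
  exact: (Jeps_gradient ipP T0 ydL2 Hf Hg HV YD PD state adjoint (costate i)).
apply: (scalar_diff_eq _ _ (scalar_diffD (scalar_diff_sum (index_enum 'I_N) term)
  (sqnorm_diff ipP th game))) => // h.
have ipsum (r : seq 'I_N) (c : 'I_N -> R) (v : 'I_N -> 'cV[R]_(param_dim A eps)) :
    \sum_(i <- r) c i * ipe (v i) h = ipe (\sum_(i <- r) c i *: v i) h.
  have [ipC _ _] := ipP; rewrite [RHS]ipC.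
  elim: r => [|i r IH]; first by rewrite !big_nil (linear_0 (ip_linear ipP h)).
  by rewrite !big_cons IH (ip_linear ipP h) (ipC _ h).
have [_ ipl _] := ipP.
by rewrite ipsum [in RHS]addrC ipl addrC.
Qed.
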